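(* Let $\Gamma$ be a metric graph, $K$ a finite group acting isometrically on $\Gamma$ and $D$ a $K$-invariant effective divisor on $\Gamma$. Let $\phi_{|D|^K}$ be the rational map from $\Gamma$ to a tropical projective space associated to the $K$-invariant linear system $|D|^K$. Then $\phi_{|D|^K}$ induces a $K$-Galois covering $\Gamma\to\mathrm{Im}(\phi_{|D|^K})$, with edge-multiplicities equal to $1$ on all edges of $\Gamma$ and equal to $|K_e|$ on the image of an edge $e$, if and only if $\phi_{|D|^K}$ maps distinct $K$-orbits to distinct points.
   Context: Metric graph: the underlying ($\infty$-)metric space of an edge-weighted graph $(G,l)$, where $G$ is a finite connected nonempty multigraph (loops allowed) and $l:E(G)\to\mathbb{R}_{>0}\cup\{\infty\}$ may take the value $\infty$ only on leaf edges (edges adjacent to a vertex of valence one). Each edge $e$ is identified with $[0,l(e)]$; if $l(e)=\infty$ the leaf end of $e$ is identified with $\infty$ and is called a point at infinity. $(G,l)$ is called a model, a loopless model if $G$ has no loops. A half-edge of a point $x$ is a connected component of $U\setminus\{x\}$ for a sufficiently small connected neighborhood $U$ of $x$. A divisor is an element $D=\sum D(x)\cdot x$ of the free abelian group on the points of $\Gamma$; effective means all $D(x)\ge0$; $K$-invariant means $D(\sigma(x))=D(x)$ for $\sigma\in K$. A rational function is the constant $-\infty$ or a piecewise linear function with integer slopes and finitely many pieces, taking values $\pm\infty$ only at points at infinity. For $f\not\equiv-\infty$, $\mathrm{div}(f)=\sum_x\mathrm{ord}_x(f)\cdot x$, with $\mathrm{ord}_x(f)$ the sum of outgoing slopes of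 $f$ at $x$ ($0$ if $\Gamma$ is a singleton). $R(D)=\{f\not\equiv-\infty: D+\mathrm{div}(f)\ge0\}\cup\{-\infty\}$, $R(D)^K=\{f\in R(D): f\circ\sigma=f\ \forall\sigma\in K\}$; $R(D)^K$ is a finitely generated tropical semimodule over $\boldsymbol{T}=(\mathbb{R}\cup\{-\infty\},\oplus=\max,\odot=+)$ under pointwise operations. $|D|^K$ is the set of $K$-invariant effective divisors linearly equivalent to $D$, identified with $R(D)^K$ modulo additive constants. $\boldsymbol{TP}^{n-1}=(\boldsymbol{T}^{n}\setminus\{(-\infty,\dots,-\infty)\})/\sim$, where $\boldsymbol{x}\sim\boldsymbol{y}$ iff $\boldsymbol{x}=\boldsymbol{y}+(\lambda,\dots,\lambda)$ for some real $\lambda$. For a minimal generating set $\{f_1,\dots,f_n\}$ of $R(D)^K$ (unique up to order and additive constants), $\phi_{|D|^K}(x)=(f_1(x):\cdots:f_n(x))\in\boldsymbol{TP}^{n-1}$ (extended continuously at points at infinity). Lattice length: if $u\ne v$ have real coordinates and $(u_j-u_i)-(v_j-v_i)=\lambda w_j$ for all $j$, with $\lambda>0$ and $w$ an integer vector with entries of greatest common divisor $1$, their distance is $\lambda$ (independent of $i$); it is $\infty$ for segments reaching coordinates $-\infty$. The image is regarded as a metric graph by giving the image of each segment on which all $f_i$ are linear its lattice length. Morphism: a continuous map $\varphi:\Gamma\to\Gamma'$ of metric graphs for which there are models $(G,l),(G',l')$ with $\varphi(V(G))\subset V(G')$, such that the inverse image of the relative interior of each edge of $G'$ is the union of relative interiors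 of finitely many edges of $G$, and $\varphi$ on each edge $e$ of $G$ is a dilation by an integer factor $\deg_e(\varphi)\ge0$. Finite: all $\deg_e(\varphi)>0$. For a half-edge $h\subset e$, $\deg_h(\varphi)=\deg_e(\varphi)$. With loopless models and edge-multiplicity functions $m:E(G)\to\mathbb{Z}_{>0}$, $m':E(G')\to\mathbb{Z}_{>0}$ (with $m'(\varphi(e))=0$ if $e$ is contracted) and $\Gamma'$ not a singleton, $\varphi$ is harmonic at $x$ if $m(e_1)\mid m'(\varphi(e_1))$ for each edge $e_1$ adjacent to $x$ and $\deg_x^{m,m'}(\varphi)=\sum_h\frac{m'(\varphi(e))}{m(e)}\deg_h(\varphi)$ is independent of the half-edge $h'$ at $\varphi(x)$, where $h$ runs over the half-edges of $x$ mapped to $h'$ and $e\supset h$. Harmonic: harmonic at all points; $\deg^{m,m'}(\varphi)=\sum_{x\in\varphi^{-1}(x')}\deg_x^{m,m'}(\varphi)$, independent of $x'$. If only $\Gamma'$ is a singleton, $\varphi$ is harmonic of degree $0$; if both are singletons, it is regarded as harmonic of any degree. $\varphi$ is a $K$-Galois covering with edge-multiplicities $m,m'$ if it is a finite harmonic morphism with respect to $m,m'$, $\deg^{m,m'}(\varphi)=|K|$, $K$ acts transitively on every fibre, and $K$ preserves the edge-multiplicities. In the claim, the models are some loopless models of $\Gamma$ and of the image (part of what is asserted to exist), $m\equiv1$, and $m'(e')=|K_e|$ where $e$ is any edge of $\Gamma$'s model with image $e'$ and $K_e$ is the stabilizer of $e$ in $K$. *)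

(* Defs.v *)
From HB Require Import structures.
From mathcomp Require Import all_boot all_order all_algebra.
From mathcomp Require Import all_fingroup.
From mathcomp Require Import finmap.
From mathcomp Require Import all_classical all_reals.
From mathcomp Require Import ereal topology normedtype.

Set Implicit Arguments.
Unset Strict Implicit.
Unset Printing Implicit Defensive.

Import Order.TTheory GRing.Theory Num.Theory.

Local Open Scope classical_set_scope.
Local Open Scope ring_scope.

Definition valence (V E : finType) (src tgt : E -> V) (v : V) : nat :=
  (#|[set e | src e == v]%SET| + #|[set e | tgt e == v]%SET|)%N.

Definition adjacent (V E : finType) (src tgt : E -> V) : rel V :=
  fun u v => [exists e, ((src e == u) && (tgt e == v)) ||
                        ((src e == v) && (tgt e == u))].

(* Edges carry an arbitrary orientation, subject to one normalization: an edge
   of infinite length is oriented towards its leaf end, so that the point at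
   infinity sits at parameter [+oo]. *)
Record wgraph (R : realType) := WGraph {
  vertex : finType;
  edge : finType;
  src : edge -> vertex;
  tgt : edge -> vertex;
  len : edge -> \bar R;
  vertex_nonempty : (0 < #|vertex|)%N;
  connected_graph : forall u v, connect (adjacent src tgt) u v;
  len_gt0 : forall e, (0 < len e)%E;
  infinite_leaf : forall e, len e = +oo%E -> valence src tgt (tgt e) = 1%N
}.

Definition edge_dom (R : realType) (G : wgraph R) (e : edge G) : set (\bar R) :=
  [set t | (0 <= t <= len e)%E].

Definition loopless (R : realType) (G : wgraph R) : Prop :=
  forall e : edge G, src e != tgt e.

Inductive chain (R : realType) (X : Type) (step : X -> X -> \bar R -> Prop) :
    X -> X -> \bar R -> Prop :=
| chain_nil x : chain step x x 0%E
| chain_cons x y z r s :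
    step x y r -> chain step y z s -> chain step x z (r + s)%E.

(* The largest pseudometric (with values in [0, +oo]) for which [step x y r]
   forces the distance from [x] to [y] to be at most [r]. *)
Definition chain_dist (R : realType) (X : Type)
    (step : X -> X -> \bar R -> Prop) (x y : X) : \bar R :=
  ereal_inf [set r | chain step x y r].

(* In an edge parametrized by [0, len e], the points at parameters [s] and [t]
   are at distance |s - t| along the edge. *)
Definition edge_step (R : realType) (G : wgraph R) (X : Type)
    (emap : edge G -> \bar R -> X) (x y : X) (r : \bar R) : Prop :=
  exists e s t, [/\ edge_dom e s, edge_dom e t, emap e s = x, emap e t = y
                  & r = `|s - t|%E].

(* A model of the space [X] with distance [d]: a weighted graph with an
   identification of [X], as a topological and as a metric space, with the
   quotient of the disjoint union of the intervals [0, len e].  The topology is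
   recorded besides the distance because points at infinity are at distance
   [+oo] from everything else, so [d] does not see which ray they close. *)
Record model (R : realType) (X : topologicalType) (d : X -> X -> \bar R) :=
  Model {
  mgraph :> wgraph R;
  vmap : vertex mgraph -> X;
  emap : edge mgraph -> \bar R -> X;
  emap_src : forall e, emap e 0%E = vmap (src e);
  emap_tgt : forall e, emap e (len e) = vmap (tgt e);
  vmap_inj : injective vmap;
  emap_vmap : forall e t v, (0 < t < len e)%E -> emap e t <> vmap v;
  emap_inj : forall e t e' t', (0 < t < len e)%E -> (0 < t' < len e')%E ->
        emap e t = emap e' t' -> e = e' /\ t = t';
  model_cover : forall x, (exists v, x = vmap v) \/
                (exists e t, (0 < t < len e)%E /\ x = emap e t);
  model_open : forall U : set X, open U <->
        (forall e, exists W : set (\bar R),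
           open W /\ forall t, edge_dom e t -> (U (emap e t) <-> W t));
  model_dist : forall x y, d x y = chain_dist (edge_step emap) x y
}.

Arguments vmap {R X d} m.
Arguments emap {R X d} m.

(* [refmodel] is the model through which piecewise linearity and slopes are
   expressed below; the notions do not depend on its choice. *)
Record metricGraph (R : realType) := MetricGraph {
  points :> topologicalType;
  dist : points -> points -> \bar R;
  refmodel : model dist
}.

Definition is_singleton (X : Type) : Prop := forall x y : X, x = y.

Definition at_infinity (R : realType) (Gamma : metricGraph R) (x : Gamma) :
    Prop :=
  exists e : edge (refmodel Gamma),
    len e = +oo%E /\ emap (refmodel Gamma) e +oo%E = x.

Section Models.
Variables (R : realType) (X : topologicalType) (d : X -> X -> \bar R).
Variable M : model d.

Definition edge_set (e : edge M) : set X := emap M e @` edge_dom e.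

Definition edge_interior (e : edge M) : set X :=
  emap M e @` [set t | (0 < t < len e)%E].

(* A half-edge at [x] is a germ of edge leaving [x]; it is encoded by an edge
   [e] through [x] and the side of [x] on which it lies: [(e, true)] for
   increasing parameter, [(e, false)] for decreasing parameter.  A vertex with
   a loop thus gets two half-edges from it, and a point inside an edge two. *)
Definition half_edge := (edge M * bool)%type.

Definition half_pos (h : half_edge) (x : X) (t : \bar R) : Prop :=
  emap M h.1 t = x /\
  (if h.2 then (0 <= t < len h.1)%E else (0 < t <= len h.1)%E).

Definition half_at (h : half_edge) (x : X) : Prop := exists t, half_pos h x t.

Definition half_nbhs (b : bool) (t : \bar R) : set_system (\bar R) :=
  within [set s | if b then (t < s)%E else (s < t)%E] (nbhs t).

Definition is_outgoing_slope (f : X -> \bar R) (h : half_edge) (x : X)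
    (k : int) : Prop :=
  exists2 t, half_pos h x t &
    exists c : R, \forall s \near half_nbhs h.2 t,
      f (emap M h.1 s) =
      (c%:E + ((if h.2 then k else - k)%:~R : R)%:E * s)%E.

Definition outgoing_slope (f : X -> \bar R) (h : half_edge) (x : X) : int :=
  xget 0 [set k | is_outgoing_slope f h x k].

Definition ord_at (f : X -> \bar R) (x : X) : int :=
  \sum_(h : half_edge | `[< half_at h x >]) outgoing_slope f h x.

(* At a point at infinity this uses c + k * (+oo), which is c for k = 0. *)
Definition linear_on (f : X -> \bar R) (e : edge M) (A : set (\bar R)) : Prop :=
  exists (c : R) (k : int),
    forall t, A t -> f (emap M e t) = (c%:E + (k%:~R : R)%:E * t)%E.

End Models.

Section LinearSystem.
Variables (R : realType) (Gamma : metricGraph R).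
Let M := refmodel Gamma.

Definition divisor := {fsfun Gamma -> int with 0}.

Definition effective (D : divisor) : Prop := forall x, 0 <= D x.

(* Rational functions other than the constant -oo; [B] is a finite set of
   break points. *)
Definition piecewise_linear (f : Gamma -> \bar R) : Prop :=
  (forall x, ~ at_infinity x -> f x \is a fin_num) /\
  exists2 B : set Gamma, finite_set B &
    forall (e : edge M) s t, (0 <= s)%E -> (s <= t)%E -> (t <= len e)%E ->
      (forall u, (s < u < t)%E -> ~ B (emap M e u)) ->
      linear_on (M := M) f e [set u | (s <= u <= t)%E].

Definition RD (D : divisor) : set (Gamma -> \bar R) :=
  [set f | f = (fun=> -oo%E) \/
           piecewise_linear f /\ forall x, 0 <= D x + ord_at M f x].

Variables (K : finGroupType) (to : {action K &-> Gamma}).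

Definition acts_isometrically : Prop :=
  forall a : K, continuous (fun x : Gamma => to x a : Gamma) /\
    forall x y : Gamma, dist (to x a) (to y a) = dist x y.

Definition invariant_divisor (D : divisor) : Prop :=
  forall (a : K) (x : Gamma), D (to x a) = D x.

Definition RDK (D : divisor) : set (Gamma -> \bar R) :=
  [set f | RD D f /\ forall (a : K) (x : Gamma), f (to x a) = f x].

End LinearSystem.

Definition trop_generates (R : realType) (X : Type) (n : nat)
    (f : 'I_n -> X -> \bar R) (J : {set 'I_n}) (S : set (X -> \bar R)) : Prop :=
  forall g, S g -> exists a : 'I_n -> \bar R, (forall i, a i <> +oo%E) /\
    forall x, g x = \big[maxe/-oo%E]_(i in J) (a i + f i x)%E.

Definition min_generating (R : realType) (X : Type) (n : nat)
    (f : 'I_n -> X -> \bar R) (S : set (X -> \bar R)) : Prop :=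
  [/\ forall i, S (f i), trop_generates f [set: 'I_n]%SET S
    & forall J : {set 'I_n}, trop_generates f J S -> J = [set: 'I_n]%SET].

Section TropicalProjectiveSpace.
Variables (R : realType) (n : nat).

Definition trop_nonzero : set 'rV[\bar R]_n :=
  [set v | (forall i, v ord0 i <> +oo%E) /\ exists i, v ord0 i <> -oo%E].

Definition tp_rel (u v : trop_nonzero) : bool :=
  `[< exists c : R, forall i, (val u ord0 i = val v ord0 i + c%:E)%E >].

Lemma tp_rel_equiv : equiv_class_of tp_rel.
Proof.
split.
- by move=> u; apply/asboolP; exists 0 => i; rewrite adde0.
- have sym u v : tp_rel u v -> tp_rel v u.
    move=> /asboolP[c h]; apply/asboolP; exists (- c) => i.
    by rewrite h -addeA -EFinD subrr adde0.
  by move=> u v; apply/idP/idP; apply: sym.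
- move=> v u w /asboolP[c h] /asboolP[c' h']; apply/asboolP.
  by exists (c' + c) => i; rewrite h h' -addeA -EFinD.
Qed.

Canonical tp_equiv := EquivRelPack tp_rel_equiv.

(* Tropical projective space with [n] homogeneous coordinates, i.e. of
   dimension n - 1, as a topological quotient. *)
Definition TP : topologicalType :=
  quotient_topology {eq_quot tp_equiv}%qT.

Definition hom_coords (p : TP) (v : 'rV[\bar R]_n) : Prop :=
  exists2 u : trop_nonzero, val u = v & p = (\pi_{eq_quot tp_equiv} u)%qT.

Definition real_coords (p : TP) (u : 'rV[R]_n) : Prop :=
  hom_coords p (map_mx EFin u).

(* In the second case the choice of the reference coordinate [i] is
   irrelevant. *)
Definition lattice_length (p q : TP) (r : \bar R) : Prop :=
  [\/ p = q /\ r = 0%E,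
      exists (u v : 'rV[R]_n) (i : 'I_n) (lambda : R) (w : 'I_n -> int),
        [/\ real_coords p u, real_coords q v, 0 < lambda,
            \big[gcdn/0%N]_j `|w j|%N = 1%N
          & (forall j, (u ord0 j - u ord0 i) - (v ord0 j - v ord0 i) = lambda * (w j)%:~R)
            /\ r = lambda%:E]
    | [/\ p <> q, ~ ((exists u, real_coords p u) /\ (exists v, real_coords q v))
        & r = +oo%E] ].

End TropicalProjectiveSpace.

Section ImageGraph.
Variables (R : realType) (Gamma : metricGraph R) (n : nat).
Variables (f : 'I_n -> Gamma -> \bar R) (phi : Gamma -> TP R n).

(* Continuity determines [phi] at the points at infinity, where some [f i] may
   be infinite: TP is Hausdorff and the other points are dense. *)
Definition induced_map : Prop :=
  (forall x, ~ at_infinity x -> hom_coords (phi x) (\row_i f i x)) /\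
  continuous phi.

Definition image_graph : topologicalType := range phi.

Definition to_image (x : Gamma) : image_graph :=
  SigSub (mem_set (imageT phi x)).

(* The endpoints of a segment of [Gamma] on which all [f i] are linear are sent
   to points whose distance along the image segment is its lattice length. *)
Definition image_step (p q : image_graph) (r : \bar R) : Prop :=
  exists (e : edge (refmodel Gamma)) s t,
    [/\ edge_dom e s, edge_dom e t,
        forall i, linear_on (M := refmodel Gamma) (f i) e
                    [set u | (s <= u <= t)%E \/ (t <= u <= s)%E],
        to_image (emap (refmodel Gamma) e s) = p /\
        to_image (emap (refmodel Gamma) e t) = q
      & lattice_length (val p) (val q) r].

Definition image_dist (p q : image_graph) : \bar R :=
  chain_dist image_step p q.

End ImageGraph.

Arguments to_image {R Gamma n} phi x.
Arguments image_dist {R Gamma n} f phi p q.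

Section Coverings.
Variables (R : realType).
Variables (X : topologicalType) (d : X -> X -> \bar R) (M : model d).
Variables (X' : topologicalType) (d' : X' -> X' -> \bar R) (M' : model d').
Variable phi : X -> X'.

(* On [e], [phi] is the dilation by [k] into [e'], preserving the
   parametrizations' directions iff [o]. *)
Definition dilates (e : edge M) (k : nat) (e' : edge M') (o : bool) : Prop :=
  exists a : R, forall t, edge_dom e t ->
    let t' := (a%:E + (if o then k%:R else - k%:R : R)%:E * t)%E in
    edge_dom e' t' /\ phi (emap M e t) = emap M' e' t'.

Definition contracts (e : edge M) : Prop :=
  exists x', forall t, edge_dom e t -> phi (emap M e t) = x'.

(* [phi] is a morphism, as witnessed by the models [M] and [M'], with degree
   [deg e] on the edge [e]. *)
Definition is_morphism (deg : edge M -> nat) : Prop :=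
  [/\ continuous phi,
      forall v, exists v', phi (vmap M v) = vmap M' v',
      forall e' : edge M', exists S : {set edge M},
        phi @^-1` edge_interior e' =
        \bigcup_(e in [set` S]) edge_interior e
    & forall e, if deg e == 0%N then contracts e
                else exists e' o, dilates e (deg e) e' o].

Definition is_finite (deg : edge M -> nat) : Prop :=
  forall e, (0 < deg e)%N.

Variable deg : edge M -> nat.
Variables (m : edge M -> nat) (m' : edge M' -> nat).

Definition half_maps (h : half_edge M) (h' : half_edge M') : Prop :=
  (0 < deg h.1)%N /\ dilates h.1 (deg h.1) h'.1 (h.2 == h'.2).

(* A contracted edge imposes no divisibility condition, the multiplicity of its
   image being 0 by convention.  [k] is the local degree at [x]. *)
Definition harmonic_at (x : X) (k : nat) : Prop :=
  (forall e1, edge_set e1 x -> forall e' o,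
     (0 < deg e1)%N -> dilates e1 (deg e1) e' o -> (m e1 %| m' e')%N) /\
  forall h' : half_edge M', half_at h' (phi x) ->
    (\sum_(h : half_edge M | `[< half_at h x /\ half_maps h h' >])
       (m' h'.1 %/ m h.1) * deg h.1)%N = k.

Definition harmonic_of_degree (N : nat) : Prop :=
  (is_singleton X' /\ (is_singleton X \/ N = 0%N)) \/
  (~ is_singleton X' /\
   exists dx : X -> nat, (forall x, harmonic_at x (dx x)) /\
     forall x', \sum_(x \in phi @^-1` [set x']) dx x = N).

End Coverings.

Section Galois.
Variables (R : realType).
Variables (X : topologicalType) (d : X -> X -> \bar R) (M : model d).
Variables (X' : topologicalType) (d' : X' -> X' -> \bar R) (M' : model d').
Variable phi : X -> X'.
Variables (K : finGroupType) (to : {action K &-> X}).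

Definition edge_stab (e : edge M) : {set K} :=
  [set a | `[< (fun x => to x a) @` edge_set e = edge_set e >]]%SET.

Definition preserves_multiplicity (m : edge M -> nat) : Prop :=
  forall (a : K) (e : edge M), exists2 e1 : edge M,
    (fun x => to x a) @` edge_set e = edge_set e1 & m e1 = m e.

Definition transitive_on_fibres : Prop :=
  forall x y, phi x = phi y <-> exists a : K, to x a = y.

Definition galois_covering (m : edge M -> nat) (m' : edge M' -> nat) : Prop :=
  (forall e, (0 < m e)%N) /\ (forall e', (0 < m' e')%N) /\
  exists deg : edge M -> nat,
    [/\ is_morphism M' phi deg, is_finite deg,
        harmonic_of_degree phi deg m m' #|K|,
        transitive_on_fibres & preserves_multiplicity m].

End Galois.

(* Main.v *)
Require Import Defs.
From mathcomp Require Import all_boot all_order all_algebra all_fingroup.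
From mathcomp Require Import all_classical all_reals ereal topology normedtype.
From mathcomp Require Import finmap zify ring lra.

(* Separating orbits makes the fibres of [phi] exactly the [K]-orbits.  The point
   is that [phi] then has dilation factor 1 on every segment where all [f i] are
   linear, i.e. that two of the slopes of the [f i] differ by 1 there.  If [f i]
   has slope k > 0 at a generic point [x0] with [f i x0 = c], then
   max(c, f i - min(eps, dist(K x0, -))) is again in R(D)^K: the chips that
   max(c, f i) puts on the level set f i = c pay for lowering the slope k by one
   next to the orbit of [x0].  This function has slope k - 1 just above [x0] and
   is a tropical combination of the [f j], so some [f j] has slope k - 1.

   Subdivide Gamma at the K-orbits of vertices and of break points of the [f i].
   Then [phi] is injective on closed edges, [K] permutes the edges, and
   an element stabilizing an edge fixes it pointwise.  Since Gamma is compact and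
   TP is Hausdorff, [phi] is a quotient map onto its image, so the edges modulo [K]
   form a model of the image; its metric is the lattice length because the
   dilation factors are 1.  Orbit-stabilizer counting gives the degrees. *)

(** One direction is immediate: the fibres of a Galois covering are orbits by definition. In the
    other, the obstacle is the points at infinity. There the [f i] may be infinite and [phi] is
    known only as a limit, so [K]-invariance of [phi] is obtained by density, and it must be shown
    separately that an end is not sent to the image of a real parameter. Segments reaching such
    points have infinite length in the image and can be discarded when distances are compared.

    The unit gap between two slopes does more than give the dilation factor. If [f j1 - f j2] has
    slope 1 on an edge, it is a coordinate of that edge which [phi] remembers: this gives
    injectivity on the edge and, by comparing an edge with its translate, shows that an element of
    [K] carries edges to edges by the identity or a reflection of the parameter. It also makes the
    vector of slope differences primitive, which is what lattice length measures. Lowering a slope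
    by exactly 1 is the smallest change that integer slopes allow, so a generator with the lowered
    slope provides the gap. *)

Module InvariantLinearSystem.

Set Implicit Arguments.
Unset Strict Implicit.
Unset Printing Implicit Defensive.

Import Order.TTheory GRing.Theory Num.Theory numFieldNormedType.Exports.

Local Open Scope classical_set_scope.
Local Open Scope ring_scope.

(** * Subdividing a model *)

Section ExtendedReals.
Variable R : realType.
Implicit Types (l t : \bar R) (a c r : R).

Lemma interior_fin l t : (0 < t < l)%E -> exists r, t = r%:E.
Proof.
case: t => [r| |] //; first by exists r.
by case/andP => _; case: l.
Qed.

Lemma addeBK c t : (c%:E + (t - c%:E))%E = t.
Proof. by rewrite addeC subeK. Qed.

Lemma abse_subDl c (s t : \bar R) :
  (`|(c%:E + s) - (c%:E + t)| = `|s - t|)%E.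
Proof.
by case: s t => [s| |] [t| |] //=; rewrite opprD addrACA subrr add0r.
Qed.

Lemma abse_subC (s t : \bar R) : (`|s - t| = `|t - s|)%E.
Proof. by case: s t => [s| |] [t| |] //=; rewrite distrC. Qed.

Lemma abse_sub_between c (s t : \bar R) : (s <= c%:E)%E -> (c%:E <= t)%E ->
  (0 <= s)%E -> (`|s - c%:E| + `|c%:E - t| = `|s - t|)%E.
Proof.
case: s t => [s| |] [t| |] //=; rewrite !lee_fin => h1 h2 h3.
rewrite -EFinD; congr (_%:E); rewrite !ler0_norm; lra.
Qed.

Lemma eq_ereal_le (s t : \bar R) : s = t -> (s <= t)%E.
Proof. by move=> ->. Qed.

Lemma affine_continuous c r : continuous (fun t : \bar R => (c%:E + r%:E * t)%E).
Proof.
move=> t; apply: cvgeD => //; first exact: cvg_cst.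
exact: mule_continuous.
Qed.

Lemma shift_continuous c : continuous (fun t : \bar R => (c%:E + t)%E).
Proof.
have -> : (fun t : \bar R => (c%:E + t)%E) = (fun t => (c%:E + 1%:E * t)%E).
  by apply/funext => t; rewrite mul1e.
exact: affine_continuous.
Qed.

Lemma open_preimage (T U : topologicalType) (g : T -> U) (W : set U) :
  continuous g -> open W -> open (g @^-1` W).
Proof. by move=> /continuousP; apply. Qed.

End ExtendedReals.

(** * Distances generated by chains of steps *)

Section Chains.
Variables (R : realType) (X : Type).
Implicit Types (step : X -> X -> \bar R -> Prop) (x y z : X) (r s : \bar R).

Lemma chain1 step x y r : step x y r -> chain step x y r.
Proof.
by move=> h; rewrite -[r]adde0; apply: chain_cons h _; exact: chain_nil.
Qed.

Lemma chain_cat step x y z r s :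
  chain step x y r -> chain step y z s -> chain step x z (r + s)%E.
Proof.
move=> h; elim: h => [{}x|{}x u {}y r1 r2 st _ IH] hs; first by rewrite add0e.
by rewrite -addeA; apply: chain_cons st _; apply: IH.
Qed.

Lemma chain_sub step1 step2 x y r :
  (forall x y r, step1 x y r -> chain step2 x y r) ->
  chain step1 x y r -> chain step2 x y r.
Proof.
move=> h; elim=> [{}x|{}x u {}y r1 r2 st _ IH]; first exact: chain_nil.
exact: chain_cat (h _ _ _ st) IH.
Qed.

Lemma chain_ge0 step x y r : (forall x y r, step x y r -> (0 <= r)%E) ->
  chain step x y r -> (0 <= r)%E.
Proof.
by move=> h; elim=> [//|{}x u {}y r1 r2 st _ IH]; apply: adde_ge0 => //; exact: h st.
Qed.

(** Lengths are nonnegative, so a chain containing a step of length +oo has length +oo and does not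
    affect the infimum. Such steps need no counterpart on the other side, which takes care of
    segments reaching a point at infinity. *)
Lemma chain_dist_eq step1 step2 x y :
  (forall x y r, step1 x y r -> (0 <= r)%E) ->
  (forall x y r, step2 x y r -> (0 <= r)%E) ->
  (forall x y r, step1 x y r -> r = +oo%E \/ chain step2 x y r) ->
  (forall x y r, step2 x y r -> r = +oo%E \/ chain step1 x y r) ->
  chain_dist step1 x y = chain_dist step2 x y.
Proof.
have key st1 st2 : (forall x y r, st1 x y r -> (0 <= r)%E) ->
    (forall x y r, st1 x y r -> r = +oo%E \/ chain st2 x y r) ->
    (chain_dist st2 x y <= chain_dist st1 x y)%E.
  move=> st1_ge0 sim; apply: le_ereal_inf_tmp => r /= c1.
  have [->|c2] : r = +oo%E \/ chain st2 x y r; last 2 first.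
  - by rewrite leey.
  - exact: ereal_inf_lbound.
  elim: c1 => [{}x|{}x u {}y r1 r2 st ch IH]; first by right; exact: chain_nil.
  have r2_ge0 := chain_ge0 st1_ge0 ch.
  have r1_ge0 := st1_ge0 _ _ _ st.
  have [->|c1] := sim _ _ _ st.
    by left; rewrite addye// gt_eqF// (lt_le_trans _ r2_ge0).
  case: IH => [->|c2]; last by right; apply: chain_cat c2.
  by left; rewrite addey// gt_eqF// (lt_le_trans _ r1_ge0).
move=> h1 h2 s12 s21; apply/eqP; rewrite eq_le.
by rewrite (key step2 step1)//= (key step1 step2).
Qed.

End Chains.

Lemma edge_step_ge0 (R : realType) (G : wgraph R) (X : Type)
    (em : edge G -> \bar R -> X) x y r : edge_step em x y r -> (0 <= r)%E.
Proof. by case=> e [s [t [_ _ _ _ ->]]]; rewrite abse_ge0. Qed.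

Lemma valence1P (V E : finType) (src tgt : E -> V) (e : E) :
  valence src tgt (tgt e) = 1%N <->
  (forall e1, src e1 <> tgt e) /\ (forall e1, tgt e1 = tgt e -> e1 = e).
Proof.
rewrite /valence; split=> [h|[hs ht]]; last first.
  have -> : [set e1 | src e1 == tgt e]%SET = finset.set0.
    by apply/setP => e1; rewrite !inE; apply/eqP/hs.
  have -> : [set e1 | tgt e1 == tgt e]%SET = [set e]%SET.
    by apply/setP => e1; rewrite !inE; apply/eqP/eqP => [/ht|->].
  by rewrite cards0 cards1.
have e_in : e \in [set e1 | tgt e1 == tgt e]%SET by rewrite inE.
have tgt_gt0 : (0 < #|[set e1 | tgt e1 == tgt e]%SET|)%N.
  by apply/card_gt0P; exists e.
have [src0 tgt1] : (#|[set e1 | src e1 == tgt e]%SET| = 0)%N /\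
    #|[set e1 | tgt e1 == tgt e]%SET| = 1%N.
  by move: h tgt_gt0; case: #|_| => [|p]; case: #|_| => [|[|q]] //; rewrite addnS.
split=> [e1 he1|e1 he1].
  move/eqP: src0; rewrite cards_eq0 => /eqP /setP /(_ e1).
  by rewrite !inE he1 eqxx.
move/eqP/cards1P: tgt1 => [e2 he2].
have : e1 \in [set e1 | tgt e1 == tgt e]%SET by rewrite inE he1.
by move: e_in; rewrite he2 !inE => /eqP -> /eqP ->.
Qed.

Section Subdivision.
Variables (R : realType) (X : topologicalType) (d : X -> X -> \bar R).
Variables (M : model d) (e0 : edge M) (t0 : R).
Hypothesis t0_int : (0 < t0%:E < len e0)%E.

(** [None] is both the new vertex and the new edge: [Some e0] is cut down to the parameters up to
    [t0], and [None] carries the rest of [e0], shifted to start at 0. If [e0] is infinite, its leaf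
    end thus passes to the edge [None]. *)
Let sub_src (e : option (edge M)) : option (vertex M) :=
  if e is Some e1 then Some (src e1) else None.
Let sub_tgt (e : option (edge M)) : option (vertex M) :=
  if e is Some e1 then (if e1 == e0 then None else Some (tgt e1))
  else Some (tgt e0).
Let sub_len (e : option (edge M)) : \bar R :=
  if e is Some e1 then (if e1 == e0 then t0%:E else len e1)
  else (len e0 - t0%:E)%E.
Let sub_vmap (v : option (vertex M)) : X :=
  if v is Some v1 then vmap M v1 else emap M e0 t0%:E.
Let sub_emap (e : option (edge M)) (t : \bar R) : X :=
  if e is Some e1 then emap M e1 t else emap M e0 (t0%:E + t)%E.

Let sub_adj := adjacent sub_src sub_tgt.

Let sub_adjC : symmetric sub_adj.
Proof.
by move=> u v; apply/existsP/existsP => -[e he]; exists e; rewrite orbC.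
Qed.

Let sub_adjE e : connect sub_adj (sub_src e) (sub_tgt e).
Proof. by apply: connect1; apply/existsP; exists e; rewrite !eqxx. Qed.


Let sub_connected u v : connect sub_adj u v.
Proof.
have sym : connect_sym sub_adj by apply: sym_connect_sym; exact: sub_adjC.
have edgeE e1 : connect sub_adj (Some (src e1)) (Some (tgt e1)).
  have [->|ne] := eqVneq e1 e0; last first.
    by have := sub_adjE (Some e1); rewrite /= (negbTE ne).
  have E0 : connect sub_adj (Some (src e0)) None.
    by have := sub_adjE (Some e0); rewrite /= eqxx.
  exact: connect_trans E0 (sub_adjE None).
have old a b : connect sub_adj (Some a) (Some b).
  have /connectP[p] := connected_graph (w := M) a b.
  elim: p a => [|c p IH] a /=; first by move=> _ ->.
  case/andP => /existsP[e1 he1] pth lst; apply: connect_trans (IH c pth lst).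
  case/orP: he1 => /andP[/eqP <- /eqP <-]; first exact: edgeE.
  by rewrite sym; apply: edgeE.
have none : connect sub_adj None (Some (tgt e0)) by exact: (sub_adjE None).
case: u v => [a|] [b|].
- exact: old.
- by rewrite sym; exact: connect_trans none (old _ _).
- exact: connect_trans none (old _ _).
- exact: connect0.
Qed.

Let sub_len_gt0 e : (0 < sub_len e)%E.
Proof.
case/andP: t0_int => h1 h2; case: e => [e1|]; last by rewrite /sub_len sube_gt0.
rewrite /sub_len; case: ifP => _ //; exact: len_gt0.
Qed.

Let sub_infinite_leaf e : sub_len e = +oo%E ->
  valence sub_src sub_tgt (sub_tgt e) = 1%N.
Proof.
move=> hl; apply/valence1P.
have [e1 e1oo [tgtE e1E]] : exists2 e1, len e1 = +oo%E &
    sub_tgt e = Some (tgt e1) /\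
    e = (if e1 == e0 then None else Some e1).
  case: e hl => [e1|] /=.
    by case: eqVneq => // ne h; exists e1; rewrite // (negbTE ne).
  move=> h; exists e0; last by rewrite eqxx.
  by case: (len e0) h.
have /valence1P[hs ht] := infinite_leaf e1oo.
rewrite tgtE; split=> [[e2|] //= [/hs]//|[e2|] /=].
  by case: eqVneq => // ne [/ht E]; rewrite e1E -E (negbTE ne).
by case=> /ht E; rewrite e1E -E eqxx.
Qed.

Let sub_vertex_nonempty : (0 < #|{: option (vertex M)}|)%N.
Proof. by rewrite card_option. Qed.

Definition subdiv_graph : wgraph R :=
  WGraph sub_vertex_nonempty sub_connected sub_len_gt0 sub_infinite_leaf.

Let sub_emap_src (e : edge subdiv_graph) : sub_emap e 0%E = sub_vmap (src e).
Proof. by case: e => [e1|] /=; rewrite ?emap_src// adde0. Qed.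

Let sub_emap_tgt (e : edge subdiv_graph) : sub_emap e (len e) = sub_vmap (tgt e).
Proof.
case: e => [e1|]; last exact: etrans (congr1 (emap M e0) (addeBK _ _)) (emap_tgt e0).
rewrite /sub_emap /= ; by case: eqVneq => [->|] //=; rewrite emap_tgt.
Qed.

Let sub_vmap_inj : injective sub_vmap.
Proof.
move=> [u|] [v|] //= h; first by rewrite (vmap_inj h).
- by have := emap_vmap t0_int; move=> /(_ u); rewrite h.
- by have := emap_vmap t0_int; move=> /(_ v); rewrite h.
Qed.

Lemma subdiv_shift t : (0 < t < len e0 - t0%:E)%E ->
  (t0%:E < t0%:E + t < len e0)%E.
Proof.
move=> /[dup] /interior_fin[r ->]; rewrite lte_fin => /andP[r_gt0].
rewrite lteBrDr// addeC -EFinD => ->; rewrite andbT lte_fin; lra.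
Qed.

Lemma subdiv_shift_int t : (0 < t < len e0 - t0%:E)%E ->
  (0 < t0%:E + t < len e0)%E.
Proof.
by move=> /subdiv_shift /andP[h ->]; rewrite (lt_trans _ h)//; case/andP: t0_int.
Qed.

Let sub_int e1 t : (0 < t < sub_len (Some e1))%E -> (0 < t < len e1)%E.
Proof.
rewrite /sub_len; case: eqVneq => [->|//] /andP[-> h] /=.
by apply: lt_trans h _; case/andP: t0_int.
Qed.

Let sub_emap_vmap (e : edge subdiv_graph) t v :
  (0 < t < len e)%E -> sub_emap e t <> sub_vmap v.
Proof.
case: e => [e1|]; last first.
  case: v => [v|] h; first exact: emap_vmap (subdiv_shift_int h).
  move=> /(emap_inj (subdiv_shift_int h) t0_int)[_ E].
  by have := subdiv_shift h; rewrite E ltxx.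
move=> h; case: v => [v|]; first exact: emap_vmap (sub_int h).
move=> /(emap_inj (sub_int h) t0_int)[E1 E2].
by move: h; rewrite /= E1 eqxx E2 ltxx andbF.
Qed.

Let sub_emap_inj (e : edge subdiv_graph) t (e' : edge subdiv_graph) t' :
  (0 < t < len e)%E -> (0 < t' < len e')%E ->
  sub_emap e t = sub_emap e' t' -> e = e' /\ t = t'.
Proof.
case: e => [e1|] h; case: e' => [e2|] h'.
- by move=> /(emap_inj (sub_int h) (sub_int h'))[-> ->].
- move=> /(emap_inj (sub_int h) (subdiv_shift_int h'))[E1 E2].
  move: h; rewrite /= E1 eqxx E2 => /andP[_ h].
  by have /andP[/lt_trans /(_ h)] := subdiv_shift h'; rewrite ltxx.
- move=> /(emap_inj (subdiv_shift_int h) (sub_int h'))[E1 E2].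
  move: h'; rewrite /= -E1 eqxx -E2 => /andP[_ h'].
  by have /andP[/lt_trans /(_ h')] := subdiv_shift h; rewrite ltxx.
- move=> /(emap_inj (subdiv_shift_int h) (subdiv_shift_int h'))[_ E].
  split=> //; move: h h' E => /interior_fin[r ->] /interior_fin[r' ->].
  by rewrite -!EFinD => -[] /addrI ->.
Qed.

Let sub_cover x : (exists v, x = sub_vmap v) \/
  (exists (e : edge subdiv_graph) t, (0 < t < len e)%E /\ x = sub_emap e t).
Proof.
have [[v ->]|[e [t [h ->]]]] := model_cover M x; first by left; exists (Some v).
have [E|ne] := eqVneq e e0; last first.
  by right; exists (Some e), t; rewrite /= (negbTE ne).
subst e; have [lt|gt|->] := ltgtP t t0%:E; last by left; exists None.
  by right; exists (Some e0), t; rewrite /= eqxx lt; case/andP: h => ->.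
right; exists None, (t - t0%:E)%E; split; last first.
  by rewrite /sub_emap addeBK.
by case/andP: h => _ h; rewrite sube_gt0 gt; apply: lte_leB.
Qed.

Let sub_step_left s t : (0 <= s <= t0%:E)%E -> (0 <= t <= t0%:E)%E ->
  edge_step (G := subdiv_graph) sub_emap (emap M e0 s) (emap M e0 t) `|s - t|%E.
Proof.
by move=> hs ht; exists (Some e0), s, t; split=> //; rewrite /edge_dom /= eqxx.
Qed.

Let sub_step_right s t : (t0%:E <= s <= len e0)%E -> (t0%:E <= t <= len e0)%E ->
  edge_step (G := subdiv_graph) sub_emap (emap M e0 s) (emap M e0 t) `|s - t|%E.
Proof.
move=> /andP[s1 s2] /andP[u1 u2]; exists None, (s - t0%:E)%E, (t - t0%:E)%E.
split=> //.
- by apply/andP; split; [rewrite sube_ge0|apply: leeB].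
- by apply/andP; split; [rewrite sube_ge0|apply: leeB].
- by rewrite /sub_emap addeBK.
- by rewrite /sub_emap addeBK.
- by rewrite ![(_ - t0%:E)%E]addeC -EFinN abse_subDl.
Qed.

Lemma subdiv_step x y r : edge_step (emap M) x y r ->
  chain (edge_step (G := subdiv_graph) sub_emap) x y r.
Proof.
case=> e [s [t [hs ht <- <- ->]]].
have [E|ne] := eqVneq e e0; last first.
  by apply: chain1; exists (Some e), s, t; split; rewrite // /edge_dom /= (negbTE ne).
subst e; move: hs ht => /= /andP[s1 s2] /andP[u1 u2].
case/andP: t0_int => t0_gt0 /ltW t0_le.
have [st|/ltW st] := leP s t0%:E; have [tt|/ltW tt] := leP t t0%:E.
- by apply/chain1/sub_step_left; rewrite ?s1 ?u1.
- rewrite -(abse_sub_between st tt s1).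
  apply: chain_cat (chain1 (sub_step_left _ _)) (chain1 (sub_step_right _ _)).
  + by rewrite s1.
  + by rewrite lexx ltW.
  + by rewrite lexx.
  + by rewrite tt.
- rewrite abse_subC -(abse_sub_between tt st u1) addeC.
  rewrite [X in (X + _)%E]abse_subC [X in (_ + X)%E]abse_subC.
  apply: chain_cat (chain1 (sub_step_right _ _)) (chain1 (sub_step_left _ _)).
  + by rewrite st.
  + by rewrite lexx.
  + by rewrite lexx ltW.
  + by rewrite u1.
- by apply/chain1/sub_step_right; rewrite ?st ?tt.
Qed.

Let sub_dom e t : edge_dom (G := subdiv_graph) (Some e) t -> edge_dom e t.
Proof.
rewrite /edge_dom /=; case: eqVneq => // -> /andP[-> h] /=.
by apply: le_trans h _; case/andP: t0_int => _ /ltW.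
Qed.

Let sub_dom_shift t : edge_dom (G := subdiv_graph) None t ->
  edge_dom e0 (t0%:E + t)%E.
Proof.
case/andP: t0_int => /ltW h1 _ /andP[h2 h3]; apply/andP; split.
  exact: adde_ge0.
by rewrite addeC -leeBrDr.
Qed.

Let sub_step_coarse x y r : edge_step (G := subdiv_graph) sub_emap x y r ->
  edge_step (emap M) x y r.
Proof.
case=> -[e|] [s [t [hs ht <- <- ->]]].
  by exists e, s, t; split=> //; exact: sub_dom.
exists e0, (t0%:E + s)%E, (t0%:E + t)%E; split=> //; try exact: sub_dom_shift.
by rewrite abse_subDl.
Qed.

Let sub_dist x y : d x y = chain_dist (edge_step (G := subdiv_graph) sub_emap) x y.
Proof.
rewrite (model_dist M); apply: chain_dist_eq; try exact: edge_step_ge0.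
- by move=> ? ? ? h; right; exact: subdiv_step h.
- by move=> ? ? ? h; right; apply/chain1/sub_step_coarse.
Qed.

Let sub_open (U : set X) : open U <->
  (forall e : edge subdiv_graph, exists W : set (\bar R),
     open W /\ forall t, edge_dom e t -> (U (sub_emap e t) <-> W t)).
Proof.
rewrite (model_open M); split=> h e.
  case: e => [e|].
    by have [W [oW hW]] := h e; exists W; split=> // t /sub_dom; exact: hW.
  have [W [oW hW]] := h e0.
  exists ((fun t => t0%:E + t)%E @^-1` W); split.
    by apply: open_preimage => //; exact: shift_continuous.
  by move=> t /sub_dom_shift; exact: hW.
have [W1 [oW1 hW1]] := h (Some e); have [E|ne] := eqVneq e e0; last first.
  by exists W1; split=> // t ht; apply: hW1; rewrite /edge_dom /= (negbTE ne).
subst e; have [W2 [oW2 hW2]] := h None.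
(* Each factor imposes its condition only on its own side of [t0]. At [t0] both apply, and they
   agree because both express that the new vertex lies in [U]. *)
exists (([set t | t0%:E < t]%E `|` W1) `&`
  ([set t | t < t0%:E]%E `|` (fun t => (- t0)%:E + t)%E @^-1` W2)); split.
  apply: openI; apply: openU => //.
  - exact: open_ereal_gt_ereal.
  - exact: open_ereal_lt_ereal.
  - by apply: open_preimage => //; exact: shift_continuous.
move=> t /andP[t_ge0 t_le] /=.
have left : (t <= t0%:E)%E -> U (emap M e0 t) <-> W1 t.
  by move=> tt; apply: hW1; rewrite /edge_dom /= eqxx t_ge0.
have right : (t0%:E <= t)%E -> U (emap M e0 t) <-> W2 ((- t0)%:E + t)%E.
  move=> tt; rewrite addeC EFinN -hW2 /sub_emap ?addeBK//.
  by apply/andP; split; [rewrite sube_ge0|apply: leeB].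
have [tt|tt|tt] := ltgtP t t0%:E.
- by rewrite (left (ltW tt)); split=> [?|[[]]//]; split; [right|left].
- by rewrite (right (ltW tt)); split=> [?|[_ []]//]; split; [left|right].
- have := left (eq_ereal_le tt); have := right (eq_ereal_le (esym tt)).
  move=> hr hl; split=> [?|]; first by split; right; tauto.
  by case=> -[|]; rewrite ?tt ?ltxx// -tt; tauto.
Qed.

Definition subdiv : model d :=
  @Model R X d subdiv_graph sub_vmap sub_emap sub_emap_src sub_emap_tgt
    sub_vmap_inj sub_emap_vmap sub_emap_inj sub_cover sub_open sub_dist.

End Subdivision.

Section Refinement.
Variables (R : realType) (X : topologicalType) (d : X -> X -> \bar R).

(** Each new edge is a part of an old one traversed in the same direction, so a linear function
    keeps its slope. Image distances and points at infinity are defined through the reference model;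
    the third and fourth clauses carry them over to the refinement. *)
Definition refines (M0 M1 : model d) : Prop :=
  [/\ forall v, exists v1, vmap M1 v1 = vmap M0 v,
      forall e1 : edge M1, exists (e0 : edge M0) (a : R),
        [/\ 0 <= a, (a%:E + len e1 <= len e0)%E
          & forall t, edge_dom e1 t -> emap M1 e1 t = emap M0 e0 (a%:E + t)%E],
      forall x y r, edge_step (emap M0) x y r ->
        chain (edge_step (emap M1)) x y r
    & forall e0 : edge M0, len e0 = +oo%E ->
        exists2 e1 : edge M1, len e1 = +oo%E & emap M1 e1 +oo%E = emap M0 e0 +oo%E].

Lemma refines_refl (M : model d) : refines M M.
Proof.
split=> [v|e|x y r|e he].
- by exists v.
- by exists e, 0; rewrite add0e; split=> // t _; rewrite add0e.
- exact: chain1.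
- by exists e.
Qed.

Lemma refines_trans (M1 M0 M2 : model d) :
  refines M0 M1 -> refines M1 M2 -> refines M0 M2.
Proof.
move=> [v01 e01 c01 i01] [v12 e12 c12 i12]; split.
- by move=> v; have [v1 <-] := v01 v; have [v2 <-] := v12 v1; exists v2.
- move=> e2; have [e1 [a [a_ge0 ha ea]]] := e12 e2.
  have [e0 [b [b_ge0 hb eb]]] := e01 e1; exists e0, (b + a); split.
  + exact: addr_ge0.
  + by rewrite EFinD -addeA; apply: le_trans hb; rewrite leeD2l.
  + move=> t /[dup] ht /andP[t_ge0 t_le]; rewrite ea// eb ?EFinD ?addeA//.
    by apply/andP; split; [exact: adde_ge0|exact: le_trans (leeD2l _ t_le) ha].
- by move=> x y r /c01; apply: chain_sub.
- move=> e0 /i01[e1 /i12[e2 h2 E2] E1]; exists e2 => //; by rewrite E2.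
Qed.

Lemma subdiv_refines (M : model d) (e0 : edge M) (t0 : R)
  (h : (0 < t0%:E < len e0)%E) : refines M (subdiv h).
Proof.
split.
- by move=> v; exists (Some v).
- case=> [e|].
    exists e, 0; split=> [//||t _]; last by rewrite add0e.
    rewrite add0e /=; case: eqVneq => // ->; by case/andP: h => _ /ltW.
  exists e0, t0; split => //; last by rewrite addeBK.
  by case/andP: h => /ltW.
- exact: subdiv_step.
- move=> e hl; have [E|ne] := eqVneq e e0; last first.
    by exists (Some e); rewrite //= (negbTE ne).
  by subst e; exists None; rewrite /= ?hl.
Qed.

Lemma refine_at (M : model d) (s : seq X) : exists M1 : model d,
  refines M M1 /\
  forall x, (exists v, x = vmap M1 v) <-> (exists v, x = vmap M v) \/ x \in s.
Proof.
elim: s => [|y s [M1 [ref1 v1]]].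
  by exists M; split=> [|x]; [exact: refines_refl|split=> [|[]//]; left].
have [[v E]|[e [t [h E]]]] := model_cover M1 y.
  exists M1; split=> // x; rewrite v1 inE; split=> [[|->]|]; first by left.
    by right; rewrite orbT.
  case=> [|/orP[/eqP ->|]]; [by left| |by right].
  by apply/v1; exists v.
have [t0 tE] := interior_fin h; subst t; exists (subdiv h); split.
  exact: refines_trans ref1 (subdiv_refines h).
move=> x; rewrite inE; split.
  case=> -[v|] /= ->; last by right; rewrite E eqxx.
  have /v1 : exists u, vmap M1 v = vmap M1 u by exists v.
  by case=> [|->]; [left|right; rewrite orbT].
have old : (exists v, x = vmap M1 v) -> exists v, x = vmap (subdiv h) v.
  by case=> v ->; exists (Some v).
case=> [?|/orP[/eqP ->|?]].
- by apply/old/v1; left.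
- by exists None.
- by apply/old/v1; right.
Qed.

End Refinement.

(** * Distances near an interior point of an edge *)

Section ModelGeometry.
Variables (R : realType) (X : topologicalType) (d : X -> X -> \bar R).
Variable M : model d.

Lemma edge_dom0 (e : edge M) : edge_dom e 0%E.
Proof. by rewrite /edge_dom /= lexx ltW// len_gt0. Qed.

Lemma edge_dom_len (e : edge M) : edge_dom e (len e).
Proof. by rewrite /edge_dom /= lexx ltW// len_gt0. Qed.

Lemma edge_dom_int (e : edge M) t : (0 < t < len e)%E -> edge_dom e t.
Proof. by case/andP => /ltW h1 /ltW h2; apply/andP. Qed.

Lemma edge_domP (e : edge M) t : edge_dom e t ->
  [\/ t = 0%E, t = len e | (0 < t < len e)%E].
Proof.
move=> /andP[t0 tl]; have [E|t_ne0] := eqVneq t 0%E; first by apply: Or31.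
have [E|t_nel] := eqVneq t (len e); first by apply: Or32.
by apply: Or33; rewrite !lt_neqAle t0 tl eq_sym t_ne0 t_nel.
Qed.

Lemma emap_int_inj (e e' : edge M) t t' :
  (0 < t < len e)%E -> edge_dom e' t' -> emap M e t = emap M e' t' ->
  e = e' /\ t = t'.
Proof.
move=> h /edge_domP[->|->|h']; rewrite ?emap_src ?emap_tgt.
- by move=> /emap_vmap -/(_ h).
- by move=> /emap_vmap -/(_ h).
- exact: emap_inj.
Qed.

(** The sum [|v - u| + r] is a budget: moving from [v] to [w] takes [|w - v|] off [r], so the sum
    does not increase along the chain. As long as it is below [rho], the chain stays inside [e],
    where a step can only move along [e]. *)
Lemma chain_interior (e : edge M) (u rho : R) x z r : rho <= u -> ((u + rho)%:E <= len e)%E ->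
  chain (edge_step (emap M)) x z r ->
  forall v : R, x = emap M e v%:E -> (`|v - u|%:E + r < rho%:E)%E ->
  exists2 w : R, z = emap M e w%:E & (`|w - v|%:E <= r)%E.
Proof.
move=> rho_u u_rho; elim=> [{}x|{}x y {}z r1 r2 st ch IH] v xE.
  by move=> _; exists v => //; rewrite subrr normr0.
move=> hr; have r1_ge0 := edge_step_ge0 st.
have r2_ge0 := chain_ge0 (@edge_step_ge0 _ _ _ (emap M)) ch.
have v_int : (0 < v%:E < len e)%E.
  have : (`|v - u|%:E < rho%:E)%E.
    by apply: le_lt_trans hr; rewrite leeDl// adde_ge0.
  rewrite !lte_fin ltr_distl => /andP[h1 h2]; apply/andP; split; first by lra.
  by apply: lt_le_trans u_rho; rewrite lte_fin; lra.
case: st => e1 [s [t [hs ht sE tE r1E]]].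
have [e1E sv] := emap_int_inj v_int hs (etrans (esym xE) (esym sE)).
subst e1 s.
have [w tw] : exists w : R, t = w%:E.
  case: t ht tE r1E => [w| |]; [by exists w| |by case/andP].
  move=> _ _ r1E; move: hr; rewrite r1E /= addye ?addey //.
  by rewrite gt_eqF// (lt_le_trans _ r2_ge0).
subst t; rewrite -EFinB abse_EFin in r1E.
have [|w' zE hw'] := IH w (esym tE).
  apply: le_lt_trans hr; rewrite addeA leeD2r// r1E -EFinD lee_fin.
  by have := ler_distD v w u; rewrite (distrC w v); lra.
exists w' => //; rewrite r1E.
apply: le_trans (leeD2l _ hw'); rewrite -EFinD lee_fin.
by have := ler_distD w w' v; rewrite (distrC w v); lra.
Qed.

(** A chain of length below [rho] never leaves the edge, and a longer one cannot beat the direct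
    step, so shortcuts through the rest of the graph do not matter here. *)
Lemma dist_interior (e : edge M) (u rho : R) z : rho <= u -> ((u + rho)%:E <= len e)%E ->
  (d (emap M e u%:E) z < rho%:E)%E ->
  exists2 w : R, z = emap M e w%:E & d (emap M e u%:E) z = `|w - u|%:E.
Proof.
move=> rho_u u_rho; rewrite (model_dist M) => /ereal_inf_lt[r ch r_rho].
have r_ge0 := chain_ge0 (@edge_step_ge0 _ _ _ (emap M)) ch.
have rho_gt0 : 0 < rho by rewrite -lte_fin; exact: le_lt_trans r_ge0 r_rho.
have bound r' : chain (edge_step (emap M)) (emap M e u%:E) z r' -> (r' < rho%:E)%E ->
    exists2 w : R, z = emap M e w%:E & (`|w - u|%:E <= r')%E.
  by move=> ch' h'; apply: (chain_interior rho_u u_rho ch' erefl); rewrite subrr normr0 add0e.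
have int w : `|w - u| < rho -> (0 < w%:E < len e)%E.
  rewrite ltr_distl => /andP[h1 h2]; apply/andP; split; first by rewrite lte_fin; lra.
  by apply: lt_le_trans u_rho; rewrite lte_fin; lra.
have [w zE hw] := bound r ch r_rho; exists w => //.
have w_rho : `|w - u| < rho by rewrite -lte_fin; exact: le_lt_trans hw r_rho.
apply/eqP; rewrite eq_le; apply/andP; split.
  apply: ereal_inf_lbound; apply: chain1; exists e, u%:E, w%:E; split=> //.
  - by apply/edge_dom_int/int; rewrite subrr normr0.
  - exact/edge_dom_int/int.
  - by rewrite -EFinB abse_EFin distrC.
apply: le_ereal_inf_tmp => r' /= ch'.
have [r'_rho|] := ltP r' rho%:E; last first.
  by apply: le_trans; rewrite lee_fin ltW.
have [w' zE' hw'] := bound _ ch' r'_rho.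
have w'_rho : `|w' - u| < rho by rewrite -lte_fin; exact: le_lt_trans r'_rho.
have [_ [ww]] := emap_int_inj (int _ w_rho) (edge_dom_int (int _ w'_rho))
  (etrans (esym zE) zE').
by rewrite ww.
Qed.

Lemma dist_edge_le (e : edge M) s t : edge_dom e s -> edge_dom e t ->
  (d (emap M e s) (emap M e t) <= `|s - t|)%E.
Proof.
move=> hs ht; rewrite (model_dist M); apply: ereal_inf_lbound.
by apply: chain1; exists e, s, t.
Qed.

End ModelGeometry.

(** * Piecewise linear functions and slopes *)

Section PiecewiseLinear.
Variables (R : realType) (X : topologicalType) (d : X -> X -> \bar R).
Variable M : model d.
Implicit Types (f g h : X -> \bar R) (e : edge M) (a b s t u : \bar R).

Definition seg s t : set (\bar R) := [set u | (s <= u <= t)%E].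

(** The break points are parameters on one edge instead of points of the graph. Linearity is
    required on closed segments, so adjacent pieces agree at their common end and continuity is
    built in. *)
Definition pl_on f e a b : Prop := exists P : seq (\bar R), forall s t,
  (a <= s)%E -> (s <= t)%E -> (t <= b)%E ->
  (forall u, u \in P -> ~~ (s < u < t)%E) -> linear_on f e (seg s t).

Lemma linear_on_sub f e (A B : set (\bar R)) :
  B `<=` A -> linear_on f e A -> linear_on f e B.
Proof. by move=> BA [c [k h]]; exists c, k => t /BA; exact: h. Qed.

Lemma seg_sub s t s' t' : (s <= s')%E -> (t' <= t)%E -> seg s' t' `<=` seg s t.
Proof.
by move=> h1 h2 u /andP[h3 h4]; apply/andP; split; [exact: le_trans h3|exact: le_trans h2].
Qed.

Lemma pl_linear f e a b : linear_on f e (seg a b) -> pl_on f e a b.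
Proof.
by move=> h; exists [::] => s t as_ _ tb _; apply: linear_on_sub h; exact: seg_sub.
Qed.

Lemma pl_on_sub f e a b a' b' : (a <= a')%E -> (b' <= b)%E ->
  pl_on f e a b -> pl_on f e a' b'.
Proof.
move=> aa bb [P h]; exists P => s t h1 h2 h3; apply: h => //.
  exact: le_trans h1.
exact: le_trans bb.
Qed.

Lemma pl_join u f e a b : pl_on f e a u -> pl_on f e u b -> pl_on f e a b.
Proof.
move=> [P hP] [Q hQ]; exists (u :: P ++ Q) => s t as_ st tb free.
have freeP v : v \in P -> ~~ (s < v < t)%E.
  by move=> vP; apply: free; rewrite inE mem_cat vP orbT.
have freeQ v : v \in Q -> ~~ (s < v < t)%E.
  by move=> vQ; apply: free; rewrite inE mem_cat vQ !orbT.
have : ~~ (s < u < t)%E by apply: free; rewrite inE eqxx.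
rewrite negb_and -!leNgt => /orP[us|tu]; first exact: hQ.
exact: hP.
Qed.

(** The interval is cut at the break points of [f], one at a time. Applied to two functions in turn,
    this reduces a claim to segments on which both are linear, without forming a common list of
    break points. *)
Lemma pl_ind f h e a b : pl_on f e a b ->
  (forall s t, (a <= s)%E -> (s <= t)%E -> (t <= b)%E ->
     linear_on f e (seg s t) -> pl_on h e s t) -> pl_on h e a b.
Proof.
move=> [P]; elim: P a b => [|p P IH] a b hP base.
  have [ab|ba] := leP a b; first by apply: base => //; exact: hP.
  exists [::] => s t as_ st tb _.
  by have := le_trans as_ (le_trans st tb); rewrite leNgt ba.
have [/andP[/ltW ap /ltW pb]|out] := boolP (a < p < b)%E.
- apply: (@pl_join p); apply: IH.
  + move=> s t as_ st tp free; apply: hP => //; first exact: le_trans tp pb.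
    move=> u; rewrite inE => /orP[/eqP ->|/free//].
    by rewrite negb_and -!leNgt tp orbT.
  + by move=> s t h1 h2 h3; apply: base => //; exact: le_trans h3 pb.
  + move=> s t ps st tb free; apply: hP => //; first exact: le_trans ps.
    move=> u; rewrite inE => /orP[/eqP ->|/free//].
    by rewrite negb_and -!leNgt ps.
  + by move=> s t h1 h2 h3; apply: base => //; exact: le_trans ap h1.
- apply: IH base => s t as_ st tb free; apply: hP => // u.
  rewrite inE => /orP[/eqP ->|/free//]; apply: contra out => /andP[h1 h2].
  by rewrite (le_lt_trans as_ h1) (lt_le_trans h2 tb).
Qed.

Lemma pl_max f g e a b : (0 <= a)%E -> pl_on f e a b -> pl_on g e a b ->
  pl_on (fun x => maxe (f x) (g x)) e a b.
Proof.
move=> a_ge0 plf plg; apply: (pl_ind plf) => s t as_ st tb linf.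
apply: (pl_ind (pl_on_sub as_ tb plg)) => s' t' ss st' tt ling.
have {}linf := linear_on_sub (seg_sub ss tt) linf.
have s'_ge0 : (0 <= s')%E by exact: le_trans a_ge0 (le_trans as_ ss).
move: s' t' s'_ge0 linf ling {a_ge0 plf plg as_ st tb ss st' tt s t a b} => s t s_ge0.
move=> [c1 [k1 h1]] [c2 [k2 h2]].
wlog k12 : f g c1 k1 c2 k2 h1 h2 / (k1 <= k2)%R.
  move=> W; have [k12|/ltW k21] := leP k1 k2; first exact: (W f g c1 k1 c2 k2).
  rewrite (_ : (fun x => maxe (f x) (g x)) = fun x => maxe (g x) (f x)).
    exact: (W g f c2 k2 c1 k1).
  by apply/funext => x; rewrite maxC.
have [Ek|ltk] := eqVneq k1 k2.
  subst k2; have [c12|/ltW c21] := leP c1 c2; apply: pl_linear.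
    exists c2, k1 => u hu; rewrite h1// h2//; apply: max_r.
    by rewrite leeD2r.
  exists c1, k1 => u hu; rewrite h1// h2//; apply: max_l.
  by rewrite leeD2r.
have {}ltk : (k1%:~R < k2%:~R :> R)%R by rewrite ltr_int lt_neqAle ltk.
(* The parameter where the two lines cross: as [k1 < k2], [f] dominates below it and [g] above it.
   The segment is split at [u0] unless [u0] falls outside. *)
pose u0 : R := (c1 - c2) / (k2%:~R - k1%:~R).
have u0E : (c1 - c2 = u0 * (k2%:~R - k1%:~R))%R by rewrite /u0 divfK// gt_eqF ?subr_gt0.
have below u : seg s t u -> (u <= u0%:E)%E -> (g (emap M e u) <= f (emap M e u))%E.
  move=> hu; rewrite h1// h2//; case/andP: hu => su _.
  case: u su => [u| |] // su; last by have := le_trans s_ge0 su.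
  rewrite !lee_fin => hu.
  have p1 : 0 <= u0 - u by rewrite subr_ge0.
  have p2 : 0 <= k2%:~R - k1%:~R :> R by rewrite subr_ge0 ltW.
  by have := mulr_ge0 p1 p2; nra.
have above u : seg s t u -> (u0%:E <= u)%E -> (f (emap M e u) <= g (emap M e u))%E.
  move=> hu; rewrite h1// h2//; case/andP: hu => su _.
  case: u su => [u| |] // su.
    rewrite !lee_fin => hu.
    have p1 : 0 <= u - u0 by rewrite subr_ge0.
    have p2 : 0 <= k2%:~R - k1%:~R :> R by rewrite subr_ge0 ltW.
    by have := mulr_ge0 p1 p2; nra.
  move=> _; have [k2n|k2p|k20] := ltgtP (k2%:~R : R) 0.
  - by rewrite !lt0_muley// lte_fin// (lt_trans ltk).
  - have -> : ((k2%:~R : R)%:E * +oo = +oo)%E by rewrite gt0_muley ?lte_fin.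
    by rewrite [(c2%:E + _)%E]addey// leey.
  - by rewrite lt0_muley ?lte_fin -?k20// leNye.
have [u0s|/ltW su0] := leP u0%:E s.
  apply: pl_linear; exists c2, k2 => u hu; rewrite -h2//; apply: max_r.
  by apply: above => //; case/andP: hu => su _; exact: le_trans su.
have [tu0|/ltW u0t] := leP t u0%:E.
  apply: pl_linear; exists c1, k1 => u hu; rewrite -h1//; apply: max_l.
  by apply: below => //; case/andP: hu => _ ut; exact: le_trans tu0.
apply: (@pl_join u0%:E); apply: pl_linear.
  exists c1, k1 => u /andP[su uu0]; have hu : seg s t u.
    by apply/andP; split=> //; exact: le_trans u0t.
  by rewrite -h1//; apply: max_l; exact: below.
exists c2, k2 => u /andP[u0u ut]; have hu : seg s t u.
  by apply/andP; split=> //; exact: le_trans u0u.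
by rewrite -h2//; apply: max_r; exact: above.
Qed.

Lemma pl_sub_fin f g e a b : (0 <= a)%E ->
  (forall u, seg a b u -> g (emap M e u) \is a fin_num) ->
  pl_on f e a b -> pl_on g e a b ->
  pl_on (fun x => f x - g x)%E e a b.
Proof.
move=> a_ge0 fing plf plg; apply: (pl_ind plf) => s t as_ st tb linf.
apply: (pl_ind (pl_on_sub as_ tb plg)) => s' t' ss st' tt ling.
apply: pl_linear.
case: (linear_on_sub (seg_sub ss tt) linf) ling => c1 [k1 h1] [c2 [k2 h2]].
exists (c1 - c2), (k1 - k2) => u hu; rewrite h1// h2//.
have a_s' := le_trans as_ ss; have t'_b := le_trans tt tb.
have := fing u (seg_sub a_s' t'_b hu); rewrite h2//.
case/andP: hu => su _; have := le_trans a_ge0 (le_trans a_s' su).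
case: u su => [u| |] // _ _; first by move=> _; rewrite intrB; congr (_%:E); ring.
(* Only [u = +oo] remains. The value of [g] there is finite, which forces [k2 = 0], so no difference
   of infinite values occurs. *)
have [k2n|k2p|k20] := ltgtP (k2%:~R : R) 0.
- by rewrite lt0_muley ?lte_fin.
- by rewrite gt0_muley ?lte_fin.
- by rewrite intrB k20 subr0 mul0e adde0 addeAC -EFinB.
Qed.

Lemma pl_bigmax (I : Type) (r : seq I) (F : I -> X -> \bar R) g e a b :
  (0 <= a)%E -> pl_on g e a b -> (forall i, pl_on (F i) e a b) ->
  pl_on (fun x => maxe (g x) (\big[maxe/-oo%E]_(i <- r) F i x)) e a b.
Proof.
move=> a_ge0 plg plF; elim: r => [|i r IH].
  rewrite (_ : (fun x => _) = g)//.
  by apply/funext => x; rewrite big_nil; apply: max_l; rewrite leNye.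
rewrite (_ : (fun x => _) = fun x =>
    maxe (F i x) (maxe (g x) (\big[maxe/-oo%E]_(i <- r) F i x))).
  exact: pl_max.
by apply/funext => x; rewrite big_cons maxCA.
Qed.

Lemma right_gap (P : seq (\bar R)) t b : (t < b)%E ->
  exists s, [/\ (t < s)%E, (s <= b)%E & forall u, u \in P -> ~~ (t < u < s)%E].
Proof.
move=> tb; elim: P => [|p P [s [ts sb h]]]; first by exists b; split.
have [tp|pt] := ltP t p; last first.
  exists s; split=> // u; rewrite inE => /orP[/eqP ->|/h//].
  by rewrite negb_and -!leNgt pt.
exists (mine s p); split.
- by rewrite lt_min ts.
- by rewrite ge_min sb.
- move=> u; rewrite inE => /orP[/eqP ->|/h]; rewrite lt_min negb_and.
    by rewrite ltxx andbF orbT.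
  by rewrite !negb_and => /orP[->//|->]; rewrite orbT.
Qed.

Lemma left_gap (P : seq (\bar R)) a t : (a < t)%E ->
  exists s, [/\ (s < t)%E, (a <= s)%E & forall u, u \in P -> ~~ (s < u < t)%E].
Proof.
move=> tb; elim: P => [|p P [s [ts sb h]]]; first by exists a; split.
have [tp|pt] := ltP p t; last first.
  exists s; split=> // u; rewrite inE => /orP[/eqP ->|/h//].
  by rewrite negb_and -!leNgt pt orbT.
exists (maxe s p); split.
- by rewrite gt_max ts.
- by rewrite le_max sb.
- move=> u; rewrite inE => /orP[/eqP ->|/h]; rewrite gt_max negb_and.
    by rewrite ltxx andbF.
  by rewrite !negb_and => /orP[->//|->]; rewrite orbT.
Qed.

Lemma pl_right_germ f e t : pl_on f e 0%E (len e) -> (0 <= t < len e)%E ->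
  exists s, [/\ (t < s)%E, (s <= len e)%E & linear_on f e (seg t s)].
Proof.
move=> [P hP] /andP[t0 tl]; have [s [ts sl h]] := right_gap P tl.
by exists s; split=> //; apply: hP => //; exact: ltW.
Qed.

Lemma pl_left_germ f e t : pl_on f e 0%E (len e) -> (0 < t <= len e)%E ->
  exists s, [/\ (s < t)%E, (0 <= s)%E & linear_on f e (seg s t)].
Proof.
move=> [P hP] /andP[t0 tl]; have [s [ts sl h]] := left_gap P t0.
by exists s; split=> //; apply: hP => //; exact: ltW.
Qed.

End PiecewiseLinear.

(** * Outgoing slopes and orders *)

Section OutgoingSlopes.
Variables (R : realType) (X : topologicalType) (d : X -> X -> \bar R).
Variable M : model d.
Implicit Types (f g : X -> \bar R) (e : edge M) (s t u : \bar R) (k : int).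

Lemma half_pos_dom (h : half_edge M) x t : half_pos h x t -> edge_dom h.1 t.
Proof.
case: h => e [] [_] /= /andP[h1 h2]; apply/andP; split=> //; exact: ltW.
Qed.

(** The two ends of a loop are the same point; the side [h.2] admits only one of them. *)
Lemma half_pos_uniq (h : half_edge M) x t t' :
  half_pos h x t -> half_pos h x t' -> t = t'.
Proof.
move=> ht ht'; have := half_pos_dom ht; have := half_pos_dom ht'.
case: ht ht' => E ht [E' ht'] dom' /edge_domP[t0|tl|int]; last first.
- by have [] := emap_int_inj int dom' (etrans E (esym E')).
- case: (edge_domP dom') => [t'0|->//|int'].
    by move: ht ht'; rewrite tl t'0; case: h.2; rewrite ltxx ?andbF.
  by rewrite tl in E; case: (emap_vmap int' (etrans E' (etrans (esym E) (emap_tgt _)))).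
- case: (edge_domP dom') => [->//|t'l|int'].
    by move: ht ht'; rewrite t0 t'l; case: h.2; rewrite ltxx ?andbF.
  by rewrite t0 in E; case: (emap_vmap int' (etrans E' (etrans (esym E) (emap_src _)))).
Qed.

(** Two parameters determine an affine function, so this is what makes the slope of a germ
    unique. *)
Lemma half_nbhs_two (b : bool) t (A : set (\bar R)) : t <> -oo%E -> (b -> t <> +oo%E) ->
  half_nbhs b t A -> exists s1 s2 : R, [/\ s1 < s2, A s1%:E & A s2%:E].
Proof.
rewrite /half_nbhs /within /=; case: t => [t| |] // _ hb; last first.
  case: b hb => [/(_ isT)//|_] /= [N [_ hN]].
  by exists (N + 1), (N + 2); split; [lra| |]; apply: hN; rewrite ?ltry// lte_fin; lra.
move=> /nbhs_EFin /nbhs_ballP[eps /= eps_gt0 heps].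
have ball_in z : `|t - z| < eps -> (if b then (t%:E < z%:E)%E else (z%:E < t%:E)%E) -> A z%:E.
  by move=> hz; apply: heps.
case: b {hb heps} ball_in => ball_in.
  exists (t + eps / 3), (t + eps / 2); split; first by lra.
    apply: ball_in; last by rewrite lte_fin; lra.
    by rewrite ltr0_norm; lra.
  apply: ball_in; last by rewrite lte_fin; lra.
  by rewrite ltr0_norm; lra.
exists (t - eps / 2), (t - eps / 3); split; first by lra.
  apply: ball_in; last by rewrite lte_fin; lra.
  by rewrite gtr0_norm; lra.
apply: ball_in; last by rewrite lte_fin; lra.
by rewrite gtr0_norm; lra.
Qed.

Lemma outgoing_slope_uniq f (h : half_edge M) x k k' :
  is_outgoing_slope f h x k -> is_outgoing_slope f h x k' -> k = k'.
Proof.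
move=> [t ht [c hc]] [t' ht' [c' hc']].
have tt := half_pos_uniq ht ht'; subst t'.
have := @half_nbhs_two h.2 t _ _ _ (filterI hc hc').
case=> [E|hb E|s1 [s2 [s12 [e1 e1'] [e2 e2']]]].
- by have /andP[] := half_pos_dom ht; rewrite E.
- by case: ht => _; rewrite hb E => /andP[_]; case: (len _).
- move: e1 e2; rewrite e1' e2' -!EFinM -!EFinD => -[E1] [E2].
  set m := (if h.2 then k else - k) in E1 E2.
  set m' := (if h.2 then k' else - k') in E1 E2.
  have : (m%:~R - m'%:~R) * (s1 - s2) = 0 :> R by lra.
  move=> /eqP; rewrite mulf_eq0 => /orP[|]; last by rewrite subr_eq0 lt_eqF.
  rewrite subr_eq0 eqr_int /m /m'; case: h.2 => [/eqP//|].
  by rewrite eqr_opp => /eqP.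
Qed.

Lemma outgoing_slopeE f (h : half_edge M) x k :
  is_outgoing_slope f h x k -> outgoing_slope f h x = k.
Proof.
move=> hk; apply: (@outgoing_slope_uniq f h x _ _ _ hk).
by apply: (@xgetI _ 0 _ k).
Qed.

Lemma right_slopeE f e x t s (c : R) k : half_pos (e, true) x t -> (t < s)%E ->
  (forall u, seg t s u -> f (emap M e u) = (c%:E + (k%:~R : R)%:E * u)%E) ->
  outgoing_slope f (e, true) x = k.
Proof.
move=> ht ts h; apply: outgoing_slopeE; exists t => //; exists c => /=.
have := open_ereal_lt' ts; apply: filterS => u us tu; apply: h.
by apply/andP; split; exact: ltW.
Qed.

Lemma left_slopeE f e x t s (c : R) k : half_pos (e, false) x t -> (s < t)%E ->
  (forall u, seg s t u -> f (emap M e u) = (c%:E + (k%:~R : R)%:E * u)%E) ->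
  outgoing_slope f (e, false) x = - k.
Proof.
move=> ht st h; apply: outgoing_slopeE; exists t => //; exists c => /=.
have := open_ereal_gt' st; apply: filterS => u su ut; rewrite opprK; apply: h.
by apply/andP; split; exact: ltW.
Qed.

Lemma pl_has_slope f (h : half_edge M) x : (forall e, pl_on f e 0%E (len e)) ->
  half_at h x -> exists k, is_outgoing_slope f h x k.
Proof.
move=> plf; case: h => e [] [t ht]; have [/= _ hb] := ht.
- have [s [ts _ [c [k hk]]]] := pl_right_germ (plf e) hb.
  exists k, t => //; exists c; have := open_ereal_lt' ts.
  by apply: filterS => u us tu; apply: hk; apply/andP; split; exact: ltW.
- have [s [st _ [c [k hk]]]] := pl_left_germ (plf e) hb.
  exists (- k), t => //; exists c; have := open_ereal_gt' st.
  apply: filterS => u su ut; rewrite opprK; apply: hk.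
  by apply/andP; split; exact: ltW.
Qed.

Lemma outgoing_slope_shift f (h : half_edge M) x (r : R) :
  (forall e, pl_on f e 0%E (len e)) -> half_at h x ->
  outgoing_slope (fun y => f y - r%:E)%E h x = outgoing_slope f h x.
Proof.
move=> plf hx; have [k hk] := pl_has_slope plf hx.
rewrite (outgoing_slopeE hk); apply: outgoing_slopeE.
case: hk => t ht [c hc]; exists t => //; exists (c - r).
by apply: filterS hc => u ->; rewrite EFinB addeAC.
Qed.

Lemma outgoing_slope_cst (c : R) (h : half_edge M) x :
  half_at h x -> outgoing_slope (fun=> c%:E) h x = 0.
Proof.
case=> t ht; apply: outgoing_slopeE; exists t => //; exists c.
by apply: nearW => u; case: h.2; rewrite ?oppr0 mul0e adde0.
Qed.

(** Near [x] the graph of [g] lies above that of [f] and touches it at [x], so [g] cannot leave [x]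
    with a smaller slope. Orders of the bump are bounded below by exhibiting functions that touch it
    from below. *)
Lemma outgoing_slope_le f g (h : half_edge M) x :
  (forall e, pl_on f e 0%E (len e)) -> (forall e, pl_on g e 0%E (len e)) ->
  (forall t, half_pos h x t -> t <> +oo%E) ->
  (forall y, (f y <= g y)%E) -> f x = g x -> f x \is a fin_num ->
  half_at h x -> outgoing_slope f h x <= outgoing_slope g h x.
Proof.
case: h => e b plf plg tfin fg fgx fx [t ht].
have := tfin t ht; have /andP[t0 _] := half_pos_dom ht.
case: t ht t0 {tfin} => [t| |] // ht t0 _.
have [/= xE hb] := ht; case: b ht hb => ht hb /=.
- have [s1 [ts1 _ [c1 [k1 h1]]]] := pl_right_germ (plf e) hb.
  have [s2 [ts2 _ [c2 [k2 h2]]]] := pl_right_germ (plg e) hb.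
  rewrite (right_slopeE ht ts1 h1) (right_slopeE ht ts2 h2).
  have [u [tu us1 us2]] : exists u : R, [/\ t < u, (u%:E <= s1)%E & (u%:E <= s2)%E].
    have : (t%:E < mine s1 s2)%E by rewrite lt_min ts1 ts2.
    case E : (mine s1 s2) => [m| |] // h.
      exists m; split; first by rewrite -lte_fin.
        by rewrite -E ge_min lexx.
      by rewrite -E ge_min lexx orbT.
    exists (t + 1); split; first by lra.
      by apply: le_trans (leey _) _; rewrite -E ge_min lexx.
    by apply: le_trans (leey _) _; rewrite -E ge_min lexx orbT.
  have tt1 : seg t%:E s1 t%:E by rewrite /seg /= lexx ltW.
  have tt2 : seg t%:E s2 t%:E by rewrite /seg /= lexx ltW.
  have u1 : seg t%:E s1 u%:E by rewrite /seg /= us1 lee_fin ltW.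
  have u2 : seg t%:E s2 u%:E by rewrite /seg /= us2 lee_fin ltW.
  have := fg (emap M e u%:E); rewrite h1// h2// -!EFinM -!EFinD lee_fin.
  move: fgx; rewrite -xE h1// h2// -!EFinM -!EFinD => -[E1] E2.
  rewrite -(ler_int R) -(ler_pM2r (_ : 0 < u - t)) ?subr_gt0//; lra.
- have [s1 [ts1 s1_ge0 [c1 [k1 h1]]]] := pl_left_germ (plf e) hb.
  have [s2 [ts2 s2_ge0 [c2 [k2 h2]]]] := pl_left_germ (plg e) hb.
  rewrite (left_slopeE ht ts1 h1) (left_slopeE ht ts2 h2).
  have [u [tu us1 us2]] : exists u : R, [/\ u < t, (s1 <= u%:E)%E & (s2 <= u%:E)%E].
    have : (maxe s1 s2 < t%:E)%E by rewrite gt_max ts1 ts2.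
    case E : (maxe s1 s2) => [m| |] // h.
      exists m; split; first by rewrite -lte_fin.
        by rewrite -E le_max lexx.
      by rewrite -E le_max lexx orbT.
    by move: s1_ge0; have : (s1 <= maxe s1 s2)%E by [rewrite le_max lexx]; rewrite E leeNy_eq => /eqP ->.
  have tt1 : seg s1 t%:E t%:E by rewrite /seg /= lexx ltW.
  have tt2 : seg s2 t%:E t%:E by rewrite /seg /= lexx ltW.
  have u1 : seg s1 t%:E u%:E by rewrite /seg /= us1 lee_fin ltW.
  have u2 : seg s2 t%:E u%:E by rewrite /seg /= us2 lee_fin ltW.
  have := fg (emap M e u%:E); rewrite h1// h2// -!EFinM -!EFinD lee_fin.
  move: fgx; rewrite -xE h1// h2// -!EFinM -!EFinD => -[E1] E2.
  rewrite lerN2 -(ler_int R) -(ler_pM2r (_ : 0 < t - u)) ?subr_gt0//; lra.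
Qed.

(** Only the two half-edges of [e] leave an interior point. A supporting line of slope [p] forces
    the slope of [g] to be at least [p] on the right and at most [p] on the left, and the order is
    their difference. *)
Lemma ord_at_support g e (u a p rho : R) :
  (forall e, pl_on g e 0%E (len e)) -> (0 < u%:E < len e)%E -> 0 < rho ->
  (forall v : R, `|v - u| < rho -> ((a + p * v)%:E <= g (emap M e v%:E))%E) ->
  g (emap M e u%:E) = (a + p * u)%:E -> 0 <= ord_at M g (emap M e u%:E).
Proof.
move=> plg u_int rho_gt0 supp gu; set x := emap M e u%:E.
have u_dom := edge_dom_int u_int; have [u_gt0 u_len] := andP u_int.
have htr : half_pos (M := M) (e, true) x u%:E by split=> //=; rewrite u_len andbT ltW.
have htl : half_pos (M := M) (e, false) x u%:E by split=> //=; rewrite u_gt0 ltW.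
have only (h : half_edge M) : half_at h x -> h.1 = e.
  move=> [t ht]; have [] := ht => /esym tE _.
  by have [-> _] := emap_int_inj u_int (half_pos_dom ht) tE.
rewrite /ord_at (bigD1 (e, true)) /=; last by apply/asboolP; exists u%:E.
rewrite (bigD1 (e, false)) /=; last first.
  by rewrite xpair_eqE andbF andbT; apply/asboolP; exists u%:E.
rewrite big1 ?addr0; last first.
  move=> [e1 b] /andP[/andP[/asboolP /only /= -> ]].
  by case: b; rewrite ?eqxx// andbF.
have [s1 [us1 _ [c1 [k1 h1]]]] := pl_right_germ (plg e) (proj2 htr).
have [s2 [us2 s2_ge0 [c2 [k2 h2]]]] := pl_left_germ (plg e) (proj2 htl).
rewrite (right_slopeE htr us1 h1) (left_slopeE htl us2 h2) subr_ge0.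
have uu1 : seg u%:E s1 u%:E by rewrite /seg /= lexx ltW.
have uu2 : seg s2 u%:E u%:E by rewrite /seg /= lexx ltW.
have := h1 _ uu1; rewrite gu -EFinM -EFinD => -[E1].
have := h2 _ uu2; rewrite gu -EFinM -EFinD => -[E2].
have p_k1 : p <= k1%:~R.
  have [v [uv vs vr]] : exists v : R, [/\ u < v, (v%:E <= s1)%E & v < u + rho].
    case: s1 us1 {h1 uu1} => [s1| |] //; last by exists (u + rho / 2); rewrite leey; split=> //; lra.
    rewrite lte_fin => us1; exists (Num.min s1 (u + rho / 2)).
    by rewrite lt_min us1 lee_fin ge_min lexx gt_min /=; split=> //; lra.
  have hv : seg u%:E s1 v%:E by rewrite /seg /= vs lee_fin ltW.
  have := supp v; rewrite (h1 _ hv) -EFinM -EFinD lee_fin gtr0_norm ?subr_gt0//.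
  move=> /(_ _)/wrap[|]; first by lra.
  by move=> H; rewrite -(ler_pM2r (_ : 0 < v - u)) ?subr_gt0//; lra.
have k2_p : k2%:~R <= p.
  have [v [uv vs vr]] : exists v : R, [/\ v < u, (s2 <= v%:E)%E & u - rho < v].
    case: s2 us2 s2_ge0 {h2 uu2} => [s2| |] // us2 _.
    rewrite lte_fin in us2; exists (Num.max s2 (u - rho / 2)).
    by rewrite gt_max us2 lee_fin le_max lexx lt_max /=; split=> //; lra.
  have hv : seg s2 u%:E v%:E by rewrite /seg /= vs lee_fin ltW.
  have := supp v; rewrite (h2 _ hv) -EFinM -EFinD lee_fin ltr0_norm ?subr_lt0//.
  move=> /(_ _)/wrap[|]; first by lra.
  by move=> H; rewrite -(ler_pM2r (_ : 0 < u - v)) ?subr_gt0//; lra.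
by rewrite -(ler_int R); exact: le_trans k2_p p_k1.
Qed.

Lemma leaf_half_edge e (h : half_edge M) : len e = +oo%E ->
  half_at h (emap M e +oo%E) -> h = (e, false).
Proof.
move=> le_oo [t ht]; have /valence1P[hs hl] := infinite_leaf le_oo.
have xE : emap M e +oo%E = vmap M (tgt e) by rewrite -emap_tgt le_oo.
have [hE hb] := ht; rewrite xE in hE; move: hE hb.
case: (edge_domP (half_pos_dom ht)) => [->|->|int].
- by rewrite emap_src => /vmap_inj /hs.
- rewrite emap_tgt => /vmap_inj /hl <-; case: h {ht} => e1 [] //=.
  by rewrite ltxx andbF.
- by move=> /emap_vmap -/(_ int).
Qed.

Lemma ord_at_infinity f e s (c : R) k : len e = +oo%E -> (s < +oo)%E ->
  (forall u, seg s +oo%E u -> f (emap M e u) = (c%:E + (k%:~R : R)%:E * u)%E) ->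
  ord_at M f (emap M e +oo%E) = - k.
Proof.
move=> le_oo s_oo hf.
have hp : half_pos (M := M) (e, false) (emap M e +oo%E) +oo%E.
  by split=> //=; rewrite le_oo lexx ltry.
rewrite /ord_at (bigD1 (e, false)) /=; last by apply/asboolP; exists +oo%E.
rewrite big1 ?addr0; first exact: left_slopeE hp s_oo hf.
by move=> h /andP[/asboolP /(leaf_half_edge le_oo) ->]; rewrite eqxx.
Qed.

End OutgoingSlopes.

Section RationalFunctions.
Variables (R : realType) (Gamma : metricGraph R).
Let M := refmodel Gamma.
Implicit Types (f g : Gamma -> \bar R) (e : edge M).

Lemma int_not_at_infinity e t : (0 < t < len e)%E -> ~ at_infinity (emap M e t).
Proof.
move=> h [e1 [l1 E]]; have d1 : edge_dom e1 +oo%E by rewrite -l1; exact: edge_dom_len.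
have [ee tE] := emap_int_inj h d1 (esym E); move: h; rewrite tE.
by case/andP => _; case: (len e).
Qed.

Lemma finite_params (B : set Gamma) e : finite_set B ->
  exists P : seq (\bar R), forall u, (0 < u < len e)%E ->
    B (emap M e u) <-> u \in P.
Proof.

move=> /finite_seqP[r ->].
pose par b := xget 0%E [set u | (0 < u < len e)%E /\ emap M e u = b].
exists [seq u <- [seq par b | b <- r] | emap M e u \in r] => u h /=.
rewrite mem_filter; split=> [ur|/andP[]//]; rewrite ur /=.
apply/mapP; exists (emap M e u) => //; rewrite /par.
case: xgetP => [v _ [hv E]|/(_ u)[]//].
by have [_ ->] := emap_inj hv h E.
Qed.

Lemma piecewise_linear_pl f : piecewise_linear f -> forall e, pl_on f e 0%E (len e).
Proof.
move=> [_ [B finB hB]] e; have [P hP] := finite_params e finB.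
exists P => s t s0 st tl free; apply: hB => // u sut /hP.
have /andP[su ut] := sut.
rewrite (le_lt_trans s0 su) (lt_le_trans ut tl) => /(_ isT) /free.
by rewrite sut.
Qed.

Lemma pl_piecewise_linear f : (forall x, ~ at_infinity x -> f x \is a fin_num) ->
  (forall e, pl_on f e 0%E (len e)) -> piecewise_linear f.
Proof.
move=> ffin plf; split=> //.
have [P hP] := choice plf.
exists (\bigcup_(e in [set: edge M]) emap M e @` [set` P e]).
  apply: bigcup_finite; first exact: finite_finset.
  by move=> e _; apply: finite_image; exact: finite_seq.
move=> e s t s0 st tl free; apply: hP => // u uP; apply/negP => sut.
by apply: (free u sut); exists e => //; exists u.
Qed.

End RationalFunctions.

(** * The bump function *)

Section InfiniteAction.
Variables (K : finGroupType) (X : Type) (to : {action K &-> X}).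

(* The library states the action laws only for finite [X]. *)
Lemma tactM x a b : to x (a * b)%g = to (to x a) b.
Proof. by have [_ h] : is_action [set: K]%SET to by [case: to]; apply: h; rewrite inE. Qed.

Lemma tact_inj a : injective (fun x => to x a).
Proof. by have [h _] : is_action [set: K]%SET to by [case: to]; exact: h. Qed.

Lemma tact1 x : to x 1%g = x.
Proof. by apply: (@tact_inj 1%g); rewrite -tactM mulg1. Qed.

Lemma tactK a x : to (to x a) a^-1%g = x.
Proof. by rewrite -tactM mulgV tact1. Qed.

Lemma tactKV a x : to (to x a^-1%g) a = x.
Proof. by rewrite -tactM mulVg tact1. Qed.

End InfiniteAction.

Section Bump.
Variables (R : realType) (Gamma : metricGraph R).
Let M := refmodel Gamma.
Variables (K : finGroupType) (to : {action K &-> Gamma}) (D : divisor Gamma).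
Hypothesis iso : acts_isometrically to.
Hypothesis D_ge0 : effective D.
Variables (f : Gamma -> \bar R) (x0 : Gamma) (c eps : R).
Variables (ea : K -> edge M) (ua ca : K -> R) (ka : K -> int).
Hypothesis f_pl : piecewise_linear f.
Hypothesis f_ord : forall x, 0 <= D x + ord_at M f x.
Hypothesis f_inv : forall (a : K) x, f (to x a) = f x.
Hypothesis eps_gt0 : 0 < eps.
Hypothesis fx0 : f x0 = c%:E.
Hypothesis orbitE : forall a, to x0 a = emap M (ea a) (ua a)%:E.
Hypothesis ua_ge : forall a, eps <= ua a.
Hypothesis ua_le : forall a, ((ua a + eps)%:E <= len (ea a))%E.
Hypothesis f_loc : forall a (u : R), `|u - ua a| <= eps ->
  f (emap M (ea a) u%:E) = (ca a + (ka a)%:~R * u)%:E.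

(** The truncation makes the tent constant outside the chart around [to x0 a], so subtracting it
    changes no slope there. The maximum of [- tent a] over [a] is minus the truncated distance to
    the orbit, which is [K]-invariant. *)
Definition tent (a : K) (x : Gamma) : \bar R := mine eps%:E (dist (to x0 a) x).

(* The bump shaves one unit of slope off [f] just above the orbit of [x0]: the
   chips of [max(f, c)] sitting on the level set [f = c] pay for it. *)
Definition bump (x : Gamma) : \bar R :=
  maxe c%:E (\big[maxe/-oo%E]_(a : K) (f x - tent a x))%E.

Lemma tent_bounds a x : (0 <= tent a x <= eps%:E)%E.
Proof.
rewrite /tent ge_min lexx /= andbT le_min lee_fin ltW//=.
rewrite (model_dist M); apply: le_ereal_inf_tmp => r /=.
exact: chain_ge0 (@edge_step_ge0 _ _ _ _).
Qed.

Lemma tent_fin a x : tent a x \is a fin_num.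
Proof.
have /andP[h1 h2] := tent_bounds a x.
by rewrite ge0_fin_numE//; apply: le_lt_trans h2 _; exact: ltry.
Qed.

Lemma orbit_int a (u : R) : `|u - ua a| < eps -> (0 < u%:E < len (ea a))%E.
Proof.
rewrite ltr_distl => /andP[h1 h2]; have h3 := ua_ge a; apply/andP; split.
  by rewrite lte_fin; lra.
by apply: lt_le_trans (ua_le a); rewrite lte_fin; lra.
Qed.

Lemma orbit_int0 a : (0 < (ua a)%:E < len (ea a))%E.
Proof. by apply: orbit_int; rewrite subrr normr0. Qed.

Lemma tent_near a x : (tent a x < eps%:E)%E ->
  exists w : R, [/\ x = emap M (ea a) w%:E, tent a x = `|w - ua a|%:E
    & `|w - ua a| < eps].
Proof.
rewrite /tent gt_min ltxx /= => h.
have := h; rewrite orbitE => /(dist_interior (ua_ge a) (ua_le a))[w xE dE].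
exists w; move: h; rewrite -lte_fin -dE orbitE => h; split=> //.
by apply: min_r; exact: ltW.
Qed.

(** Near the orbit point this is [tent_near]. Elsewhere on the edge the tent equals [eps]; the
    distance is then at least [eps], and so is the upper bound [|v - ua a|] for it. Hence both
    minima are [eps], even if a path outside the edge is shorter. *)
Lemma tent_same a v : edge_dom (ea a) v ->
  tent a (emap M (ea a) v) = mine eps%:E `|v - (ua a)%:E|%E.
Proof.
move=> hv; have [|ge] := ltP (tent a (emap M (ea a) v)) eps%:E.
  move=> /[dup] lt /tent_near[w [xE tE w_eps]].
  have [_ wE] := emap_int_inj (orbit_int w_eps) hv (esym xE).
  by rewrite tE -wE -EFinB abse_EFin; apply/esym/min_r; rewrite lee_fin ltW.
have -> : tent a (emap M (ea a) v) = eps%:E.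
  by apply/eqP; rewrite eq_le ge andbT; case/andP: (tent_bounds a (emap M (ea a) v)).
apply/esym/min_l; apply: le_trans ge _; rewrite /tent ge_min; apply/orP; right.
by rewrite orbitE abse_subC; apply: dist_edge_le => //; exact: edge_dom_int (orbit_int0 a).
Qed.

Lemma tent_other a e v : e <> ea a -> edge_dom e v -> tent a (emap M e v) = eps%:E.
Proof.
move=> ne hv; apply/eqP; have /andP[_] := tent_bounds a (emap M e v).
rewrite le_eqVlt => /orP[//|/tent_near[w [xE _ w_eps]]].
by have [/esym] := emap_int_inj (orbit_int w_eps) hv (esym xE).
Qed.

Lemma tent_pl a e : pl_on (M := M) (tent a) e 0%E (len e).
Proof.
have [E|ne] := eqVneq e (ea a); last first.
  apply: pl_linear; exists eps, 0 => v hv.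
  by rewrite tent_other ?mul0e ?adde0//; exact/eqP.
subst e; have u_ge := ua_ge a; have u_le := ua_le a.
have [u uE] : exists u, u = ua a by exists (ua a).
rewrite -uE in u_ge u_le; have e_gt0 := eps_gt0.
have dom v : seg 0%E (len (ea a)) v -> edge_dom (ea a) v by [].
have piece (s t : R) (A : R) (k : int) : 0 <= s -> (t%:E <= len (ea a))%E ->
    (forall v : R, s <= v <= t -> Num.min eps `|v - u| = A + k%:~R * v) ->
    pl_on (M := M) (tent a) (ea a) s%:E t%:E.
  move=> s0 tl h; apply: pl_linear; exists A, k => v /andP[sv vt].
  rewrite tent_same -?uE; last first.
    by apply/andP; split; [exact: le_trans sv|exact: le_trans tl].
  case: v sv vt => [v| |] //; rewrite !lee_fin => sv vt.
  rewrite -EFinB abse_EFin -EFin_min h; last by rewrite sv vt.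
  by rewrite -EFinM -EFinD.
apply: (@pl_join _ _ _ _ (u - eps)%:E).
  apply: (piece _ _ eps 0) => //.
    by apply: le_trans u_le; rewrite lee_fin; lra.
  move=> v /andP[v0 vu]; rewrite mul0r addr0; apply: min_l.
  by rewrite ler0_norm; lra.
apply: (@pl_join _ _ _ _ u%:E).
  apply: (piece _ _ u (-1)); first by lra.
    by apply: le_trans u_le; rewrite lee_fin; lra.
  move=> v /andP[v0 vu]; have -> : `|v - u| = u - v by rewrite ler0_norm ?opprB ?subr_le0.
  by rewrite mulN1r min_r; lra.
apply: (@pl_join _ _ _ _ (u + eps)%:E).
  apply: (piece _ _ (- u) 1) => //; first by lra.
  move=> v /andP[v0 vu]; have -> : `|v - u| = v - u by rewrite ger0_norm ?subr_ge0.
  by rewrite mul1r min_r; lra.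
apply: pl_linear; exists eps, 0 => v /andP[uv vl].
rewrite mul0e adde0 tent_same -?uE; last first.
  apply/andP; split=> //; apply: le_trans uv.
  by have h : 0 <= u + eps by [lra]; exact: h.
apply: min_l; case: v uv vl => [v| |] // uv _; last exact: leey.
rewrite lee_fin in uv; rewrite -EFinB abse_EFin lee_fin.
by rewrite ger0_norm; lra.
Qed.

Lemma bump_inv (b : K) x : bump (to x b) = bump x.
Proof.
rewrite /bump; congr maxe; rewrite (reindex_inj (mulIg b)) /=.
apply: eq_bigr => a _; rewrite f_inv /tent.
rewrite tactM; have [_ iso_b] := iso b.
by rewrite iso_b.
Qed.

Lemma bump_ge_c x : (c%:E <= bump x)%E.
Proof. by rewrite /bump le_max lexx. Qed.

Lemma bump_ge a x : (f x - tent a x <= bump x)%E.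
Proof.
rewrite /bump le_max; apply/orP; right.
by have := le_bigmax (-oo%E) (fun b => (f x - tent b x)%E) a.
Qed.

Lemma bump_cases x : bump x = c%:E \/ exists a, bump x = (f x - tent a x)%E.
Proof.
rewrite /bump; case: leP => [|lt]; last by left.
set F := fun a => (f x - tent a x)%E => _; right.
have -> : \big[maxe/-oo%E]_(a : K) F a = F [arg max_(i > 1%g) F i]%O.
  by apply: bigmax_eq_arg => // i _; rewrite leNye.
by eexists.
Qed.

Lemma bump_le x : (bump x <= maxe c%:E (f x))%E.
Proof.
case: (bump_cases x) => [->|[a ->]]; first by rewrite le_max lexx.
rewrite le_max; apply/orP; right; rewrite leeBlDr ?tent_fin//.
by rewrite leeDl//; case/andP: (tent_bounds a x).
Qed.

Lemma bump_pl e : pl_on (M := M) bump e 0%E (len e).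
Proof.
apply: pl_bigmax => //.
  by apply: pl_linear; exists c, 0 => t _; rewrite mul0e adde0.
move=> a; apply: pl_sub_fin => //; first by move=> u _; exact: tent_fin.
  exact: piecewise_linear_pl.
exact: tent_pl.
Qed.

Lemma bump_fin x : ~ at_infinity x -> bump x \is a fin_num.
Proof.
move=> /(proj1 f_pl) h; case: (bump_cases x) => [->//|[a ->]].
by rewrite fin_numB h tent_fin.
Qed.

Lemma shifted_pl (r : R) e : pl_on (M := M) (fun x => f x - r%:E)%E e 0%E (len e).
Proof.
apply: pl_sub_fin => //; first exact: piecewise_linear_pl.
by apply: pl_linear; exists r, 0 => t _; rewrite mul0e adde0.
Qed.

(** The order at the end is minus the slope [k] towards it. If [k <= 0], effectiveness of [D]
    suffices; if [k] is at most the slope [k1] of [f], the inequality for [f] does. Otherwise the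
    bump would eventually exceed both [c] and [f]. *)
Lemma bump_ord_infinite e : len e = +oo%E ->
  0 <= D (emap M e +oo%E) + ord_at M bump (emap M e +oo%E).
Proof.
move=> le_oo; have hl : (0%E < (+oo%E : \bar R) <= len e)%E by rewrite le_oo lexx andbT lt0y.
have [s [s_oo s_ge0 [C [k hk]]]] := pl_left_germ (bump_pl e) hl.
have [s1 [s1_oo s1_ge0 [C1 [k1 hk1]]]] :=
  pl_left_germ (piecewise_linear_pl f_pl e) hl.
rewrite (ord_at_infinity le_oo s_oo hk).
have := f_ord (emap M e +oo%E); rewrite (ord_at_infinity le_oo s1_oo hk1).
have := D_ge0 (emap M e +oo%E).
suff : k <= 0 \/ k <= k1 by lia.
have [k_le0|k_gt0] := leP k 0; [by left|right].
rewrite leNgt; apply/negP => k1_k.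
have [r [r0 sr s1r]] : exists r : R, [/\ 0 <= r, (s <= r%:E)%E & (s1 <= r%:E)%E].
  case: s s_oo s_ge0 {hk} => [s| |] // _; rewrite lee_fin => s_ge0.
  case: s1 s1_oo s1_ge0 {hk1} => [s1| |] // _; rewrite lee_fin => s1_ge0.
  by exists (s + s1); rewrite !lee_fin; split; lra.
(* Past [r] both linear formulas hold. As [k] is at least 1 and exceeds [k1] by at least 1, the
   growth of the bump beats [c] and [f] by at least [v], which is chosen to outweigh the differences
   of the constants. *)
pose v := r + `|c - C| + `|C1 - C| + 1.
have v_r : r <= v by rewrite /v -!addrA lerDl !addr_ge0.
have vc : c - C < v by rewrite /v; have := ler_norm (c - C); have := normr_ge0 (C1 - C); lra.
have vC : C1 - C < v by rewrite /v; have := ler_norm (C1 - C); have := normr_ge0 (c - C); lra.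
have v_ge0 : 0 <= v by exact: le_trans v_r.
have := bump_le (emap M e v%:E).
rewrite hk; last by rewrite /seg /= leey andbT (le_trans sr)// lee_fin.
rewrite hk1; last by rewrite /seg /= leey andbT (le_trans s1r)// lee_fin.
rewrite -!EFinM -!EFinD le_max !lee_fin.
have k_ge1 : 1 <= k%:~R :> R by rewrite ler1z -gtz0_ge1.
have kk1 : k1%:~R + 1 <= k%:~R :> R.
  have : (k1 + 1)%:~R <= k%:~R :> R by rewrite ler_int lezD1.
  by rewrite intrD.
have m1 : v <= k%:~R * v by rewrite ler_peMl.
have m2 : k1%:~R * v + v <= k%:~R * v.
  by rewrite -[X in _ + X]mul1r -mulrDl ler_wpM2r.
by case/orP; lra.
Qed.

(** At a finite point the bump is touched from below by a function of known order: by the constant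
    [c] where it equals [c], in particular on the orbit of [x0]; by [f - eps], with the order of
    [f], where the relevant tent has reached [eps]; and on the open slopes of a tent by an affine
    function. In the first and last cases [D >= 0] suffices. *)
Lemma bump_ord x : 0 <= D x + ord_at M bump x.
Proof.
have [[e [le_oo <-]]|x_fin] := pselect (at_infinity x); first exact: bump_ord_infinite.
have real h t : half_pos (M := M) h x t -> t <> +oo%E.
  move=> ht tE; apply: x_fin; exists h.1; move: (half_pos_dom ht); rewrite tE.
  case/andP => _ l; split; first by apply/eqP; rewrite eq_le leey.
  by case: ht; rewrite tE.
have plc e : pl_on (M := M) (fun=> c%:E) e 0%E (len e).
  by apply: pl_linear; exists c, 0 => t _; rewrite mul0e adde0.
have atc : bump x = c%:E -> 0 <= D x + ord_at M bump x.
  move=> xc; apply: addr_ge0 => //; apply: sumr_ge0 => h /asboolP hx.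
  rewrite -(outgoing_slope_cst c hx).
  exact: outgoing_slope_le plc bump_pl (real h) bump_ge_c (esym xc) _ hx.
case: (bump_cases x) => [//|[a xa]].
have f_x := proj1 f_pl x x_fin.
have [lt|ge] := ltP (tent a x) eps%:E; last first.
  have tE : tent a x = eps%:E.
    by apply/eqP; rewrite eq_le ge andbT; case/andP: (tent_bounds a x).
  rewrite tE in xa; apply: le_trans (f_ord x) _; rewrite lerD2l /ord_at.
  apply: ler_sum => h /asboolP hx.
  rewrite -(outgoing_slope_shift eps (piecewise_linear_pl f_pl) hx).
  apply: outgoing_slope_le (shifted_pl eps) bump_pl (real h) _ (esym xa) _ hx.
    move=> y; apply: le_trans (bump_ge a y); apply: leeB => //.
    by case/andP: (tent_bounds a y).
  by rewrite fin_numB f_x.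
have [w [xE tE w_eps]] := tent_near lt.
have [wu|w_ne] := eqVneq w (ua a).
  apply: atc; rewrite xa tE wu subrr normr0 sube0 xE wu -orbitE f_inv.
  exact: fx0.
apply: addr_ge0 => //; rewrite xE.
have ge_loc v : `|v - ua a| <= eps ->
    ((ca a + (ka a)%:~R * v - `|v - ua a|)%:E <= bump (emap M (ea a) v%:E))%E.
  move=> hv; apply: le_trans (bump_ge a _); rewrite f_loc// EFinB.
  apply: leeB => //; rewrite tent_same; last first.
    have := ua_ge a; move: hv; rewrite ler_distl => /andP[h1 h2] h3.
    apply/andP; split; first by rewrite lee_fin; lra.
    by apply: le_trans (ua_le a); rewrite lee_fin; lra.
  by rewrite -EFinB abse_EFin ge_min lexx orbT.
have gt0 : 0 < `|w - ua a| by rewrite normr_gt0 subr_eq0.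
(* Within [rho] of [w] a parameter stays in the chart and on the same side of [ua a] as [w], so
   [|v - ua a|] is affine there. *)
pose rho := Num.min `|w - ua a| (eps - `|w - ua a|).
have rho_gt0 : 0 < rho by rewrite lt_min gt0 subr_gt0.
have w_val : bump (emap M (ea a) w%:E) = (ca a + (ka a)%:~R * w - `|w - ua a|)%:E.
  by rewrite -xE xa tE xE f_loc ?ltW// EFinB.
have near v : `|v - w| < rho -> `|v - ua a| <= eps /\
    `|v - w| < `|w - ua a|.
  rewrite lt_min => /andP[h1 h2]; split=> //.
  by have := ler_distD w v (ua a); lra.
have [w_lt|w_gt|wE] := ltgtP w (ua a); last by rewrite wE eqxx in w_ne.
- apply: (ord_at_support (a := ca a - ua a) (p := (ka a)%:~R + 1) bump_pl
    (orbit_int w_eps) rho_gt0).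
    move=> v /near[/ge_loc h1]; rewrite (ltr0_norm (_ : w - ua a < 0)) ?subr_lt0//.
    rewrite ltr_distl => /andP[_ h2]; move: h1; rewrite ltr0_norm ?subr_lt0; last by lra.
    by congr (is_true (Order.le _ _)); congr (_%:E); ring.
  by rewrite w_val ltr0_norm ?subr_lt0//; congr (_%:E); ring.
- apply: (ord_at_support (a := ca a + ua a) (p := (ka a)%:~R - 1) bump_pl
    (orbit_int w_eps) rho_gt0).
    move=> v /near[/ge_loc h1]; rewrite (gtr0_norm (_ : 0 < w - ua a)) ?subr_gt0//.
    rewrite ltr_distl => /andP[h2 _]; move: h1; rewrite gtr0_norm ?subr_gt0; last by lra.
    by congr (is_true (Order.le _ _)); congr (_%:E); ring.
  by rewrite w_val gtr0_norm ?subr_gt0//; congr (_%:E); ring.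
Qed.

Lemma bump_RDK : RDK to D bump.
Proof.
split; last by move=> b x; exact: bump_inv.
right; split; last exact: bump_ord.
exact: pl_piecewise_linear bump_fin bump_pl.
Qed.

End Bump.

(** * Two slopes differ by one *)

Section UnitGap.
Variable R : realType.

Lemma finite_eps (T : finType) (Q : T -> R -> Prop) :
  (forall a r r', 0 < r' <= r -> Q a r -> Q a r') ->
  (forall a, exists2 r, 0 < r & Q a r) -> exists2 r, 0 < r & forall a, Q a r.
Proof.
move=> mono ex.
have [r hr] := choice (fun a => let: ex_intro2 r r0 q := ex a in ex_intro (fun r => 0 < r /\ Q a r) r (conj r0 q)).
have gt0 : 0 < \big[Num.min/1]_a r a.
  by apply: lt_bigmin => // a _; case: (hr a).
exists (\big[Num.min/1]_a r a) => // a.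
by apply: (mono a (r a)); [rewrite gt0 bigmin_le|case: (hr a)].
Qed.

Lemma two_sided_gap (P : seq (\bar R)) (lo hi : \bar R) (u : R) :
  (lo < u%:E < hi)%E -> u%:E \notin P ->
  exists2 r : R, 0 < r & [/\ (lo <= (u - r)%:E)%E, ((u + r)%:E <= hi)%E
    & forall p, p \in P -> ~~ ((u - r)%:E < p < (u + r)%:E)%E].
Proof.
case/andP => lo_u u_hi uP.
have [s1 [us1 s1h h1]] := right_gap P u_hi.
have [s2 [s2u los2 h2]] := left_gap P lo_u.
have [r1 r1_gt0 r1s] : exists2 r1 : R, 0 < r1 & ((u + r1)%:E <= s1)%E.
  case: s1 us1 {s1h h1} => [s1| |] //; last by exists 1; rewrite ?ltr01 ?leey.
  by rewrite lte_fin => h; exists (s1 - u); rewrite ?subr_gt0// addrC subrK.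
have [r2 r2_gt0 r2s] : exists2 r2 : R, 0 < r2 & (s2 <= (u - r2)%:E)%E.
  case: s2 s2u {los2 h2} => [s2| |] //; last by exists 1; rewrite ?ltr01 ?leNye.
  by rewrite lte_fin => h; exists (u - s2); rewrite ?subr_gt0// opprB addrC subrK.
pose r := Num.min r1 r2.
have rr1 : r <= r1 by rewrite ge_min lexx.
have rr2 : r <= r2 by rewrite ge_min lexx orbT.
have hi_r : ((u + r)%:E <= s1)%E by apply: le_trans r1s; rewrite lee_fin lerD2l.
have lo_r : (s2 <= (u - r)%:E)%E by apply: le_trans r2s _; rewrite lee_fin lerB.
exists r; first by rewrite lt_min r1_gt0.
split; [exact: le_trans lo_r|exact: le_trans s1h|move=> p pP].
apply/negP => /andP[p1 p2]; have [up|pu|pu] := ltgtP u%:E p.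
- by have := h1 p pP; rewrite up (lt_le_trans p2 hi_r).
- by have := h2 p pP; rewrite pu (le_lt_trans lo_r p1).
- by move: uP; rewrite pu pP.
Qed.

Variable Gamma : metricGraph R.
Let M := refmodel Gamma.

Lemma generic_param (F : set Gamma) (e : edge M) (s t : \bar R) :
  finite_set F -> (0 <= s)%E -> (s < t)%E -> (t <= len e)%E ->
  exists u : R, (s < u%:E < t)%E /\ ~ F (emap M e u%:E).
Proof.
move=> finF s0 st tl; have [P hP] := finite_params e finF.
have [s1 [ss1 s1t h]] := right_gap P st.
have [u [su us1]] : exists u : R, (s < u%:E)%E /\ (u%:E < s1)%E.
  case: s s0 ss1 {st h} => [s| |] // _; last by rewrite ltNge leey.
  case: s1 {s1t} => [s1| |] //; last by move=> _; exists (s + 1); rewrite lte_fin ltry; split=> //; lra.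
  by rewrite lte_fin => h; exists ((s + s1) / 2); rewrite !lte_fin; split; lra.
have ut := lt_le_trans us1 s1t.
exists u; rewrite su ut; split=> //.
move=> /hP; rewrite (le_lt_trans s0 su) (lt_le_trans ut tl) => /(_ isT) /h.
by rewrite su us1.
Qed.

Variables (K : finGroupType) (to : {action K &-> Gamma}) (D : divisor Gamma).
Variables (n : nat) (f : 'I_n -> Gamma -> \bar R).
Hypothesis iso : acts_isometrically to.
Hypothesis D_ge0 : effective D.
Hypothesis f_gen : min_generating f (RDK to D).

Lemma RD_piecewise_linear (g : Gamma -> \bar R) x : RD D g -> g x <> -oo%E ->
  piecewise_linear g /\ forall y, 0 <= D y + ord_at M g y.
Proof. by case=> [->|//]. Qed.

(** For a generic [u0] the whole orbit avoids vertices and break points, and one radius serves its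
    finitely many points. The doubled room around [u0] is for orbit points within [eps] of a point
    that is itself within [eps] of [u0]: they too must have parameters between [s] and [t]. *)
Lemma local_charts (g : Gamma -> \bar R) (e : edge M) (s t : \bar R) :
  piecewise_linear g -> (0 <= s)%E -> (s < t)%E -> (t <= len e)%E ->
  exists (u0 eps : R) (ea : K -> edge M) (ua ca : K -> R) (ka : K -> int),
  [/\ 0 < eps, (s <= (u0 - eps *+ 2)%:E)%E /\ ((u0 + eps *+ 2)%:E <= t)%E,
      forall a, to (emap M e u0%:E) a = emap M (ea a) (ua a)%:E,
      forall a, eps <= ua a /\ ((ua a + eps)%:E <= len (ea a))%E
    & forall a (u : R), `|u - ua a| <= eps ->
        g (emap M (ea a) u%:E) = (ca a + (ka a)%:~R * u)%:E].
Proof.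
move=> g_pl s0 st tl.
have [P hP] := choice (piecewise_linear_pl g_pl).
pose Bad : set Gamma := range (vmap M) `|`
  \bigcup_(e1 in [set: edge M]) emap M e1 @` [set` P e1].
have finBad : finite_set Bad.
  rewrite finite_setU; split; first exact/finite_image/finite_finset.
  apply: bigcup_finite; first exact: finite_finset.
  by move=> e1 _; exact/finite_image/finite_seq.
pose F : set Gamma := \bigcup_(a in [set: K]) (fun x => to x a) @^-1` Bad.
have finF : finite_set F.
  apply: bigcup_finite; first exact: finite_finset.
  by move=> a _; apply: finite_preimage => // x y _ _; exact: tact_inj.
have [u0 [/andP[su0 u0t] u0F]] := generic_param finF s0 st tl.
have chart a : exists p : edge M * R,
    [/\ to (emap M e u0%:E) a = emap M p.1 p.2%:E, (0 < p.2%:E < len p.1)%E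
      & p.2%:E \notin P p.1].
  have notBad : ~ Bad (to (emap M e u0%:E) a) by move=> h; apply: u0F; exists a.
  case: (model_cover M (to (emap M e u0%:E) a)) => [[v E]|[e1 [u1 [h E]]]].
    by case: notBad; left; exists v.
  have [u1' u1E] := interior_fin h; subst u1; exists (e1, u1'); split=> //=.
  by apply/negP => h'; apply: notBad; right; exists e1 => //; exists u1'%:E.
have {chart} [p hp] := choice chart.
have [eps eps_gt0 heps] : exists2 eps, 0 < eps & forall a,
    [/\ eps <= (p a).2, (((p a).2 + eps)%:E <= len (p a).1)%E,
        forall q, q \in P (p a).1 -> ~~ (((p a).2 - eps)%:E < q < ((p a).2 + eps)%:E)%E
      & (s <= (u0 - eps *+ 2)%:E)%E /\ ((u0 + eps *+ 2)%:E <= t)%E].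
  apply: finite_eps => [a r r' /andP[r'0 r'r] [h1 h2 h3 [h4 h5]]|a].
    split; first exact: le_trans h1.
    - by apply: le_trans h2; rewrite lee_fin lerD2l.
    - move=> q /h3; apply: contra => /andP[q1 q2]; apply/andP; split.
        by apply: le_lt_trans q1; rewrite lee_fin lerB.
      by apply: lt_le_trans q2 _; rewrite lee_fin lerD2l.
    - split; first by apply: le_trans h4 _; rewrite lee_fin; lra.
      by apply: le_trans h5; rewrite lee_fin; lra.
  have [_ pint pP] := hp a.
  have [r r0 [h1 h2 h3]] := two_sided_gap pint pP.
  have [r' r'0 [h1' h2' _]] := two_sided_gap (P := [::]) (introT andP (conj su0 u0t)) isT.
  pose m := Num.min r (r' / 2).
  have mr : m <= r by rewrite ge_min lexx.
  have mr' : m <= r' / 2 by rewrite ge_min lexx orbT.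
  exists m; first by rewrite lt_min r0 divr_gt0.
  split.
  - by move: h1; rewrite lee_fin; lra.
  - by apply: le_trans h2; rewrite lee_fin lerD2l.
  - move=> q /h3; apply: contra => /andP[q1 q2]; apply/andP; split.
      by apply: le_lt_trans q1; rewrite lee_fin lerB.
    by apply: lt_le_trans q2 _; rewrite lee_fin lerD2l.
  - split; first by apply: le_trans h1' _; rewrite lee_fin; lra.
    by apply: le_trans h2'; rewrite lee_fin; lra.
have lin a : exists ck : R * int, forall u : R, `|u - (p a).2| <= eps ->
    g (emap M (p a).1 u%:E) = (ck.1 + ck.2%:~R * u)%:E.
  have [h1 h2 h3 _] := heps a.
  have [||c [k h]] := hP (p a).1 ((p a).2 - eps)%:E ((p a).2 + eps)%:E _ _ h2 h3.
  - by rewrite lee_fin subr_ge0.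
  - by rewrite lee_fin; lra.
  exists (c, k) => u; rewrite ler_distl => /andP[u1 u2].
  by rewrite h /seg /= ?lee_fin ?u1// -EFinM -EFinD.
have {lin} [ck hck] := choice lin.
exists u0, eps, (fun a => (p a).1), (fun a => (p a).2), (fun a => (ck a).1),
  (fun a => (ck a).2); split=> //.
- by have [_ _ _] := heps 1%g.
- by move=> a; have [] := hp a.
- by move=> a; have [h1 h2 _ _] := heps a.
Qed.

(* The slope of a bump of [f i] near [x0] differs by one from that of [f i], and
   it is the slope of some [f j] because the [f j] generate. *)
Lemma unit_gap (e : edge M) (s t : \bar R) (A : 'I_n -> R) (k : 'I_n -> int) i :
  (0 <= s)%E -> (s < t)%E -> (t <= len e)%E ->
  (forall j u, seg s t u ->
     f j (emap M e u) = ((A j)%:E + ((k j)%:~R : R)%:E * u)%E) ->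
  k i <> 0 -> exists j1 j2, k j1 = k j2 + 1.
Proof.
move=> s0 st tl hf ki0; have [f_RDK f_trop _] := f_gen.
have [u1 [u1_in _]] := generic_param (F := set0) (finite_set0 _) s0 st tl.
have segE (u : R) : (s <= u%:E)%E -> (u%:E <= t)%E -> forall j,
    f j (emap M e u%:E) = (A j + (k j)%:~R * u)%:E.
  by move=> h1 h2 j; rewrite hf /seg /= ?h1// -EFinM -EFinD.
have [fi_RD fi_inv] := f_RDK i.
have fi_fin : f i (emap M e u1%:E) <> -oo%E.
  by case/andP: u1_in => /ltW h1 /ltW h2; rewrite segE.
have [fi_pl fi_ord] := RD_piecewise_linear fi_RD fi_fin.
have [u0 [eps [ea [ua [ca [ka [eps_gt0 [su ut] orbE charts loc]]]]]]] :=
  local_charts fi_pl s0 st tl.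
have near (u : R) : `|u - u0| <= eps *+ 2 -> forall j,
    f j (emap M e u%:E) = (A j + (k j)%:~R * u)%:E.
  rewrite ler_distl => /andP[h1 h2]; apply: segE.
    by apply: le_trans su _; rewrite lee_fin.
  by apply: le_trans ut; rewrite lee_fin.
have int (u : R) : `|u - u0| < eps *+ 2 -> (0 < u%:E < len e)%E.
  rewrite ltr_distl => /andP[h1 h2]; apply/andP; split.
    by apply: le_lt_trans s0 _; apply: le_lt_trans su _; rewrite lte_fin.
  by apply: lt_le_trans tl; apply: lt_le_trans ut; rewrite lte_fin.
set x0 := emap M e u0%:E in orbE.
pose c := A i + (k i)%:~R * u0.
have e2 : 0 <= eps *+ 2 by rewrite mulrn_wge0// ltW.
have fx0 : f i x0 = c%:E by rewrite near// subrr normr0.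
have u0_int : (0 < u0%:E < len e)%E by apply: int; rewrite subrr normr0; lra.
have ua_ge a := proj1 (charts a); have ua_le a := proj2 (charts a).
have bumpR := bump_RDK iso D_ge0 fi_pl fi_ord fi_inv eps_gt0 fx0 orbE ua_ge ua_le loc.
have [al [al_oo bumpE]] := f_trop _ bumpR.
have e1E : e = ea 1%g /\ u0%:E = (ua 1%g)%:E.
  apply: (emap_int_inj u0_int); last by rewrite -orbE tact1.
  by apply/edge_dom_int/(orbit_int0 eps_gt0 ua_ge ua_le).
(* In the direction [sg] the function [f i] rises with slope at least 1, so even after the tent
   around [x0] is subtracted it does not fall below [c]. *)
pose sg : R := Num.sg (k i)%:~R.
have ki_ne0 : (k i)%:~R != 0 :> R by rewrite intr_eq0; exact/eqP.
have sg1 : 1 <= sg * (k i)%:~R.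
  by rewrite -normrEsg -intr_norm ler1z -gtz0_ge1 normr_gt0; exact/eqP.
have sgsg : sg * sg = 1 by have := sqr_sg ((k i)%:~R : R); rewrite ki_ne0 expr2.
have sgN : `|sg| = 1 by rewrite normr_sg ki_ne0.
have bump_val (r : R) : 0 <= r < eps ->
    bump to (f i) x0 c eps (emap M e (u0 + sg * r)%:E) =
    (A i + (k i)%:~R * (u0 + sg * r) - r)%:E.
  move=> /andP[r0 re]; set u := u0 + sg * r.
  have uu0 : `|u - u0| = r by rewrite /u addrC addKr normrM sgN mul1r ger0_norm.
  have u_int : (0 < u%:E < len e)%E by apply: int; rewrite uu0; lra.
  have u_val : f i (emap M e u%:E) = (A i + (k i)%:~R * u)%:E by apply: near; rewrite uu0; lra.
  apply/eqP; rewrite eq_le; apply/andP; split.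
    case: (bump_cases to (f i) x0 c eps (emap M e u%:E)) => [->|[a ->]].
      by rewrite lee_fin /c /u; nra.
    (* A tent below [r] at [u] would belong to an orbit point on [e] within [2 eps] of [u0]. By
       invariance [f i] has the value [c] there, but it is affine with nonzero slope on that range,
       so the point is [x0], at distance exactly [r]. *)
    rewrite u_val EFinB; apply: leeB => //; rewrite leNgt; apply/negP => lt.
    have lte : (tent to x0 eps a (emap M e u%:E) < eps%:E)%E.
      by apply: lt_trans lt _; rewrite lte_fin.
    have [w [xE tE w_eps]] := tent_near orbE ua_ge ua_le lte.
    have [eE uwE] := emap_int_inj u_int
      (edge_dom_int (orbit_int ua_ge ua_le w_eps)) xE.
    have wE := EFin_inj uwE.
    move: lt; rewrite tE lte_fin => lt; rewrite -wE in w_eps lt.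
    have : f i (to x0 a) = c%:E by rewrite fi_inv.
    rewrite orbE -eE near; last first.
      have := ler_distD u (ua a) u0; rewrite (distrC (ua a) u) uu0; lra.
    case=> ck; have : (k i)%:~R * (ua a - u0) = 0 by move: ck; rewrite /c; lra.
    move/eqP; rewrite mulf_eq0 intr_eq0 subr_eq0 => /orP[/eqP//|/eqP uau0].
    by move: lt; rewrite uau0 uu0 ltxx.
  apply: le_trans (bump_ge to (f i) x0 c eps 1%g _).
  rewrite u_val EFinB; apply: leeB => //.
  case: e1E => eE uuE; have uE := EFin_inj uuE; rewrite eE (tent_same eps_gt0 orbE ua_ge ua_le); last first.
    by rewrite -eE; exact: edge_dom_int.
  by rewrite -uE -EFinB abse_EFin uu0 ge_min lexx orbT.
(* A translate of some [f j] attains the bump at [r0] and stays below it at [eps / 4] and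
   [3 eps / 4], on either side. Both are affine on this range, so contact at the middle forces equal
   slopes. *)
pose r0 := eps / 2; have r0_in : 0 <= r0 < eps by rewrite /r0; apply/andP; split; lra.
have val j (r : R) : 0 <= r < eps -> f j (emap M e (u0 + sg * r)%:E) =
    (A j + (k j)%:~R * (u0 + sg * r))%:E.
  move=> /andP[h1 h2]; apply: near.
  by rewrite addrC addKr normrM sgN mul1r ger0_norm//; lra.
have [j hj] : exists j, (al j + f j (emap M e (u0 + sg * r0)%:E))%E =
    (A i + (k i)%:~R * (u0 + sg * r0) - r0)%:E.
  rewrite -bump_val// bumpE; pose F j := (al j + f j (emap M e (u0 + sg * r0)%:E))%E.
  exists [arg max_(j > i | j \in [set: 'I_n]%SET) F j]%O; apply/esym.
  by apply: (@bigmax_eq_arg _ _ _ _ _ _ F) => [|j _]; rewrite ?inE ?leNye.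
rewrite val// in hj.
have [b bE] : exists b : R, al j = b%:E.
  by case: (al j) (al_oo j) hj => [b| |] //; exists b.
rewrite bE -EFinD in hj; case: hj => hj.
have le_r (r : R) : 0 <= r < eps ->
    b + (A j + (k j)%:~R * (u0 + sg * r)) <= A i + (k i)%:~R * (u0 + sg * r) - r.
  move=> hr; rewrite -lee_fin -bump_val// bumpE EFinD -bE -val//.
  by apply: (le_bigmax_cond (-oo%E)
    (fun j => (al j + f j (emap M e (u0 + sg * r)%:E))%E)); rewrite inE.
have [m1 m2] : 0 <= eps / 4 < eps /\ 0 <= 3 * eps / 4 < eps.
  by split; apply/andP; split; lra.
have kj : (k j)%:~R * sg = (k i)%:~R * sg - 1 :> R.
  have := le_r _ m1; have := le_r _ m2; move: hj; rewrite /r0 => hj h1 h2.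
  have eps0 : eps != 0 by rewrite gt_eqF.
  have /eqP : eps * ((k j)%:~R * sg - (k i)%:~R * sg + 1) = 0 by nra.
  by rewrite mulf_eq0 (negbTE eps0) /= => /eqP; lra.
(* The slope has moved by one towards 0, so the sign of [k i] decides which of [k i] and [k j] is
   the larger. *)
move: kj; rewrite /sg; case: sgrP => [/eqP|kp|kn].
- by rewrite intr_eq0 => /eqP.
- rewrite !mulr1 => E; exists i, j; apply/eqP; rewrite -(eqr_int R) intrD.
  by apply/eqP; lra.
- rewrite !mulrN1 => E; exists j, i; apply/eqP; rewrite -(eqr_int R) intrD.
  by apply/eqP; lra.
Qed.

End UnitGap.

(** * The topology of tropical projective space *)

Section MaxContinuity.
Variable R : realType.

Lemma ereal_dense (x y : \bar R) : (x < y)%E -> exists r : R, (x < r%:E < y)%E.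
Proof.
case: x y => [x| |] [y| |] //.
- rewrite lte_fin => h; exists ((x + y) / 2); rewrite !lte_fin.
  by apply/andP; split; lra.
- by move=> _; exists (x + 1); rewrite ltry lte_fin ltrDl ltr01.
- by move=> _; exists (y - 1); rewrite ltNyr lte_fin gtrDl oppr_lt0 ltr01.
- by move=> _; exists 0; rewrite ltNyr ltry.
Qed.

Lemma cvg_maxe (T : Type) (F : set_system T) {FF : Filter F} (g h : T -> \bar R) a b :
  g @ F --> a -> h @ F --> b -> (fun x => maxe (g x) (h x)) @ F --> maxe a b.
Proof.
wlog ab : g h a b / (a <= b)%E.
  move=> W ga hb; have [ab|/ltW ba] := leP a b.
    by have := W g h a b ab ga hb; rewrite max_r.
  rewrite (_ : (fun x => _) = fun x => maxe (h x) (g x)).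
    by have := W h g b a ba hb ga; rewrite max_r.
  by apply/funext => x; rewrite maxC.
move=> ga hb; rewrite max_r// => U Ub.
have [E|ne] := eqVneq a b.
  subst b; have gU : \forall x \near F, U (g x) by exact: ga Ub.
  have hU : \forall x \near F, U (h x) by exact: hb Ub.
  apply: filterS2 gU hU => x /= h1 h2.
  by have [_|_] := leP (g x) (h x).
have /ereal_dense[r /andP[ar rb]] : (a < b)%E by rewrite lt_neqAle ne.
have g_r : \forall x \near F, (g x < r%:E)%E by exact: ga (open_ereal_lt' ar).
have h_r : \forall x \near F, (r%:E < h x)%E by exact: hb (open_ereal_gt' rb).
have hU : \forall x \near F, U (h x) by exact: hb Ub.
apply: filterS3 g_r h_r hU => x /= h1 h2 h3.
by rewrite max_r// ltW// (lt_trans h1).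
Qed.

Lemma mx_coord_continuous (m n : nat) (T : topologicalType) (i : 'I_m) (j : 'I_n) :
  continuous (fun A : 'M[T]_(m, n) => A i j).
Proof.
move=> A U AU; exists (fun i' j' => [set x | i' = i /\ j' = j -> U x]).
  move=> i' j'; have [[-> ->]|ne] := pselect (i' = i /\ j' = j).
    by apply: filterS AU => x Ux _.
  by apply: nearW => x /= /ne.
by move=> B /= hB; apply: hB.
Qed.

Lemma bigmaxe_continuous (n : nat) (r : seq 'I_n) :
  continuous (fun v : 'rV[\bar R]_n => \big[maxe/-oo%E]_(j <- r) v ord0 j).
Proof.
elim: r => [|j r IH] v.
  under eq_fun do rewrite big_nil.
  exact: cst_continuous.
under eq_fun do rewrite big_cons.
have h1 : (fun w : 'rV[\bar R]_n => w ord0 j) @ v --> v ord0 j by exact: mx_coord_continuous.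
exact: cvg_maxe h1 (IH v).
Qed.

End MaxContinuity.

Section ProjectiveSpace.
Variables (R : realType) (n : nat).
Implicit Types (p q : TP R n) (v w : 'rV[\bar R]_n).

Definition vmax v : \bar R := \big[maxe/-oo%E]_j v ord0 j.

Lemma vmax_fin v : trop_nonzero v -> vmax v \is a fin_num.
Proof.
move=> [h1 [i hi]]; rewrite fin_numE; apply/andP; split.
  have := le_bigmax (-oo%E) (fun j => v ord0 j) i; rewrite -/(vmax v) => h.
  by apply/negP => /eqP E; move: h; rewrite E leeNy_eq => /eqP /hi.
have -> : vmax v = v ord0 [arg max_(j > i) v ord0 j]%O.
  by apply: bigmax_eq_arg => // j _; rewrite leNye.
exact/eqP.
Qed.

(* Normalizing the largest coordinate to be zero embeds [TP] in a product of
   extended real lines. *)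
Definition vnorm v (i : 'I_n) : \bar R := (v ord0 i - vmax v)%E.

Lemma vmax_shift v w (c : R) : (forall i, v ord0 i = w ord0 i + c%:E)%E ->
  trop_nonzero w -> vmax v = (vmax w + c%:E)%E.
Proof.
move=> h [_ [i _]]; apply/eqP; rewrite eq_le; apply/andP; split.
  apply/bigmax_leP; split=> [|j _]; first exact: leNye.
  by rewrite h leeD2r//; exact: (le_bigmax (-oo%E) (fun j => w ord0 j)).
rewrite -leeBrDr//; apply/bigmax_leP; split=> [|j _]; first exact: leNye.
by rewrite leeBrDr// -h; exact: (le_bigmax (-oo%E) (fun j => v ord0 j)).
Qed.

Lemma vnorm_shift v w (c : R) : (forall i, v ord0 i = w ord0 i + c%:E)%E ->
  trop_nonzero w -> vnorm v =1 vnorm w.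
Proof.
move=> h w0 i; rewrite /vnorm (vmax_shift h w0) h.
have := vmax_fin w0; case: (vmax w) => // m _.
case: (w ord0 i) => //= x; congr (_%:E); ring.
Qed.

Definition TPnorm (i : 'I_n) p : \bar R := vnorm (val (generic_quotient.repr p)) i.

Lemma hom_coords_norm p v : hom_coords p v -> forall i, TPnorm i p = vnorm v i.
Proof.
move=> [u <- ->] i; rewrite /TPnorm.
set q := (\pi_({eq_quot tp_equiv R n}) u)%qT.
have : (generic_quotient.repr q = u %[mod {eq_quot tp_equiv R n}])%qT.
  exact: generic_quotient.reprK.
move=> /eqmodP.
move=> /asboolP[c hc]; apply: (vnorm_shift hc).
exact: set_mem (valP u).
Qed.

Lemma TPnorm_inj p q : (forall i, TPnorm i p = TPnorm i q) -> p = q.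
Proof.
move=> h; rewrite -[p]generic_quotient.reprK -[q]generic_quotient.reprK; apply/eqmodP/asboolP.
set u := generic_quotient.repr p in h *; set v := generic_quotient.repr q in h *.
have fu := vmax_fin (set_mem (valP u)); have fv := vmax_fin (set_mem (valP v)).
exists (fine (vmax (val u)) - fine (vmax (val v))) => i.
have := h i; rewrite /TPnorm /vnorm -/u -/v => hi.
rewrite EFinB !fineK//; rewrite addeA addeAC -hi subeK//.
Qed.

(** The chosen representative need not vary continuously, but [vnorm] does not depend on it and
    therefore descends to the quotient topology. *)
Lemma TPnorm_continuous i : continuous (TPnorm i).
Proof.
pose g (u : @trop_nonzero R n) := vnorm (val u) i.
apply: (@repr_comp_continuous _ _ _ g) => [u|u v /eqP /eqmodP /asboolP[c hc]]; last first.
  by apply/eqP; exact: (vnorm_shift hc (set_mem (valP v)) i).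
have cval : val @ u --> val u by exact: initial_continuous.
apply: cvgeB.
- exact: (nbhs_filter u).
- by apply: fin_num_adde_defl; rewrite fin_numN; exact: vmax_fin (set_mem (valP u)).
- exact: cvg_comp cval (@mx_coord_continuous 1 n _ ord0 i (val u)).
- exact: cvg_comp cval (@bigmaxe_continuous R n _ (val u)).
Qed.

Lemma TP_hausdorff : hausdorff_space (TP R n).
Proof.
move=> p q pq; apply: TPnorm_inj => i; apply: ereal_hausdorff => A B hA hB.
have [z [zA zB]] := pq _ _ (TPnorm_continuous hA) (TPnorm_continuous hB).
by exists (TPnorm i z).
Qed.

Lemma hom_coords_uniq p q v : hom_coords p v -> hom_coords q v -> p = q.
Proof. by move=> hp hq; apply: TPnorm_inj => i; rewrite !(hom_coords_norm (v := v)). Qed.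

Lemma real_coords_fin p u i : real_coords p u -> TPnorm i p \is a fin_num.
Proof.
move=> /[dup] [[w wE _]] /hom_coords_norm ->; rewrite /vnorm fin_numB mxE /=.
by apply: vmax_fin; rewrite -wE; exact: set_mem (valP w).
Qed.

Lemma real_coords_diff p (u v : 'rV[R]_n) : real_coords p u -> real_coords p v ->
  forall i j, u ord0 i - u ord0 j = v ord0 i - v ord0 j.
Proof.
move=> hu hv i j.
have fin (w : 'rV[R]_n) : real_coords p w -> vmax (map_mx EFin w) \is a fin_num.
  by move=> [z zE _]; apply: vmax_fin; rewrite -zE; exact: set_mem (valP z).
have E k : vnorm (map_mx EFin u) k = vnorm (map_mx EFin v) k.
  by rewrite -(hom_coords_norm hu) -(hom_coords_norm hv).
move: (E i) (E j) (fin u hu) (fin v hv); rewrite /vnorm !mxE.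
case: (vmax _) => [U| |] //; case: (vmax _) => [V| |] //.
by rewrite -!EFinB => -[Ei] [Ej] _ _; lra.
Qed.

End ProjectiveSpace.

(** * The topology of a metric graph *)

Section EdgeTopology.
Variables (R : realType) (X : topologicalType) (d : X -> X -> \bar R).
Variable M : model d.

Lemma near_edge (e : edge M) t0 (U : set X) : open U -> edge_dom e t0 ->
  U (emap M e t0) -> \forall t \near t0, edge_dom e t -> U (emap M e t).
Proof.
move=> /(model_open M) /(_ e)[W [oW hW]] ht Ut; have Wt := (hW _ ht).1 Ut.
have : nbhs t0 W by exact: open_nbhs_nbhs.
by apply: filterS => t Wt' /hW ->.
Qed.

Lemma near_interval (e : edge M) t0 (P : set (\bar R)) : edge_dom e t0 ->
  (\forall t \near t0, P t) -> exists s1 s2, [/\ (0 <= s1)%E, (s1 < s2)%E,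
    (s2 <= len e)%E & forall t, (s1 < t < s2)%E -> P t].
Proof.
move=> /andP[t0_ge0 t0_le]; case: t0 t0_ge0 t0_le => [t0| |] // t0_ge0 t0_le; last first.
  move=> [N [_ hN]]; exists (maxe 0%E N%:E), +oo%E; split=> //.
  - by rewrite le_max lexx.
  - by rewrite gt_max lt0y ltry.
  - by move=> t /andP[h _]; apply: hN; apply: le_lt_trans h; rewrite le_max lexx orbT.
move=> /nbhs_EFin /nbhs_ballP[eps /= eps_gt0 heps].
have [t0_lt|t0_eq] := ltP t0%:E (len e).
  exists t0%:E, (mine (t0 + eps)%:E (len e)); split=> //.
  - by rewrite lt_min t0_lt lte_fin ltrDl eps_gt0.
  - by rewrite ge_min lexx orbT.
  - move=> t /andP[h1]; rewrite lt_min => /andP[h2 _].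
    case: t h1 h2 => [t| |] //; rewrite !lte_fin => h1 h2; apply: heps.
    by rewrite /ball /= ltr0_norm; lra.
have t0_gt0 : 0 < t0 by rewrite -lte_fin; apply: lt_le_trans t0_eq; exact: len_gt0.
exists (maxe 0%E (t0 - eps)%:E), t0%:E; split=> //.
- by rewrite le_max lexx.
- by rewrite gt_max !lte_fin t0_gt0 gtrDl oppr_lt0.
- move=> t /andP[]; rewrite gt_max => /andP[_ h1].
  case: t h1 => [t| |] //; rewrite !lte_fin => h1 h2; apply: heps.
  by rewrite /ball /= gtr0_norm; lra.
Qed.

Lemma near_interior (e : edge M) t0 (P : set (\bar R)) : edge_dom e t0 ->
  (\forall t \near t0, P t) -> exists t : R, (0 < t%:E < len e)%E /\ P t%:E.
Proof.
move=> h /(near_interval h)[s1 [s2 [s10 /ereal_dense[t /andP[t1 t2]] s2l hP]]].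
exists t; split; last by apply: hP; rewrite t1.
by rewrite (le_lt_trans s10 t1) (lt_le_trans t2 s2l).
Qed.

Lemma edge_interior_open (e : edge M) : open (edge_interior e).
Proof.
apply/(model_open M) => e'; have [E|ne] := eqVneq e' e.
  exists [set t | 0 < t < len e]%E; split.
    rewrite (_ : [set _ | _] = [set t | 0 < t]%E `&` [set t | t < len e]%E).
      by apply: openI; [exact: open_ereal_gt_ereal|exact: open_ereal_lt_ereal].
    by apply/seteqP; split=> t /= => [/andP[]//|[-> ->]].
  subst e' => t ht /=; split=> [[s hs E]|h]; last by exists t.
  by have [_ <-] := emap_int_inj hs ht E.
exists set0; split=> [|t ht]; first exact: open0.
split=> // -[s hs E]; have [ee _] := emap_int_inj hs ht E.
by rewrite ee eqxx in ne.
Qed.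

(** On any other edge only the two ends can belong to [e], and a finite set of parameters is
    closed. *)
Lemma edge_set_closed (e : edge M) : closed (edge_set e).
Proof.
rewrite -[edge_set e]setCK; apply: open_closedC; apply/(model_open M) => e'.
have [E|ne] := eqVneq e' e.
  exists set0; split=> [|t ht]; first exact: open0.
  by split=> // h; apply: h; exists t => //; rewrite -E.
exists (~` [set t | (t = 0%E \/ t = len e') /\ edge_set e (emap M e' t)]); split.
  apply: closed_openC.
  have acc := hausdorff_accessible (@ereal_hausdorff R).
  have [fin_closed _] := @accessible_finite_set_closed (\bar R).
  apply: (fin_closed acc); apply: (@sub_finite_set _ _ [set 0%E; len e']); first by move=> t [].
  exact: finite_set2.
move=> t ht; split=> [h [_ /h]//|h [s hs E]]; apply: h; split; last by exists s.
have [->|->|int] := edge_domP ht; [by left|by right|].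
by have [ee _] := emap_int_inj int hs (esym E); rewrite ee eqxx in ne.
Qed.

(** By connectedness a vertex without edges is the whole space. The second case isolates the
    singleton graph. *)
Lemma point_on_edge x : (exists e t, edge_dom e t /\ x = emap M e t) \/
  (forall y, y = x) /\ (edge M -> False).
Proof.
case: (model_cover M x) => [[v xv]|[e [t [h ->]]]]; last first.
  by left; exists e, t; split=> //; exact: edge_dom_int.
have [[e [ve|ve]]|none] := pselect (exists e : edge M, src e = v \/ tgt e = v).
- by left; exists e, 0%E; rewrite emap_src ve; split=> //; exact: edge_dom0.
- by left; exists e, (len e); rewrite emap_tgt ve; split=> //; exact: edge_dom_len.
have vE u : u = v.
  have /connectP[[|w p] /=] := connected_graph (w := M) v u; first by [].
  case/andP => /existsP[e /orP[]/andP[/eqP h1 /eqP h2]] _ _; case: none; exists e.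
    by left.
  by right.
have noedge (e : edge M) : False by apply: none; exists e; left; exact: vE.
right; split=> // y; rewrite xv.
by case: (model_cover M y) => [[u ->]|[e]]; [rewrite (vE u)|case: (noedge e)].
Qed.

Lemma infinite_end (e e1 : edge M) t : len e1 = +oo%E -> edge_dom e t ->
  emap M e t = emap M e1 +oo%E -> e = e1 /\ t = +oo%E.
Proof.
move=> l1 ht; have /valence1P[hs hl] := infinite_leaf l1.
rewrite (_ : emap M e1 +oo%E = vmap M (tgt e1)); last by rewrite -emap_tgt l1.
case: (edge_domP ht) => [->|->|int].
- by rewrite emap_src => /vmap_inj /hs.
- by rewrite emap_tgt => /vmap_inj /hl ->.
- by move=> /emap_vmap -/(_ int).
Qed.

End EdgeTopology.

(** * Compactness, including the points at infinity *)

Section Compactness.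
Variable R : realType.

(** For [l = +oo], a filter that does not cluster at [+oo] contains some bounded interval, which
    reduces to the real case. *)
Lemma compact_ereal_seg (l : \bar R) : compact [set t | 0 <= t <= l]%E.
Proof.
have fin (r : R) : compact [set t | 0 <= t <= r%:E]%E.
  rewrite (_ : [set _ | _]%E = EFin @` `[0, r]).
    apply: continuous_compact; last exact: segment_compact.
    by apply: continuous_subspaceT => x U /nbhs_EFin.
  apply/seteqP; split=> [t /andP[t0 tr]|_ [t ht <-]].
    case: t t0 tr => [t| |] // t0 tr; exists t => //=.
    by rewrite in_itv /= -!lee_fin t0.
  by move: ht; rewrite /= in_itv /= !lee_fin.
case: l => [r| |]; [exact: fin| |]; last first.
  rewrite (_ : [set _ | _] = set0); first exact: compact0.
  by apply/seteqP; split=> // -[t| |] //= /andP[].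
move=> F FF F0; have [inf|] := pselect (cluster F +oo%E).
  by exists +oo%E; split=> //=; rewrite leey lexx.
move=> /existsNP[A] /existsNP[B] /not_implyP[FA] /not_implyP[[N [_ hN]] AB].
have FN : F [set t | 0 <= t <= N%:E]%E.
  apply: filterS (filterI F0 FA) => t [/= /andP[-> _] At] /=; rewrite leNgt.
  by apply/negP => Nt; apply: AB; exists t; split=> //; exact: hN.
have [t [ht ct]] := fin N F FF FN; exists t; split=> //=.
by case/andP: ht => ->; rewrite leey.
Qed.

Lemma interval_connected_ereal (l : \bar R) :
  connected [set t : R | (0 < t%:E < l)%E].
Proof.
apply/connected_intervalP => x y /= /andP[x0 xl] /andP[y0 yl] z /andP[xz zy].
apply/andP; split; first by apply: lt_le_trans x0 _; rewrite lee_fin.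
by apply: le_lt_trans yl; rewrite lee_fin.
Qed.

End Compactness.

Section ModelCompact.
Variables (R : realType) (X : topologicalType) (d : X -> X -> \bar R).
Variable M : model d.

Lemma edge_set_compact (e : edge M) : compact (edge_set e).
Proof.
apply: continuous_compact; last exact: compact_ereal_seg.
apply/subspace_continuousP => t ht U.
rewrite nbhsE => -[V [oV Vt] VU]; have := near_edge oV ht Vt.
by apply: filterS => s h hs; apply: VU; exact: h.
Qed.

Lemma model_compact : compact [set: X].
Proof.
have -> : [set: X] = range (vmap M) `|` \big[setU/set0]_(e : edge M) edge_set e.
  apply/seteqP; split=> // x _; have [[v ->]|[e [t [h ->]]]] := model_cover M x.
    by left; exists v.
  right; rewrite (bigD1 e) //=; left; exists t => //; exact: edge_dom_int.
apply: compactU; first exact/finite_compact/finite_image/finite_finset.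
by apply: bigsetU_compact => e _; exact: edge_set_compact.
Qed.
End ModelCompact.

(** * The generators and the map they define *)

Section InvariantMap.
Variables (R : realType) (Gamma : metricGraph R).
Let M0 := refmodel Gamma.
Variables (K : finGroupType) (to : {action K &-> Gamma}) (D : divisor Gamma).
Variables (n : nat) (f : 'I_n -> Gamma -> \bar R) (phi : Gamma -> TP R n).
Hypothesis iso : acts_isometrically to.
Hypothesis D_ge0 : effective D.
Hypothesis f_gen : min_generating f (RDK to D).
Hypothesis phi_ind : induced_map f phi.
Hypothesis sep : forall x y : Gamma, ~ (exists a : K, to x a = y) -> phi x <> phi y.

Lemma same_orbit x y : phi x = phi y -> exists a, to x a = y.
Proof. by move=> h; apply: contrapT => /sep. Qed.

(** The constant [-oo] contributes nothing to a maximum, so a minimal generating family cannot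
    contain it. *)
Lemma generator_neq (i : 'I_n) : f i <> fun=> -oo%E.
Proof.
move=> fi; have [_ gen min] := f_gen.
have : (i \in ~: [set i])%SET; last by rewrite !inE eqxx.
rewrite (min (~: [set i])%SET) ?inE// => g /gen[a [a_oo gE]].
exists a; split=> // x; rewrite gE (bigD1 i) ?inE//= fi.
rewrite (_ : (a i + -oo = -oo)%E); last by case: (a i) (a_oo i).
rewrite maxNye; apply: eq_bigl => j; by rewrite !inE.
Qed.

Lemma generator_pl i : piecewise_linear (f i).
Proof.
have [f_RDK _ _] := f_gen; have [[fi|[]//] _] := f_RDK i.
by case: (generator_neq fi).
Qed.

Lemma generator_fin i x : ~ at_infinity x -> f i x \is a fin_num.
Proof. by have [h _] := generator_pl i; exact: h. Qed.

Lemma generator_inv i (a : K) x : f i (to x a) = f i x.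
Proof. by have [f_RDK _ _] := f_gen; have [_ ->] := f_RDK i. Qed.

Definition fine_row x : 'rV[R]_n := \row_i fine (f i x).

Lemma phi_real x : ~ at_infinity x -> real_coords (phi x) (fine_row x).
Proof.
move=> hx; have [h _] := phi_ind; rewrite /real_coords.
rewrite (_ : map_mx EFin (fine_row x) = \row_i f i x); first exact: h.
by apply/rowP => i; rewrite !mxE fineK// generator_fin.
Qed.

Lemma orbit_finite x : finite_set [set y | exists a, to x a = y].
Proof.
rewrite (_ : [set _ | _] = [set to x a | a in [set: K]]).
  exact/finite_image/finite_finset.
by apply/seteqP; split=> y [a]; [exists a|move=> _ <-; exists a].
Qed.

(** [unit_gap] needs a nonzero slope. If all slopes vanished, [phi] would be constant inside the
    segment; by separation those infinitely many points would lie in one orbit, which is finite. *)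
Lemma segment_gap (e : edge M0) (s t : \bar R) (A : 'I_n -> R) (k : 'I_n -> int) :
  (0 <= s)%E -> (s < t)%E -> (t <= len e)%E ->
  (forall j u, seg s t u ->
     f j (emap M0 e u) = ((A j)%:E + ((k j)%:~R : R)%:E * u)%E) ->
  exists j1 j2, k j1 = k j2 + 1.
Proof.
move=> s0 st tl hf; have [|none] := pselect (exists i, k i <> 0).
  by case=> i; exact: unit_gap hf.
have k0 i : k i = 0 by apply: contrapT => h; apply: none; exists i.
have [u [/andP[su ut] _]] := generic_param (F := set0) (finite_set0 _) s0 st tl.
have [v [/andP[sv vt]]] := generic_param (orbit_finite (emap M0 e u%:E)) s0 st tl.
case; apply: same_orbit.
have coords w : (s < w%:E)%E -> (w%:E < t)%E ->
    hom_coords (phi (emap M0 e w%:E)) (map_mx EFin (\row_i A i)).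
  move=> sw wt; have [h _] := phi_ind.
  have := h (emap M0 e w%:E) (int_not_at_infinity _).
  rewrite (_ : \row_i f i _ = map_mx EFin (\row_i A i)).
    by apply; rewrite (le_lt_trans s0 sw) (lt_le_trans wt tl).
  apply/rowP => i; rewrite !mxE hf; first by rewrite k0 mul0e adde0.
  by rewrite /seg /= !ltW.
exact: hom_coords_uniq (coords u su ut) (coords v sv vt).
Qed.

End InvariantMap.

(** * The model adapted to the linear system *)

Section AdaptedModel.
Variables (R : realType) (Gamma : metricGraph R).
Let M0 := refmodel Gamma.
Variables (K : finGroupType) (to : {action K &-> Gamma}) (D : divisor Gamma).
Variables (n : nat) (f : 'I_n -> Gamma -> \bar R) (phi : Gamma -> TP R n).
Hypothesis iso : acts_isometrically to.
Hypothesis D_ge0 : effective D.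
Hypothesis f_gen : min_generating f (RDK to D).
Hypothesis phi_ind : induced_map f phi.
Hypothesis sep : forall x y : Gamma, ~ (exists a : K, to x a = y) -> phi x <> phi y.

Definition adapted (M : model (@dist R Gamma)) : Prop :=
  [/\ refines M0 M,
      forall v (a : K), exists v', to (vmap M v) a = vmap M v'
    & forall e : edge M, exists (A : 'I_n -> R) (k : 'I_n -> int),
        (forall j t, edge_dom e t ->
           f j (emap M e t) = ((A j)%:E + ((k j)%:~R : R)%:E * t)%E) /\
        exists j1 j2, k j1 = k j2 + 1].

Lemma adapted_exists : exists M, adapted M.
Proof.
have [P hP] := choice (fun p : 'I_n * edge M0 =>
  piecewise_linear_pl (generator_pl f_gen p.1) p.2).
pose Bad : set Gamma := range (vmap M0) `|`
  \bigcup_(p in [set: 'I_n * edge M0]) emap M0 p.2 @` [set` P p].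
have finBad : finite_set Bad.
  rewrite finite_setU; split; first exact/finite_image/finite_finset.
  apply: bigcup_finite; first exact: finite_finset.
  by move=> p _; exact/finite_image/finite_seq.
pose F : set Gamma := \bigcup_(a in [set: K]) (fun x => to x a) @^-1` Bad.
have finF : finite_set F.
  apply: bigcup_finite; first exact: finite_finset.
  by move=> a _; apply: finite_preimage => // x y _ _; exact: tact_inj.
have BadF x : Bad x -> F x by move=> hx; exists 1%g; rewrite //= tact1.
have [r rE] := (finite_seqP F).1 finF.
have [M [ref verts]] := refine_at M0 r.
have vertE x : (exists v, x = vmap M v) <-> F x.
  rewrite verts rE /=; split=> [[[v ->]|//]|]; last by right.
  by have : F (vmap M0 v) by [apply: BadF; left; exists v]; rewrite rE.
exists M; split=> //.
  move=> v a; have /vertE[b _ hb] : exists v', vmap M v = vmap M v' by exists v.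
  suff /vertE[v' ->] : F (to (vmap M v) a) by exists v'.
  by exists (a^-1 * b)%g => //=; rewrite -tactM mulgA mulgV mul1g.
move=> e; have [_ /(_ e)[e0 [a [a_ge0 ale emE]]] _ _] := ref.
have lt_a : (a%:E < a%:E + len e)%E.
  by rewrite -{1}[a%:E]adde0 lteD2lE// len_gt0.
have lin j : exists ck : R * int, forall t, edge_dom e t ->
    f j (emap M e t) = (ck.1%:E + (ck.2%:~R : R)%:E * t)%E.
  have [||p pP|c [k h]] := hP (j, e0) a%:E (a%:E + len e)%E _ _ ale.
  - by rewrite lee_fin.
  - exact: ltW.
  - apply/negP => /andP[ap pl].
    have int : (0 < p - a%:E < len e)%E.
      by rewrite sube_gt0 ap andTb lteBlDr// addeC.
    have : F (emap M0 e0 p) by apply: BadF; right; exists (j, e0) => //; exists p.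
    move/vertE => [v E]; apply: (@emap_vmap _ _ _ M e _ v int).
    by rewrite emE; [rewrite addeBK|exact: edge_dom_int].
  (* The edge [e] is a part of [e0] with parameter shifted by [a]: the slope is kept and the
     constant absorbs [k * a]. The remaining case split is for the infinite parameter. *)
  exists (c + k%:~R * a, k) => t /[dup] ht /andP[t0 tl]; rewrite emE// h; last first.
    by apply/andP; split; [rewrite leeDl|rewrite leeD2l].
  rewrite /= EFinD EFinM -addeA; congr (_ + _)%E.
  case: t {ht tl} t0 => [t| |] // _; first by rewrite -!EFinM -!EFinD; congr (_%:E); ring.
  have [kn|kp|k0] := ltgtP (k%:~R : R) 0.
  - by rewrite lt0_muley ?lte_fin.
  - by rewrite gt0_muley ?lte_fin.
  - by rewrite k0 !mul0e adde0.
have {lin} [ck hck] := choice lin.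
exists (fun j => (ck j).1), (fun j => (ck j).2); split; first by move=> j t; exact: hck.
apply: (segment_gap iso D_ge0 f_gen phi_ind sep (e := e0) (s := a%:E)
  (t := (a%:E + len e)%E) (A := fun j => (ck j).1 - (ck j).2%:~R * a)) => //.
move=> j u /andP[au ul].
have u_dom : edge_dom e (u - a%:E)%E.
  by apply/andP; split; [rewrite sube_ge0|rewrite leeBlDr// addeC].
have -> : emap M0 e0 u = emap M e (u - a%:E)%E by rewrite emE// addeBK.
rewrite hck//; case: u au ul {u_dom} => [u| |] // _ _.
  by rewrite -EFinB -!EFinM -!EFinD; congr (_%:E); ring.
have [kn|kp|k0] := ltgtP ((ck j).2%:~R : R) 0.
- by rewrite !lt0_muley ?lte_fin.
- by rewrite !gt0_muley ?lte_fin.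
- by rewrite k0 !mul0e !mul0r subr0.
Qed.

End AdaptedModel.

(** * Injectivity on edges and invariance of the map *)

Section AdaptedFacts.
Variables (R : realType) (Gamma : metricGraph R).
Let M0 := refmodel Gamma.
Variables (K : finGroupType) (to : {action K &-> Gamma}) (D : divisor Gamma).
Variables (n : nat) (f : 'I_n -> Gamma -> \bar R) (phi : Gamma -> TP R n).
Hypothesis iso : acts_isometrically to.
Hypothesis f_gen : min_generating f (RDK to D).
Hypothesis phi_ind : induced_map f phi.
Hypothesis sep : forall x y : Gamma, ~ (exists a : K, to x a = y) -> phi x <> phi y.
Variable M : model (@dist R Gamma).
Hypothesis ref : refines M0 M.
Variables (A : edge M -> 'I_n -> R) (k : edge M -> 'I_n -> int).
Hypothesis lin : forall e j t, edge_dom e t ->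
  f j (emap M e t) = ((A e j)%:E + ((k e j)%:~R : R)%:E * t)%E.
Hypothesis gap : forall e, exists j1 j2, k e j1 = k e j2 + 1.

Lemma at_infinityP x : at_infinity x <->
  exists2 e : edge M, len e = +oo%E & emap M e +oo%E = x.
Proof.
split=> [[e [le <-]]|[e le <-]].
  by have [_ _ _ /(_ e le)] := ref.
have [_ /(_ e)[e0 [a [a0 ale emE]]] _ _] := ref.
rewrite le addey// in ale.
exists e0; split; first by apply/eqP; rewrite eq_le leey.
by rewrite emE ?addey// -le; exact: edge_dom_len.
Qed.

Lemma real_not_infinity (e : edge M) (t : R) : edge_dom e t%:E ->
  ~ at_infinity (emap M e t%:E).
Proof. by move=> ht /at_infinityP[e1 le E]; have [] := infinite_end le ht (esym E). Qed.

Lemma phi_real_edge (e : edge M) (t : R) : edge_dom e t%:E ->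
  real_coords (phi (emap M e t%:E)) (\row_j (A e j + (k e j)%:~R * t)).
Proof.
move=> ht; rewrite (_ : \row_j _ = fine_row f (emap M e t%:E)).
  exact: (phi_real f_gen) (real_not_infinity ht).
by apply/rowP => j; rewrite !mxE lin.
Qed.

Lemma phi_coord_diff (e e' : edge M) (s t : R) :
  edge_dom e s%:E -> edge_dom e' t%:E ->
  phi (emap M e s%:E) = phi (emap M e' t%:E) -> forall i j,
  (A e i + (k e i)%:~R * s) - (A e j + (k e j)%:~R * s) =
  (A e' i + (k e' i)%:~R * t) - (A e' j + (k e' j)%:~R * t).
Proof.
move=> hs ht E i j.
have := phi_real_edge ht; rewrite -E => h.
by have := real_coords_diff (phi_real_edge hs) h i j; rewrite !mxE.
Qed.

Lemma TPnorm_real_le (x : Gamma) i j : ~ at_infinity x ->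
  (TPnorm i (phi x) <= f i x - f j x)%E.
Proof.
move=> hx; rewrite (hom_coords_norm (phi_real f_gen phi_ind hx)) /vnorm.
have fE l : f l x = (fine_row f x ord0 l)%:E.
  by rewrite !mxE fineK// (generator_fin f_gen).
rewrite mxE -fE; apply: leeB => //; rewrite fE.
by have := le_bigmax (-oo%E) (fun l => map_mx EFin (fine_row f x) ord0 l) j; rewrite mxE.
Qed.

(* Near a point at infinity two coordinates drift apart, so the limit has a
   coordinate equal to -oo. *)
Lemma phi_infinite x : at_infinity x -> ~ exists u, real_coords (phi x) u.
Proof.
move=> /at_infinityP[e le <-] [u hu]; have [j1 [j2 kE]] := gap e.
have := real_coords_fin j2 hu.
case E : (TPnorm j2 _) => [r| |] // _.
have cont : continuous (fun y => TPnorm j2 (phi y)).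
  move=> y; apply: continuous_comp; first by have [_] := phi_ind; apply.
  exact: TPnorm_continuous.
have oU := open_preimage cont (@open_ereal_gt_ereal _ (r - 1)%:E).
have oo_dom : edge_dom e +oo%E by rewrite -le; exact: edge_dom_len.
have [|T [_ hT]] := near_edge oU oo_dom _.
  by rewrite /= E lte_fin gtrDl oppr_lt0.
(* Beyond [T] continuity keeps the normalized coordinate [j2] above [r - 1]. The last bound makes
   [f j2 - f j1], which has slope -1 and dominates that coordinate, at most [r - 1]. *)
pose t := Num.max 0 (Num.max (T + 1) (A e j2 - A e j1 - r + 1)).
have t0 : 0 <= t by rewrite le_max lexx.
have tT : T + 1 <= t by rewrite !le_max lexx orbT.
have tA : A e j2 - A e j1 - r + 1 <= t by rewrite !le_max lexx !orbT.
have t_dom : edge_dom e t%:E by apply/andP; rewrite le leey lee_fin.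
have Tt : (T%:E < t%:E)%E by rewrite lte_fin; lra.
have := hT _ Tt t_dom => /= h1.
have := lt_le_trans h1 (TPnorm_real_le j2 j1 (real_not_infinity t_dom)).
rewrite !lin// => h2.
have {}h2 : r - 1 < A e j2 + (k e j2)%:~R * t - (A e j1 + (k e j1)%:~R * t) by exact: h2.
by move: h2; rewrite kE intrD; lra.
Qed.

(** Real parameters are recovered from a coordinate difference of slope 1, and an infinite end is
    separated from them by [phi_infinite]. *)
Lemma phi_inj_edge (e : edge M) s t : edge_dom e s -> edge_dom e t ->
  phi (emap M e s) = phi (emap M e t) -> s = t.
Proof.
have dom_real s' : edge_dom e s' -> (exists r : R, s' = r%:E) \/
    (s' = +oo%E /\ at_infinity (emap M e s')).
  case: s' => [r| |] hs; [by left; exists r| |by case/andP: hs].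
  right; split=> //; apply/at_infinityP; exists e => //.
  by apply/eqP; rewrite eq_le leey; case/andP: hs.
move=> hs ht E; case: (dom_real _ hs) (dom_real _ ht) => [[r rE]|[sE s_inf]].
  subst s; case=> [[r' rE]|[tE t_inf]].
    subst t; have [j1 [j2 kE]] := gap e.
    have := phi_coord_diff hs ht E j1 j2; rewrite kE intrD => H.
    congr (_%:E); lra.
  by case: (phi_infinite t_inf); rewrite -E; eexists; exact: phi_real_edge.
case=> [[r rE]|[-> _]//]; subst t.
by case: (phi_infinite s_inf); rewrite E; eexists; exact: phi_real_edge.
Qed.

Lemma infinity_finite : finite_set [set x : Gamma | at_infinity x].
Proof.
apply: (@sub_finite_set _ _ (range (fun e : edge M => emap M e +oo%E))).
  by move=> x /at_infinityP[e _ <-]; exists e.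
exact/finite_image/finite_finset.
Qed.

Lemma phi_inv x (a : K) : phi (to x a) = phi x.
Proof.
have phiC := proj2 phi_ind; have [toC _] := iso a.
have [[e [t [ht xE]]]|[single _]] := point_on_edge M0 x; last by rewrite (single (to x a)).
apply: TP_hausdorff => U V hU hV.
have hU' : \forall z \near x, U (phi (to z a)).
  by have := cvg_comp _ _ (toC x) (phiC (to x a)); apply.
have hV' : \forall z \near x, V (phi z) by have := phiC x; apply.
have [W [oW Wx] sW] : exists2 W, open_nbhs x W &
    W `<=` [set z | U (phi (to z a)) /\ V (phi z)].
  have : nbhs x [set z | U (phi (to z a)) /\ V (phi z)] by exact: filterI.
  by rewrite nbhsE => -[W h1 h2]; exists W.
rewrite xE in Wx; have := near_edge oW ht Wx => /(near_interval ht).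
move=> [s1 [s2 [s1_ge0 s12 s2l hW]]].
pose F := [set z : Gamma | at_infinity z] `|` (fun z => to z a) @^-1` [set z | at_infinity z].
have finF : finite_set F.
  rewrite finite_setU; split; first exact: infinity_finite.
  by apply: finite_preimage infinity_finite => z z' _ _; exact: tact_inj.
have [u [u_in uF]] := generic_param finF s1_ge0 s12 s2l.
have u_dom : edge_dom e u%:E.
  case/andP: u_in => h1 h2; apply/andP; split.
    by apply: le_trans s1_ge0 _; exact: ltW.
  by apply: le_trans s2l; exact: ltW.
have [h1 h2] := sW _ (hW _ u_in u_dom).
set z := emap M0 e u%:E in uF h1 h2.
have nz : ~ at_infinity z by move=> h; apply: uF; left.
have nza : ~ at_infinity (to z a) by move=> h; apply: uF; right.
exists (phi z); split=> //.
rewrite (_ : phi z = phi (to z a))//.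
have := phi_real f_gen phi_ind nza; rewrite (_ : fine_row f (to z a) = fine_row f z).
  exact: hom_coords_uniq (phi_real f_gen phi_ind nz).
by apply/rowP => i; rewrite !mxE (generator_inv f_gen).
Qed.

Lemma phi_orbitP x y : phi x = phi y <-> exists a, to x a = y.
Proof.
split; first exact: same_orbit.
by case=> a <-; rewrite phi_inv.
Qed.

End AdaptedFacts.

(** * How the group acts on edges *)

Section AffineIntervals.
Variable R : realType.
Implicit Types l : \bar R.

Lemma le_interior l l1 : (0 < l)%E -> (0 < l1)%E ->
  (forall u : R, (0 < u%:E < l)%E -> (u%:E <= l1)%E) -> (l <= l1)%E.
Proof.
move=> l0 l1_0 h; rewrite leNgt; apply/negP => /ereal_dense[r /andP[r1 r2]].
have r0 : (0 < r%:E)%E by exact: lt_trans l1_0 r1.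
by have := h r; rewrite r0 r2 => /(_ isT); rewrite leNgt r1.
Qed.

Lemma small_interior l (r : R) : (0 < l)%E -> 0 < r ->
  exists u : R, (0 < u%:E < l)%E /\ u < r.
Proof.
move=> l0 r0; have : (0%E < mine l r%:E)%E by rewrite lt_min l0 lte_fin.
move=> /ereal_dense[u /andP[u0]]; rewrite lt_min lte_fin => /andP[ul ur].
by exists u; rewrite u0 ul.
Qed.

(** For slope 1, a nonzero [c] would either leave the target or miss values near 0. For slope -1,
    both intervals are bounded by [c] and fill it; in particular an infinite edge cannot be
    reversed. *)
Lemma affine_interval l l1 (c N : R) : N = 1 \/ N = -1 -> (0 < l)%E -> (0 < l1)%E ->
  (forall u : R, (0 < u%:E < l)%E -> (0 < (c + N * u)%:E < l1)%E) ->
  (forall v : R, (0 < v%:E < l1)%E -> exists2 u : R, (0 < u%:E < l)%E & v = c + N * u) ->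
  l1 = l /\ (N = 1 /\ c = 0 \/ N = -1 /\ l = c%:E).
Proof.
move=> N1 l0 l10 into onto; case: N1 => NE; subst N.
- have c0 : c = 0.
    apply/eqP; rewrite eq_le; apply/andP; split; rewrite leNgt; apply/negP => hc.
      have [v [v_int vc]] := small_interior l10 hc.
      have [u /andP[u0 _] vE] := onto v v_int.
      by move: u0; rewrite lte_fin; lra.
    have hc' : 0 < - c by lra.
    have [u [u_int uc]] := small_interior l0 hc'.
    by have /andP[h _] := into u u_int; move: h; rewrite lte_fin; lra.
  subst c; split; last by left.
  apply/eqP; rewrite eq_le; apply/andP; split; apply: le_interior => // u hu.
    by have [w /andP[_ /ltW wl] ->] := onto u hu; rewrite add0r mul1r.
  by have /andP[_ /ltW] := into u hu; rewrite add0r mul1r.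
- have c_gt0 : 0 < c.
    have [u [/[dup] u_int /andP[u0 _] _]] := small_interior l0 (@ltr01 R).
    have /andP[h _] := into u u_int.
    by move: u0 h; rewrite !lte_fin; lra.
  have lc : (l <= c%:E)%E.
    apply: le_interior => // u hu; have /andP[h _] := into u hu.
    by move: h; rewrite lte_fin lee_fin; lra.
  have l1c : (l1 <= c%:E)%E.
    apply: le_interior => // v /onto[u /andP[u0 _] ->].
    by move: u0; rewrite lte_fin lee_fin; lra.
  have cl1 : (c%:E <= l1)%E.
    apply: le_interior => // v /andP[v0 vc]; rewrite leNgt; apply/negP => l1v.
    have cv : 0 < c - v by move: vc; rewrite lte_fin; lra.
    have [u [u_int uc]] := small_interior l0 cv.
    have /andP[_ h] := into u u_int.
    by have := lt_trans h l1v; rewrite lte_fin; lra.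
  have l1E : l1 = c%:E by apply/eqP; rewrite eq_le l1c cl1.
  have cl : (c%:E <= l)%E.
    apply: le_interior => // r /andP[r0 rc].
    have [|u /andP[_ /ltW ul] E] := onto (c - r).
      by move: r0 rc; rewrite l1E !lte_fin => r0 rc; apply/andP; split; lra.
    by rewrite (_ : r = u)//; lra.
  have lE : l = c%:E by apply/eqP; rewrite eq_le lc cl.
  by split; [rewrite l1E lE|right].
Qed.

(** A reflection is an involution of the edge only when [l] is finite, whence the side condition
    [o = false -> l <> +oo] that accompanies every use. *)
Definition flip (o : bool) l (t : \bar R) : \bar R := if o then t else (l - t)%E.

End AffineIntervals.

Section EdgeAction.
Variables (R : realType) (Gamma : metricGraph R).
Let M0 := refmodel Gamma.
Variables (K : finGroupType) (to : {action K &-> Gamma}) (D : divisor Gamma).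
Variables (n : nat) (f : 'I_n -> Gamma -> \bar R) (phi : Gamma -> TP R n).
Hypothesis iso : acts_isometrically to.
Hypothesis f_gen : min_generating f (RDK to D).
Hypothesis phi_ind : induced_map f phi.
Hypothesis sep : forall x y : Gamma, ~ (exists a : K, to x a = y) -> phi x <> phi y.
Variable M : model (@dist R Gamma).
Hypothesis ref : refines M0 M.
Hypothesis vert : forall v (a : K), exists v', to (vmap M v) a = vmap M v'.
Variables (A : edge M -> 'I_n -> R) (k : edge M -> 'I_n -> int).
Hypothesis lin : forall e j t, edge_dom e t ->
  f j (emap M e t) = ((A e j)%:E + ((k e j)%:~R : R)%:E * t)%E.
Hypothesis gap : forall e, exists j1 j2, k e j1 = k e j2 + 1.

Lemma act_not_vertex (e : edge M) t a v : (0 < t < len e)%E ->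
  to (emap M e t) a <> vmap M v.
Proof.
move=> ht E; have [v' E'] := vert v a^-1%g.
by apply: (emap_vmap ht (v := v')); rewrite -E' -E tactK.
Qed.

(** Interior points do not move to vertices, so the open interval of parameters is covered by
    disjoint open sets, one for each edge interior. By connectedness a single one is nonempty. *)
Lemma edge_act_interior (a : K) (e : edge M) : exists e1 : edge M,
  forall t : R, (0 < t%:E < len e)%E -> edge_interior e1 (to (emap M e t%:E) a).
Proof.
pose S (e1 : edge M) := [set t : R | (0 < t%:E < len e)%E /\
  edge_interior e1 (to (emap M e t%:E) a)].
have [toC _] := iso a.
have oS e1 : open (S e1).
  rewrite openE => t [ht hS].
  have oU := open_preimage toC (edge_interior_open e1).
  have h1 : \forall s \near t%:E, edge_dom e s -> edge_interior e1 (to (emap M e s) a).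
    exact: near_edge oU (edge_dom_int ht) hS.
  have h2 : \forall s \near t%:E, (0 < s < len e)%E.
    case/andP: ht => t0 tl.
    have h3 : \forall s \near t%:E, (0 < s)%E by exact: open_ereal_gt'.
    have h4 : \forall s \near t%:E, (s < len e)%E by exact: open_ereal_lt'.
    by apply: filterS2 h3 h4 => s -> ->.
  have /nbhs_EFin h3 : \forall s \near t%:E,
      (edge_dom e s -> edge_interior e1 (to (emap M e s) a)) /\ (0 < s < len e)%E.
    exact: filterI.
  by apply: filterS h3 => s [h4 h5]; split=> //; exact: h4 (edge_dom_int h5).
have cover t : (0 < t%:E < len e)%E -> exists e1, S e1 t.
  move=> ht; case: (model_cover M (to (emap M e t%:E) a)) => [[v]|[e1 [s [hs E]]]].
    by move/(act_not_vertex ht).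
  by exists e1; split=> //; exists s.
have disj e1 e2 t : S e1 t -> S e2 t -> e1 = e2.
  move=> [_ [s1 h1 E1]] [_ [s2 h2 E2]].
  by have [] := emap_inj h1 h2 (etrans E1 (esym E2)).
have [t0 [t0_int _]] := small_interior (len_gt0 e) (@ltr01 R).
have [e1 t0S] := cover t0 t0_int; exists e1.
have SE : S e1 = [set t : R | (0 < t%:E < len e)%E].
  apply: interval_connected_ereal; first by exists t0.
    by exists (S e1) => //; apply/seteqP; split=> [t /[dup] [[ht _] hS]|t []].
  exists (~` \bigcup_(e2 in [set e2 | e2 != e1]) S e2).
    by apply: open_closedC; apply: bigcup_open => e2 _; exact: oS.
  apply/seteqP; split=> [t hS|t [ht /= hn]].
    split; first by case: hS.
    by move=> [e2 /= ne h2]; rewrite (disj _ _ _ h2 hS) eqxx in ne.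
  have [e2 h2] := cover t ht; have [<-//|ne] := eqVneq e2 e1.
  by case: hn; exists e2.
by move=> t ht; have : S e1 t by [rewrite SE]; case.
Qed.

Lemma closed_edge_limit (e : edge M) t (C : set Gamma) : closed C ->
  (forall u : R, (0 < u%:E < len e)%E -> C (emap M e u%:E)) ->
  edge_dom e t -> C (emap M e t).
Proof.
move=> cC intC ht; apply: contrapT => nC.
have near_nC := near_edge (closed_openC cC) ht nC.
have [u [u_int]] := near_interior ht near_nC.
by move=> /(_ (edge_dom_int u_int)); apply; exact: intC.
Qed.

Lemma mulz_eq1 (p q : int) : p * q = 1 -> p = 1 \/ p = -1.
Proof.
move=> pq; have /eqP : (`|p| * `|q| = 1)%N by rewrite -abszM pq.
rewrite muln_eq1 => /andP[/eqP h _]; lia.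
Qed.

(** Parameters on [e] and [e1] are compared through the [f j]: these are affine on both edges and
    invariant under [a], which makes the change of parameter affine. *)
Lemma edge_act (a : K) (e : edge M) : exists (e1 : edge M) (o : bool),
  [/\ len e1 = len e, o = false -> len e <> +oo%E
    & forall t, edge_dom e t -> edge_dom e1 (flip o (len e) t) /\
        to (emap M e t) a = emap M e1 (flip o (len e) t)].
Proof.
have [e1 he1] := edge_act_interior a e.
have [e2 he2] := edge_act_interior a^-1 e1.
pose rel (u v : R) := [/\ (0 < u%:E < len e)%E, (0 < v%:E < len e1)%E
  & to (emap M e u%:E) a = emap M e1 v%:E].
have into u : (0 < u%:E < len e)%E -> exists v, rel u v.
  move=> hu; have [s hs E] := he1 u hu; have [v sE] := interior_fin hs.
  by subst s; exists v.
have [u1 [u1_int _]] := small_interior (len_gt0 e) (@ltr01 R).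
have [v1 rel1] := into u1 u1_int.
have e2E : e2 = e.
  have [_ hv E] := rel1; have [s hs] := he2 v1 hv; rewrite -E tactK => E'.
  by have [] := emap_inj hs u1_int E'.
subst e2.
have onto v : (0 < v%:E < len e1)%E -> exists u, rel u v.
  move=> hv; have [s hs E] := he2 v hv; have [u sE] := interior_fin hs.
  by subst s; exists u; split=> //; rewrite E tactKV.
have rel_eq u v : rel u v -> forall j,
    A e j + (k e j)%:~R * u = A e1 j + (k e1 j)%:~R * v.
  move=> [hu hv E] j; have := generator_inv f_gen j a (emap M e u%:E).
  rewrite E (lin _ (edge_dom_int hu)) (lin _ (edge_dom_int hv)).
  by move=> /(congr1 fine) /= ->.
have [u2 [u2_int u21]] : exists u2 : R, (0 < u2%:E < len e)%E /\ u2 < u1.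
  apply: small_interior; first exact: len_gt0.
  by case/andP: u1_int; rewrite lte_fin.
have [v2 rel2] := into u2 u2_int.
have [j1 [j2 jE]] := gap e; have [i1 [i2 iE]] := gap e1.
(* The pair with unit gap on [e] expresses differences of [u] as [N] times differences of [v]; the
   pair with unit gap on [e1] gives the inverse relation with factor [N']. Both are integers, so
   [N * N' = 1]. *)
pose N := k e1 j1 - k e1 j2; pose N' := k e i1 - k e i2.
have NE u v u' v' : rel u v -> rel u' v' -> u - u' = N%:~R * (v - v').
  move=> /rel_eq h /rel_eq h'; move: (h j1) (h j2) (h' j1) (h' j2).
  by rewrite jE /N intrB !intrD; lra.
have NE' : v1 - v2 = N'%:~R * (u1 - u2).
  have h := rel_eq _ _ rel1; have h' := rel_eq _ _ rel2.
  move: (h i1) (h i2) (h' i1) (h' i2).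
  by rewrite iE /N' intrB !intrD; lra.
have u12 : u1 - u2 != 0 by rewrite gt_eqF ?subr_gt0.
have N1 : N = 1 \/ N = -1.
  apply: (@mulz_eq1 N N'); apply/eqP; rewrite -(eqr_int R) intrM; apply/eqP.
  apply: (mulIf u12); rewrite mul1r -mulrA -NE'; apply: esym; exact: NE.
have NN : N%:~R * N%:~R = 1 :> R by case: N1 => ->; rewrite ?mulrNN mulr1.
pose c := v1 - N%:~R * u1.
have relE u v : rel u v -> v = c + N%:~R * u.
  move=> r; have := NE _ _ _ _ r rel1; rewrite /c => E.
  have : N%:~R * (u - u1) = v - v1 by rewrite E mulrA NN mul1r.
  by rewrite mulrBr; lra.
have [lE alt] : len e1 = len e /\ (N%:~R = 1 :> R /\ c = 0 \/ N%:~R = -1 :> R /\ len e = c%:E).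
  apply: (affine_interval (c := c)); try exact: len_gt0.
  - by case: N1 => ->; [left|right].
  - by move=> u /into[v r]; rewrite -(relE _ _ r); case: r.
  - by move=> v /onto[u r]; exists u; [case: r|exact: relE].
have [o oE o_oo] : exists2 o : bool, (forall u : R, flip o (len e) u%:E = (c + N%:~R * u)%:E)
    & (o = false -> len e <> +oo%E).
  case: alt => -[NE1 cE].
    by exists true => // u; rewrite NE1 cE add0r mul1r.
  by exists false; rewrite cE // => u; rewrite NE1 mulN1r.
have fE j (u : R) : A e j + (k e j)%:~R * u =
    A e1 j + (k e1 j)%:~R * (c + N%:~R * u).
  have := rel_eq _ _ rel1 j; have := rel_eq _ _ rel2 j.
  rewrite (relE _ _ rel1) (relE _ _ rel2) => h2 h1.
  have : ((k e j)%:~R - (k e1 j)%:~R * N%:~R) * (u1 - u2) = 0 by lra.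
  move/eqP; rewrite mulf_eq0 (negbTE u12) orbF subr_eq0 => /eqP kE.
  by move: h1; rewrite kE; lra.
exists e1, o; split=> // t ht.
(* To include the ends, closedness of [e1] provides some parameter [t1] for the image point, and
   [phi], which is invariant and injective on [e1], determines it. *)
have [t1 ht1 E1] : edge_set e1 (to (emap M e t) a).
  have [toC _] := iso a.
  have cC : closed ((fun x => to x a) @^-1` edge_set e1).
    by move/continuous_closedP: toC; apply; exact: edge_set_closed.
  apply: (closed_edge_limit cC _ ht) => u hu; have [s hs E] := he1 u hu.
  by exists s => //; exact: edge_dom_int.
have phiE : phi (emap M e1 t1) = phi (emap M e t).
  by rewrite E1 (phi_inv iso f_gen phi_ind ref).
suff <- : t1 = flip o (len e) t by [].
case: t ht E1 phiE => [u| |] ht E1 phiE; last by case/andP: ht.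
  have dom1 : edge_dom e1 (flip o (len e) u%:E).
    have /andP[u0 ul] := ht; apply/andP; rewrite lE /flip.
    case: (o) => //; split; first by rewrite sube_ge0.
    by rewrite leeBlDr// leeDl.
  apply: (phi_inj_edge f_gen phi_ind ref lin gap ht1 dom1); rewrite phiE oE in dom1 *.
  have := phi_real_edge f_gen phi_ind ref lin dom1.
  have := phi_real_edge f_gen phi_ind ref lin ht.
  rewrite (_ : \row_j _ = \row_j (A e1 j + (k e1 j)%:~R * (c + N%:~R * u))).
    exact: hom_coords_uniq.
  by apply/rowP => j; rewrite !mxE fE.
have le : len e = +oo%E by apply/eqP; rewrite eq_le leey; case/andP: ht.
case: t1 ht1 E1 phiE => [r| |] ht1 E1 phiE; last by case/andP: ht1.
  have inf : at_infinity (emap M e +oo%E) by apply/(at_infinityP ref); exists e.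
  case: (phi_infinite f_gen phi_ind ref lin gap inf); rewrite -phiE.
  by eexists; exact: (phi_real_edge f_gen phi_ind ref lin ht1).
by rewrite /flip; case: (o) o_oo => // /(_ erefl); rewrite le.
Qed.

End EdgeAction.

(** * The quotient graph *)

Section ClassRepresentatives.
Variables (T : finType) (Y : Type) (g : T -> Y).

(** The result of [pick] depends only on the predicate, so all elements of a fibre of [g] get the
    same representative. The quotient is then the finite subtype of fixed points. *)
Definition class_rep (x : T) : T := odflt x [pick y | `[< g y = g x >]].

Lemma class_repP x : g (class_rep x) = g x.
Proof. by rewrite /class_rep; case: pickP => [y /asboolP|]. Qed.

Lemma class_rep_eq x y : g x = g y -> class_rep x = class_rep y.
Proof.
move=> gxy; rewrite /class_rep.
rewrite (eq_pick (Q := fun z => `[< g z = g y >])); last by move=> z; rewrite gxy.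
by case: pickP => // /(_ y); rewrite asboolT.
Qed.

Lemma class_rep_id x : class_rep (class_rep x) == class_rep x.
Proof. by apply/eqP/class_rep_eq; exact: class_repP. Qed.

Definition to_rep (x : T) : {x : T | class_rep x == x} := exist _ (class_rep x) (class_rep_id x).

Lemma to_repP x : g (val (to_rep x)) = g x. Proof. exact: class_repP. Qed.

Lemma to_rep_eq x y : to_rep x = to_rep y <-> g x = g y.
Proof.
split=> [E|E]; first by rewrite -(to_repP x) E to_repP.
by apply: val_inj; exact: class_rep_eq.
Qed.

Lemma to_rep_val (r : {x : T | class_rep x == x}) : to_rep (val r) = r.
Proof. by apply: val_inj => /=; apply/eqP; exact: (valP r). Qed.

End ClassRepresentatives.

Section QuotientMap.
Variables (R : realType) (Gamma : metricGraph R) (n : nat) (phi : Gamma -> TP R n).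
Hypothesis phi_cont : continuous phi.

Lemma to_image_eq x y : to_image phi x = to_image phi y <-> phi x = phi y.
Proof. by split=> [/(congr1 val)|E]; [|apply: val_inj]. Qed.

Lemma to_image_surj (p : image_graph phi) : exists x, p = to_image phi x.
Proof.
have [x _ xp] := set_mem (valP p); exists x.
by apply: val_inj; rewrite -xp.
Qed.

Lemma to_image_continuous : continuous (to_image phi).
Proof.
apply/continuousP => U [V oV <-].
rewrite (_ : _ @^-1` _ = phi @^-1` V) //.
exact: open_preimage.
Qed.

(* [Gamma] is compact and [TP] is Hausdorff, so [phi] is a quotient map onto its
   image. *)
Lemma image_openP (U : set (image_graph phi)) :
  open U <-> open (to_image phi @^-1` U).
Proof.
split=> [|oU]; first exact: open_preimage to_image_continuous.
have cC : closed (phi @` (~` (to_image phi @^-1` U))).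
  apply: compact_closed; first exact: TP_hausdorff.
  apply: continuous_compact; first exact: continuous_subspaceT.
  apply: (subclosed_compact _ (model_compact (refmodel Gamma))) => //.
  exact: open_closedC.
exists (~` (phi @` (~` (to_image phi @^-1` U)))); first exact: closed_openC.
apply/seteqP; split=> p; have [x ->] := to_image_surj p => /=.
  by move=> h; apply: contrapT => nU; apply: h; exists x.
by move=> Ux [y nUy E]; apply: nUy => /=; rewrite (_ : to_image phi y = to_image phi x)//; exact/to_image_eq.
Qed.

End QuotientMap.

Section Flip.
Variable R : realType.
Implicit Types (l t : \bar R) (o : bool).

Lemma flip_real o l t : (0 <= t <= l)%E -> (o = false -> l <> +oo%E) ->
  o = false -> exists L r : R, l = L%:E /\ t = r%:E.
Proof.
move=> /andP[t0 tl] h /h; case: l tl {h} => [L| |] // tl _.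
  by case: t t0 tl => [r| |] // _ _; exists L, r.
by have := le_trans t0 tl.
Qed.

Lemma flip_dom o l t : (0 <= t <= l)%E -> (o = false -> l <> +oo%E) ->
  (0 <= flip o l t <= l)%E.
Proof.
case: o => // ht hl; have [L [r [lE tE]]] := flip_real ht hl erefl; subst l t.
by move: ht; rewrite /flip -EFinB !lee_fin => /andP[h1 h2]; apply/andP; split; lra.
Qed.

Lemma flip_int o l t : (0 < t < l)%E -> (o = false -> l <> +oo%E) ->
  (0 < flip o l t < l)%E.
Proof.
case: o => // /[dup] /andP[/ltW t0 /ltW tl] ht hl.
have t_in : (0 <= t <= l)%E by rewrite t0 tl.
have [L [r [lE tE]]] := flip_real t_in hl erefl; subst l t.
by move: ht; rewrite /flip -EFinB !lte_fin => /andP[h1 h2]; apply/andP; split; lra.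
Qed.

Lemma flipK o l t : (0 <= t <= l)%E -> (o = false -> l <> +oo%E) ->
  flip o l (flip o l t) = t.
Proof.
case: o => // ht hl; have [L [r [lE tE]]] := flip_real ht hl erefl; subst l t.
by rewrite /flip -!EFinB; congr (_%:E); lra.
Qed.

Lemma flip_abse o l s t : (0 <= s <= l)%E -> (0 <= t <= l)%E ->
  (o = false -> l <> +oo%E) -> (`|flip o l s - flip o l t| = `|s - t|)%E.
Proof.
case: o => // hs ht hl; have [L [r [lE sE]]] := flip_real hs hl erefl; subst l s.
have [L' [r' [lE tE]]] := flip_real ht hl erefl; case: lE => ?; subst L' t.
rewrite /flip -!EFinB !abse_EFin distrC; congr (`|_|%:E); lra.
Qed.

Lemma affine_flip_uniq o o' l (c u1 u2 : R) : u2 < u1 -> (0 < l)%E ->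
  (o' = false -> l <> +oo%E) ->
  (c%:E + (if o then 1%:R else - 1%:R : R)%:E * u1%:E = flip o' l u1%:E)%E ->
  (c%:E + (if o then 1%:R else - 1%:R : R)%:E * u2%:E = flip o' l u2%:E)%E -> o = o'.
Proof.
move=> u21 l0 loo; case: o; case: o' loo => // loo; rewrite /flip.
  case: l l0 {loo} (loo erefl) => [L| |] // _ _.
  by rewrite -!EFinM -!EFinD => -[h1] [h2]; exfalso; lra.
by rewrite -!EFinM -!EFinD => -[h1] [h2]; exfalso; lra.
Qed.

Lemma flip_uniq o o' l (u1 u2 : R) : u2 < u1 -> (0 < l)%E ->
  (o = false -> l <> +oo%E) -> (o' = false -> l <> +oo%E) ->
  flip o l u1%:E = flip o' l u1%:E -> flip o l u2%:E = flip o' l u2%:E -> o = o'.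
Proof.
move=> u21 l0; case: o => loo loo' h1 h2.
  by apply: (affine_flip_uniq (c := 0) (o := true) u21 l0 loo');
    rewrite mul1e add0e.
move: (loo erefl) => {}loo; case: l l0 loo loo' h1 h2 => [L| |] // l0 _ loo' h1 h2.
by apply: (affine_flip_uniq (c := L) (o := false) u21 l0 loo'); rewrite mulN1e.
Qed.

Lemma flip_continuous o l : (o = false -> l <> +oo%E) -> l <> -oo%E ->
  continuous (flip o l).
Proof.
case: o => [_ _ t|]; first exact: cvg_id.
case: l => [L| |]; [|by move=> /(_ erefl)|by []] => _ _.
have -> : flip false L%:E = fun t => (L%:E + (-1)%:E * t)%E.
  by apply/funext => t; rewrite /flip mulN1e.
exact: affine_continuous.
Qed.

Lemma flip0 o l : flip o l 0%E = if o then 0%E else l.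
Proof. by case: o; rewrite /flip ?sube0. Qed.

Lemma flip_len o l : (0 < l)%E -> (o = false -> l <> +oo%E) ->
  flip o l l = if o then l else 0%E.
Proof.
case: o => // l0 /(_ erefl); case: l l0 => [L| |] // _ _.
by rewrite /flip subee.
Qed.

End Flip.

(** * The model of the image *)

Section QuotientModel.
Variables (R : realType) (Gamma : metricGraph R) (n : nat) (phi : Gamma -> TP R n).
Variables (K : finGroupType) (to : {action K &-> Gamma}).
Variable M : model (@dist R Gamma).
Hypothesis phi_cont : continuous phi.
Hypothesis phi_orb : forall x y, phi x = phi y <-> exists a : K, to x a = y.
Hypothesis phi_inj : forall (e : edge M) s t, edge_dom e s -> edge_dom e t ->
  phi (emap M e s) = phi (emap M e t) -> s = t.
Hypothesis act_nv : forall (e : edge M) t (a : K) v, (0 < t < len e)%E ->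
  to (emap M e t) a <> vmap M v.
Hypothesis act_edge : forall (a : K) (e : edge M), exists (e1 : edge M) (o : bool),
  [/\ len e1 = len e, o = false -> len e <> +oo%E
    & forall t, edge_dom e t -> edge_dom e1 (flip o (len e) t) /\
        to (emap M e t) a = emap M e1 (flip o (len e) t)].
Hypothesis phi_inf : forall (e e1 : edge M) (t : R), len e = +oo%E -> edge_dom e1 t%:E ->
  phi (emap M e1 t%:E) <> phi (emap M e +oo%E).

(** Stated through [phi] instead of a group element, since several elements may carry [e] to [e1];
    the direction [o] is nevertheless determined. *)
Definition edge_eqv (e e1 : edge M) (o : bool) : Prop :=
  [/\ len e1 = len e, o = false -> len e <> +oo%E
    & forall t, edge_dom e t -> edge_dom e1 (flip o (len e) t) /\
        phi (emap M e t) = phi (emap M e1 (flip o (len e) t))].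

Lemma edge_act_eqv (a : K) (e e1 : edge M) t t1 :
  (0 < t < len e)%E -> edge_dom e1 t1 -> to (emap M e t) a = emap M e1 t1 ->
  exists o, [/\ edge_eqv e e1 o, t1 = flip o (len e) t
    & forall s, edge_dom e s -> to (emap M e s) a = emap M e1 (flip o (len e) s)].
Proof.
move=> ht ht1 E; have [e2 [o [lE loo h]]] := act_edge a e.
have [_ E2] := h t (edge_dom_int ht).
have t2_int : (0 < flip o (len e) t < len e2)%E by rewrite lE; exact: flip_int.
have [eE tE] := emap_int_inj t2_int ht1 (etrans (esym E2) E).
subst e2; exists o; split=> //; last by move=> s /h[].
split=> // s hs; have [h1 h2] := h s hs; split=> //.
by apply/phi_orb; exists a.
Qed.

Lemma int_point (e : edge M) : exists t : R, (0 < t%:E < len e)%E.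
Proof. by have [t [ht _]] := small_interior (len_gt0 e) (@ltr01 R); exists t. Qed.

Lemma edge_eqv_meet (e e1 : edge M) t t1 : (0 < t < len e)%E -> edge_dom e1 t1 ->
  phi (emap M e t) = phi (emap M e1 t1) ->
  exists2 o, edge_eqv e e1 o & t1 = flip o (len e) t.
Proof.
move=> ht ht1 /phi_orb[a E]; have [o [h1 h2 _]] := edge_act_eqv ht ht1 E.
by exists o.
Qed.

Definition edge_image (e : edge M) : set (TP R n) := phi @` edge_set e.

Lemma edge_eqvP (e e1 : edge M) :
  edge_image e = edge_image e1 <-> exists o, edge_eqv e e1 o.
Proof.
split=> [E|[o [lE loo h]]].
  have [t ht] := int_point e.
  have : edge_image e1 (phi (emap M e t%:E)).
    by rewrite -E; exists (emap M e t%:E) => //; exists t%:E => //; exact: edge_dom_int.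
  move=> [_ [t1 ht1 <-] E1].
  by have [o ho _] := edge_eqv_meet ht ht1 (esym E1); exists o.
apply/seteqP; split=> [_ [_ [t ht <-] <-]|_ [_ [t ht <-] <-]].
  have [h1 ->] := h t ht.
  by exists (emap M e1 (flip o (len e) t)) => //; exists (flip o (len e) t).
have ht' : (0 <= t <= len e)%E by rewrite -lE.
have [_ E] := h _ (flip_dom ht' loo); rewrite flipK// in E.
exists (emap M e (flip o (len e) t)) => //; exists (flip o (len e) t) => //.
exact: flip_dom.
Qed.

Let vclass (v : vertex M) : TP R n := phi (vmap M v).

Definition qvertex := {v : vertex M | class_rep vclass v == v}.
Definition qedge := {e : edge M | class_rep edge_image e == e}.

Let rv : vertex M -> qvertex := to_rep vclass.
Let re : edge M -> qedge := to_rep edge_image.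

Definition qsrc (e : qedge) : qvertex := rv (src (val e)).
Definition qtgt (e : qedge) : qvertex := rv (tgt (val e)).
Definition qlen (e : qedge) : \bar R := len (val e).
Definition qvmap (v : qvertex) : image_graph phi := to_image phi (vmap M (val v)).
Definition qemap (e : qedge) (t : \bar R) : image_graph phi :=
  to_image phi (emap M (val e) t).

Lemma re_eqv (e : edge M) : exists o, edge_eqv e (val (re e)) o.
Proof. by apply/edge_eqvP; rewrite to_repP. Qed.

Lemma rvE v : phi (vmap M (val (rv v))) = phi (vmap M v).
Proof. exact: (to_repP vclass). Qed.

Lemma qemap_src e : qemap e 0%E = qvmap (qsrc e).
Proof. by apply/to_image_eq; rewrite emap_src rvE. Qed.

Lemma qemap_tgt e : qemap e (qlen e) = qvmap (qtgt e).
Proof. by apply/to_image_eq; rewrite emap_tgt rvE. Qed.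

Lemma qvmap_inj : injective qvmap.
Proof.
move=> u v /to_image_eq /(to_rep_eq vclass).
by rewrite !to_rep_val.
Qed.

Lemma qvertex_nonempty : (0 < #|{: qvertex}|)%N.
Proof. by have /card_gt0P[v _] := vertex_nonempty M; apply/card_gt0P; exists (rv v). Qed.

Let qadj := adjacent qsrc qtgt.

Lemma qconnected u v : connect qadj u v.
Proof.
have sym : connect_sym qadj.
  apply: sym_connect_sym => x y.
  by apply/existsP/existsP => -[e he]; exists e; rewrite orbC.
have edgeE e : connect qadj (rv (src e)) (rv (tgt e)).
  have [o [lE loo h]] := re_eqv e.
  have h0 := (h _ (edge_dom0 e)).2; have h1 := (h _ (edge_dom_len e)).2.
  move: h0 h1; rewrite flip0 flip_len ?len_gt0// emap_src emap_tgt.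
  have base : connect qadj (qsrc (re e)) (qtgt (re e)).
    by apply: connect1; apply/existsP; exists (re e); rewrite !eqxx.
  case: o {h loo} => h0 h1.
    rewrite emap_src in h0; rewrite -lE emap_tgt in h1.
    have -> : rv (src e) = qsrc (re e) by exact/(to_rep_eq vclass).
    by have -> : rv (tgt e) = qtgt (re e) by exact/(to_rep_eq vclass).
  rewrite -lE emap_tgt in h0; rewrite emap_src in h1.
  have -> : rv (src e) = qtgt (re e) by exact/(to_rep_eq vclass).
  have -> : rv (tgt e) = qsrc (re e) by exact/(to_rep_eq vclass).
  by rewrite sym.
rewrite -[u](to_rep_val (g := vclass)) -[v](to_rep_val (g := vclass)).
move: (val u) (val v) => {}u {}v.
have /connectP[p] := connected_graph (w := M) u v.
elim: p u => [|c p IH] u /=; first by move=> _ ->.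
case/andP => /existsP[e he] pth lst; apply: connect_trans (IH c pth lst).
case/orP: he => /andP[/eqP <- /eqP <-]; first exact: edgeE.
by rewrite sym; exact: edgeE.
Qed.

Lemma qlen_gt0 e : (0 < qlen e)%E. Proof. exact: len_gt0. Qed.

(** No real parameter is sent to the image of a point at infinity, so another edge ending there is
    infinite as well. Some element of [K] matches the two ends, and since a point at infinity lies
    on one edge only, it matches the edges. *)
Lemma qinfinite_leaf e : qlen e = +oo%E -> valence qsrc qtgt (qtgt e) = 1%N.
Proof.
move=> le; apply/valence1P.
have end_e : phi (vmap M (tgt (val e))) = phi (emap M (val e) +oo%E).
  by rewrite -emap_tgt -[len _]/(qlen e) le.
split=> e1 /(to_rep_eq vclass); rewrite /vclass end_e.
  by rewrite -emap_src; apply: phi_inf => //; exact: edge_dom0.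
rewrite -emap_tgt; case l1: (len (val e1)) => [r| |]; last 2 first.
- move=> /esym /phi_orb[a E].
  have [e2 [o [lE loo h]]] := act_edge a (val e).
  have [] := h +oo%E; first by rewrite -le; exact: edge_dom_len.
  have -> : flip o (len (val e)) +oo%E = +oo%E.
    by rewrite -[len _]/(qlen e) le; case: (o) loo => // /(_ erefl); rewrite -[len _]/(qlen e) le.
  move=> h1; rewrite E => E'.
  have l1_dom : edge_dom (val e1) +oo%E by rewrite -l1; exact: edge_dom_len.
  have [|ee _] := infinite_end _ l1_dom E'; first by rewrite lE.
  subst e2; rewrite -(to_rep_val e) -(to_rep_val e1); apply/esym/to_rep_eq/edge_eqvP.
  exists o; split=> // t ht; have [h2 h3] := h t ht; split=> //.
  by apply/phi_orb; exists a.
- by have := len_gt0 (val e1); rewrite l1.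
- move=> E; case: (phi_inf le _ E).
  by rewrite -l1; exact: edge_dom_len.
Qed.

Definition qgraph : wgraph R :=
  WGraph qvertex_nonempty qconnected qlen_gt0 qinfinite_leaf.

Lemma qemap_vmap (e : edge qgraph) t v : (0 < t < len e)%E -> qemap e t <> qvmap v.
Proof. by move=> ht /to_image_eq /phi_orb[a]; exact: act_nv. Qed.

Lemma qemap_inj (e : edge qgraph) t (e' : edge qgraph) t' :
  (0 < t < len e)%E -> (0 < t' < len e')%E ->
  qemap e t = qemap e' t' -> e = e' /\ t = t'.
Proof.
move=> ht ht' /to_image_eq E.
have [o ho _] := edge_eqv_meet ht (edge_dom_int ht') E.
have ee : e = e'.
  rewrite -(to_rep_val e) -(to_rep_val e'); apply/to_rep_eq/edge_eqvP.
  by exists o.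
by subst e'; split=> //; apply: phi_inj E; exact: edge_dom_int.
Qed.

Lemma qcover (p : image_graph phi) : (exists v, p = qvmap v) \/
  (exists (e : edge qgraph) t, (0 < t < len e)%E /\ p = qemap e t).
Proof.
have [x ->] := to_image_surj p.
have [[v ->]|[e [t [ht ->]]]] := model_cover M x.
  by left; exists (rv v); apply/to_image_eq; rewrite rvE.
right; have [o [lE loo h]] := re_eqv e; exists (re e), (flip o (len e) t); split.
  by have -> : @len R qgraph (re e) = len e by [exact: lE]; exact: flip_int.
by apply/to_image_eq; have [] := h t (edge_dom_int ht).
Qed.

Lemma qopen (U : set (image_graph phi)) : open U <->
  (forall e : edge qgraph, exists W : set (\bar R),
     open W /\ forall t, edge_dom e t -> (U (qemap e t) <-> W t)).
Proof.
rewrite (image_openP phi_cont) (model_open M); split=> h e.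
  by have [W hW] := h (val e); exists W.
have [o [lE loo he]] := re_eqv e; have [W [oW hW]] := h (re e).
exists (flip o (len e) @^-1` W); split.
  apply: open_preimage => //; apply: flip_continuous => // lN.
  by have := len_gt0 e; rewrite lN.
move=> t ht; have [h1 h2] := he t ht.
rewrite /= -(hW _ h1) /qemap.
by rewrite (_ : to_image phi (emap M e t) = to_image phi (emap M (val (re e)) (flip o (len e) t)))//;
  apply/to_image_eq.
Qed.

Section WithDistance.
Variable f : 'I_n -> Gamma -> \bar R.
Hypothesis qdist : forall p q, image_dist f phi p q =
  chain_dist (edge_step (G := qgraph) qemap) p q.

Definition qmodel : model (image_dist f phi) :=
  @Model R (image_graph phi) (image_dist f phi) qgraph qvmap qemap qemap_src
    qemap_tgt qvmap_inj qemap_vmap qemap_inj qcover qopen qdist.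

End WithDistance.

Lemma edge_step_image x y r : edge_step (emap M) x y r ->
  chain (edge_step (G := qgraph) qemap) (to_image phi x) (to_image phi y) r.
Proof.
move=> [e [s [t [hs ht <- <- ->]]]]; apply: chain1.
have [o [lE loo h]] := re_eqv e.
have [h1 E1] := h s hs; have [h2 E2] := h t ht.
exists (re e), (flip o (len e) s), (flip o (len e) t); split=> //.
- exact/to_image_eq.
- exact/to_image_eq.
- by rewrite flip_abse.
Qed.

Lemma chain_image x y r : chain (edge_step (emap M)) x y r ->
  chain (edge_step (G := qgraph) qemap) (to_image phi x) (to_image phi y) r.
Proof.
elim=> [z|z u v r1 r2 st _ IH]; first exact: chain_nil.
exact: chain_cat (edge_step_image st) IH.
Qed.

End QuotientModel.

(** * The metric of the image *)

Section LatticeLength.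
Variables (R : realType) (n : nat).

(* Two primitive integer vectors that are real multiples of each other differ by
   a sign; the vector of slopes is primitive because two slopes differ by 1. *)
Lemma primitive_scale (lambda delta : R) (w k : 'I_n -> int) i j1 j2 :
  0 < lambda -> \big[gcdn/0%N]_j `|w j|%N = 1%N -> k j1 = k j2 + 1 ->
  (forall j, ((k j)%:~R - (k i)%:~R) * delta = lambda * (w j)%:~R) ->
  lambda = `|delta|.
Proof.
move=> l_gt0 w1 kE h; pose N := w j1 - w j2.
have l_ne0 : lambda != 0 by rewrite gt_eqF.
have dE : delta = lambda * N%:~R.
  by have := h j1; have := h j2; rewrite kE /N intrB intrD; lra.
have wE j : w j = (k j - k i) * N.
  apply/eqP; rewrite -(eqr_int R) intrM intrB; apply/eqP; apply: (mulfI l_ne0).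
  by rewrite -h dE; ring.
have : (`|N| %| 1)%N.
  by rewrite -w1; apply/dvdn_biggcdP => j _; rewrite wE abszM dvdn_mull.
rewrite dvdn1 => /eqP N1.
by rewrite dE normrM (gtr0_norm l_gt0) -intr_norm -abszE N1 mulr1.
Qed.

Lemma lattice_length_ge0 (p q : TP R n) r : lattice_length p q r -> (0 <= r)%E.
Proof.
case=> [[_ ->]//|[u [v [i [lambda [w [_ _ l_gt0 _ [_ ->]]]]]]]|[_ _ ->]//].
by rewrite lee_fin ltW.
Qed.

End LatticeLength.

Section ImageDistance.
Variables (R : realType) (Gamma : metricGraph R).
Let M0 := refmodel Gamma.
Variables (K : finGroupType) (to : {action K &-> Gamma}) (D : divisor Gamma).
Variables (n : nat) (f : 'I_n -> Gamma -> \bar R) (phi : Gamma -> TP R n).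
Hypothesis iso : acts_isometrically to.
Hypothesis D_ge0 : effective D.
Hypothesis f_gen : min_generating f (RDK to D).
Hypothesis phi_ind : induced_map f phi.
Hypothesis sep : forall x y : Gamma, ~ (exists a : K, to x a = y) -> phi x <> phi y.
Variable M : model (@dist R Gamma).
Hypothesis ref : refines M0 M.
Variables (A : edge M -> 'I_n -> R) (k : edge M -> 'I_n -> int).
Hypothesis lin : forall e j t, edge_dom e t ->
  f j (emap M e t) = ((A e j)%:E + ((k e j)%:~R : R)%:E * t)%E.
Hypothesis gap : forall e, exists j1 j2, k e j1 = k e j2 + 1.
Hypothesis phi_orb : forall x y, phi x = phi y <-> exists a : K, to x a = y.
Hypothesis act_edge : forall (a : K) (e : edge M), exists (e1 : edge M) (o : bool),
  [/\ len e1 = len e, o = false -> len e <> +oo%E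
    & forall t, edge_dom e t -> edge_dom e1 (flip o (len e) t) /\
        to (emap M e t) a = emap M e1 (flip o (len e) t)].
Hypothesis phi_inf : forall (e e1 : edge M) (t : R), len e = +oo%E -> edge_dom e1 t%:E ->
  phi (emap M e1 t%:E) <> phi (emap M e +oo%E).
Let G := qgraph phi_orb act_edge phi_inf.

(** When both ends have real coordinates, their parameters are real. Coordinate differences change
    by the slope differences times [s' - t'], and the unit gap lets [primitive_scale] identify the
    lattice length with [|s' - t'|]. The segment is then a chain of [M], which descends to the
    quotient. *)
Lemma image_step_chain p q r : image_step f p q r ->
  r = +oo%E \/ chain (edge_step (G := G) (@qemap R Gamma n phi M)) p q r.
Proof.
move=> [e [s [t [hs ht flin [<- <-]]]]].
case=> [[E ->]|[u [v [i [lambda [w [hu hv l_gt0 w1 [huv ->]]]]]]]|[_ _ ->]]; last by left.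
  by right; rewrite (val_inj E); exact: chain_nil.
right.
have real_par x : edge_dom e x -> (exists z, real_coords (phi (emap M0 e x)) z) ->
    exists2 y : R, x = y%:E & ~ at_infinity (emap M0 e x).
  case: x => [y| |] hx hz; last by case/andP: hx.
    exists y => // h; exact: (phi_infinite f_gen phi_ind ref lin gap h).
  case: (phi_infinite f_gen phi_ind ref lin gap _ hz).
  exists e; split=> //; by apply/eqP; rewrite eq_le leey; case/andP: hx.
have [|s' sE s_fin] := real_par s hs; first by exists u.
have [|t' tE t_fin] := real_par t ht; first by exists v.
subst s t; have [ck hck] := choice flin.
have [kk hkk] := choice hck.
have vals j (y : R) : (s' <= y <= t') \/ (t' <= y <= s') ->
    f j (emap M0 e y%:E) = (ck j + (kk j)%:~R * y)%:E.
  by move=> hy; rewrite hkk /= ?lee_fin.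
have s_in : (s' <= s' <= t') \/ (t' <= s' <= s').
  by have [h|h] := leP s' t'; [left|right]; rewrite lexx ?h ?ltW.
have t_in : (s' <= t' <= t') \/ (t' <= t' <= s').
  by have [h|h] := leP s' t'; [left|right]; rewrite lexx ?h ?ltW.
have row_diff (y : R) z j : real_coords (phi (emap M0 e y%:E)) z ->
    ~ at_infinity (emap M0 e y%:E) -> (s' <= y <= t') \/ (t' <= y <= s') ->
    z ord0 j - z ord0 i = (ck j + (kk j)%:~R * y) - (ck i + (kk i)%:~R * y).
  move=> hz hy y_in; have := real_coords_diff hz (phi_real f_gen phi_ind hy) j i.
  by rewrite !mxE !vals.
have prim j : ((kk j)%:~R - (kk i)%:~R) * (s' - t') = lambda * (w j)%:~R.
  rewrite -huv (row_diff _ _ j hu s_fin s_in) (row_diff _ _ j hv t_fin t_in); ring.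
have st : s' != t'.
  apply/eqP => E; subst t'; move: w1; rewrite big1 // => j _.
  have := prim j; rewrite subrr mulr0 => /esym/eqP; rewrite mulf_eq0 gt_eqF//=.
  by rewrite intr_eq0 => /eqP ->.
have [j1 [j2 kE]] : exists j1 j2, kk j1 = kk j2 + 1.
  have [lt|gt|E] := ltgtP s' t'; last by rewrite E eqxx in st.
    apply: (segment_gap iso D_ge0 f_gen phi_ind sep (e := e) (s := s'%:E) (t := t'%:E) (A := ck)).
    - by case/andP: hs.
    - by rewrite lte_fin.
    - by case/andP: ht.
    - by move=> j y hy; apply: hkk; left.
  apply: (segment_gap iso D_ge0 f_gen phi_ind sep (e := e) (s := t'%:E) (t := s'%:E) (A := ck)).
  - by case/andP: ht.
  - by rewrite lte_fin.
  - by case/andP: hs.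
  - by move=> j y hy; apply: hkk; right.
rewrite (primitive_scale l_gt0 w1 kE prim).
apply: (chain_image phi_orb act_edge phi_inf).
have [_ _ st_chain _] := ref; apply: st_chain.
by exists e, s'%:E, t'%:E; split=> //; rewrite -EFinB abse_EFin.
Qed.

Lemma chain_image_step p q r : edge_step (G := G) (@qemap R Gamma n phi M) p q r ->
  r = +oo%E \/ chain (image_step f (phi := phi)) p q r.
Proof.
move=> [[e re] [s [t [hs ht <- <- ->]]]]; rewrite /qemap /= in hs ht *.
(* A step with an infinite parameter has length [+oo], even from the end to itself, because
   [+oo - +oo] is [-oo] here. *)
case: s t hs ht => [s| |] [t| |] hs ht; try by [left|case/andP: hs|case/andP: ht].
have [<-|st] := eqVneq s t.
  by right; rewrite -EFinB subrr abse_EFin normr0; exact: chain_nil.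
right; apply: chain1.
have [_ /(_ e)[e0 [a [a_ge0 ale emE]]] _ _] := ref.
have dom0 (y : R) : edge_dom e y%:E -> edge_dom e0 (a + y)%:E.
  move=> /andP[y0 yl]; apply/andP; split.
    by rewrite lee_fin addr_ge0// -lee_fin.
  by apply: le_trans ale; rewrite EFinD leeD2l.
exists e0, (a + s)%:E, (a + t)%:E; split.
- exact: dom0.
- exact: dom0.
- move=> j; exists (A e j - (k e j)%:~R * a), (k e j) => u hu.
  have [y uE] : exists y : R, u = (a + y)%:E.
    case: u hu => [y _|[/andP[_]|/andP[_]]|[/andP[+ _]|/andP[+ _]]] //.
    by exists (y - a); rewrite addrC subrK.
  subst u; have y_dom : edge_dom e y%:E.
    move: hu; rewrite /= !lee_fin !lerD2l.
    case/andP: hs => s0 sl; case/andP: ht => t0 tl.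
    case=> /andP[h1 h2]; apply/andP; split.
    + by apply: le_trans s0 _; rewrite lee_fin.
    + by apply: le_trans tl; rewrite lee_fin.
    + by apply: le_trans t0 _; rewrite lee_fin.
    + by apply: le_trans sl; rewrite lee_fin.
  rewrite EFinD -emE// lin// -!EFinM -!EFinD; congr (_%:E); ring.
- by rewrite !EFinD -!emE.
have [j1 [j2 kE]] := gap e.
have dst : `|s - t| != 0 by rewrite normr_eq0 subr_eq0.
apply: Or32; exists (\row_j (A e j + (k e j)%:~R * s)), (\row_j (A e j + (k e j)%:~R * t)).
(* Slope differences with respect to [j2] form a primitive vector, as the entry at [j1] is 1. The
   sign of [s - t] is put into the vector to leave the positive factor [|s - t|]. *)
pose sg : int := if s < t then -1 else 1.
have sgE : sg%:~R * `|s - t| = s - t.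
  rewrite /sg; case: ltP => h; first by rewrite ltr0_norm ?subr_lt0// mulrNN mul1r.
  by rewrite ger0_norm ?subr_ge0// mul1r.
exists j2, `|s - t|, (fun j => sg * (k e j - k e j2)); split.
- exact: (phi_real_edge f_gen phi_ind ref lin hs).
- exact: (phi_real_edge f_gen phi_ind ref lin ht).
- by rewrite lt_neqAle eq_sym dst normr_ge0.
- rewrite (bigD1 j1) //= (_ : sg * _ = sg); last by rewrite kE addrAC subrr add0r mulr1.
  by rewrite (_ : `|sg|%N = 1%N) ?gcd1n// /sg; case: ifP.
- split; last by rewrite -EFinB abse_EFin.
  move=> j; rewrite !mxE intrM intrB.
  rewrite [RHS]mulrA [_ * sg%:~R]mulrC sgE; ring.
Qed.

Lemma quotient_dist p q : image_dist f phi p q =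
  chain_dist (edge_step (G := G) (@qemap R Gamma n phi M)) p q.
Proof.
apply: chain_dist_eq.
- by move=> x y r [e [s [t [_ _ _ _ /lattice_length_ge0]]]].
- exact: edge_step_ge0.
- exact: image_step_chain.
- exact: chain_image_step.
Qed.

End ImageDistance.

(** * Degrees *)

Section Stabilizers.
Variables (K : finGroupType) (X : choiceType) (to : {action K &-> X}).

Definition movers (x y : X) : {set K} := [set a | to x a == y]%SET.

(** The elements carrying [x] to [y] form a coset of the stabilizer of [x]. *)
Lemma card_movers_l x y a : to x a = y -> #|movers x y| = #|movers x x|.
Proof.
move=> E; rewrite -(card_imset (mem (movers x x)) (mulIg a)).
apply: eq_card => b; apply/idP/imsetP => [|[c]]; rewrite !inE.
  move=> /eqP bE; exists (b * a^-1)%g; last by rewrite -mulgA mulVg mulg1.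
  by rewrite inE tactM bE -E tactK.
by move=> /eqP cE ->; rewrite tactM cE E.
Qed.

Lemma card_movers_r x y a : to x a = y -> #|movers x y| = #|movers y y|.
Proof.
move=> E; rewrite -(card_imset (mem (movers y y)) (mulgI a)).
apply: eq_card => b; apply/idP/imsetP => [|[c]]; rewrite !inE.
  move=> /eqP bE; exists (a^-1 * b)%g; last by rewrite mulgA mulgV mul1g.
  by rewrite inE tactM -E tactK E bE.
by move=> /eqP cE ->; rewrite tactM E cE.
Qed.

(** The stabilizer of [y] has as many elements as there are elements carrying [x] to [y], and each
    element of [K] carries [x] to exactly one point. *)
Lemma orbit_sum (x : X) :
  (\sum_(y \in [set y | exists a, to x a = y]) #|movers y y| = #|K|)%N.
Proof.
pose s := undup [seq to x a | a <- enum K].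
have memE y : (exists a, to x a = y) <-> y \in s.
  rewrite mem_undup; split=> [[a <-]|/mapP[a _ ->]]; last by exists a.
  by apply/mapP; exists a; rewrite ?mem_enum.
rewrite (_ : [set y | _] = [set` s]); last first.
  by apply/funext => y; apply/propext; exact: memE.
rewrite -fsbig_seq ?undup_uniq// -sum1_card.
rewrite (eq_big_seq (fun y => \sum_(a : K) (to x a == y))%N); last first.
  move=> y ys; have [a E] := (memE y).2 ys; rewrite -(card_movers_r E) -sum1_card big_mkcond /=.
  by apply: eq_bigr => b _; rewrite inE; case: eqP.
rewrite exchange_big /=; apply: eq_bigr => a _.
have : count_mem (to x a) s = 1%N.
  by rewrite count_uniq_mem ?undup_uniq// (_ : _ \in s = true)//; apply/memE; exists a.
by rewrite -sum1_count big_mkcond /= => <-; apply: eq_bigr => y _; rewrite eq_sym; case: eqP.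
Qed.

End Stabilizers.

(** * Harmonicity and the Galois property *)

Section GaloisCount.
Variables (R : realType) (Gamma : metricGraph R) (n : nat) (phi : Gamma -> TP R n).
Variables (K : finGroupType) (to : {action K &-> Gamma}).
Variable M : model (@dist R Gamma).
Hypothesis phi_cont : continuous phi.
Hypothesis phi_orb : forall x y, phi x = phi y <-> exists a : K, to x a = y.
Hypothesis phi_inj : forall (e : edge M) s t, edge_dom e s -> edge_dom e t ->
  phi (emap M e s) = phi (emap M e t) -> s = t.
Hypothesis act_nv : forall (e : edge M) t (a : K) v, (0 < t < len e)%E ->
  to (emap M e t) a <> vmap M v.
Hypothesis act_edge : forall (a : K) (e : edge M), exists (e1 : edge M) (o : bool),
  [/\ len e1 = len e, o = false -> len e <> +oo%E
    & forall t, edge_dom e t -> edge_dom e1 (flip o (len e) t) /\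
        to (emap M e t) a = emap M e1 (flip o (len e) t)].
Hypothesis phi_inf : forall (e e1 : edge M) (t : R), len e = +oo%E -> edge_dom e1 t%:E ->
  phi (emap M e1 t%:E) <> phi (emap M e +oo%E).
Variable f : 'I_n -> Gamma -> \bar R.
Hypothesis qdist : forall p q, image_dist f phi p q =
  chain_dist (edge_step (G := qgraph phi_orb act_edge phi_inf) (@qemap R Gamma n phi M)) p q.
Let M' : model (image_dist f phi) :=
  @qmodel R Gamma n phi K to M phi_cont phi_orb phi_inj act_nv act_edge phi_inf f qdist.

Lemma edge_eqv_sym (e e1 : edge M) o : edge_eqv phi e e1 o -> edge_eqv phi e1 e o.
Proof.
move=> [lE loo h]; split; rewrite ?lE// => t ht.
have ht' : (0 <= t <= len e)%E by rewrite -lE.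
have ft := flip_dom ht' loo; split; first exact: ft.
by have [_ ->] := h _ ft; rewrite flipK.
Qed.

Lemma edge_eqv_uniq (e e1 : edge M) o o' :
  edge_eqv phi e e1 o -> edge_eqv phi e e1 o' -> o = o'.
Proof.
move=> [lE loo h] [_ loo' h'].
have [u1 [u1_int _]] := small_interior (len_gt0 e) (@ltr01 R).
have [u2 [u2_int u21]] : exists u2 : R, (0 < u2%:E < len e)%E /\ u2 < u1.
  apply: small_interior; first exact: len_gt0.
  by case/andP: u1_int; rewrite lte_fin.
have same u : (0 < u%:E < len e)%E -> flip o (len e) u%:E = flip o' (len e) u%:E.
  move=> /edge_dom_int hu; have [d1 E1] := h _ hu; have [d2 E2] := h' _ hu.
  by apply: (phi_inj d1 d2); rewrite -E1 E2.
exact: flip_uniq u21 (len_gt0 e) loo loo' (same _ u1_int) (same _ u2_int).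
Qed.

(** Two interior points determine an affine map, so they suffice to match the direction of a
    dilation with that of the equivalence. A reflection is the dilation with constant term the
    length of the edge. *)
Lemma dilates_eqv (e : edge M) (e' : edge M') (o : bool) :
  dilates (M := M) (M' := M') (to_image phi) e 1 e' o <-> edge_eqv phi e (val e') o.
Proof.
split=> [[c h]|[lE loo h]]; last first.
  case: o loo h => loo h.
    by exists 0 => t ht; rewrite add0e mul1e; have [h1 h2] := h t ht; split=> //; apply/to_image_eq.
  case: (len e) (loo erefl) (len_gt0 e) h => [L| |] // _ _ h.
  exists L => t ht; have [h1 h2] := h t ht.
  by rewrite mulN1e; split=> //; apply/to_image_eq.
have [u1 [u1_int _]] := small_interior (len_gt0 e) (@ltr01 R).
have [u2 [u2_int u21]] : exists u2 : R, (0 < u2%:E < len e)%E /\ u2 < u1.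
  apply: small_interior; first exact: len_gt0.
  by case/andP: u1_int; rewrite lte_fin.
have [d1 E1] := h _ (edge_dom_int u1_int); have [d2 E2] := h _ (edge_dom_int u2_int).
have {}E1 := (to_image_eq _ _ _).1 E1; have {}E2 := (to_image_eq _ _ _).1 E2.
have [o' ho' f1] := edge_eqv_meet phi_orb act_edge u1_int d1 E1.
have [lE loo h'] := ho'; have [d2' E2'] := h' _ (edge_dom_int u2_int).
have f2 := phi_inj d2 d2' (etrans (esym E2) E2').
suff -> : o = o' by [].
exact: affine_flip_uniq u21 (len_gt0 e) loo f1 f2.
Qed.

Lemma act_edge_set (a : K) (e : edge M) : exists e1 : edge M,
  (fun x => to x a) @` edge_set e = edge_set e1.
Proof.
have [e1 [o [lE loo h]]] := act_edge a e; exists e1.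
apply/seteqP; split=> [_ [_ [t ht <-] <-]|_ [t ht <-]].
  by have [h1 ->] := h t ht; exists (flip o (len e) t).
have ht' : (0 <= t <= len e)%E by rewrite -lE.
exists (emap M e (flip o (len e) t)).
  by exists (flip o (len e) t) => //; exact: flip_dom.
by have [_ ->] := h _ (flip_dom ht' loo); rewrite flipK.
Qed.

(* An element that preserves an edge fixes it pointwise, since [phi] is injective
   on it. *)
Lemma edge_stabE (e : edge M) t : (0 < t < len e)%E ->
  edge_stab to e = movers to (emap M e t) (emap M e t).
Proof.
move=> ht; have t_dom := edge_dom_int ht; apply/setP => a; rewrite !inE.
apply/asboolP/eqP => [E|E].
  have : edge_set e (to (emap M e t) a).
    by rewrite -E; exists (emap M e t) => //; exists t.
  move=> [s hs sE]; rewrite -sE; congr (emap M e _).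
  apply: (phi_inj hs t_dom); rewrite sE; apply/esym/phi_orb; by exists a.
have [o [ho _ h]] := edge_act_eqv phi_orb act_edge ht t_dom E.
have fixed s : edge_dom e s -> to (emap M e s) a = emap M e s.
  move=> hs; have [_ _ /(_ s hs)[h1 h2]] := ho.
  by rewrite h//; congr (emap M e _); apply: (phi_inj h1 hs); rewrite -h2.
apply/seteqP; split=> [_ [_ [s hs <-] <-]|_ [s hs <-]].
  by exists s => //; rewrite fixed.
by exists (emap M e s); [exists s|exact: fixed].
Qed.

Lemma edge_stab_eqv (e e1 : edge M) o : edge_eqv phi e e1 o ->
  #|edge_stab to e| = #|edge_stab to e1|.
Proof.
move=> [lE loo h]; have [t ht] := int_point e.
have [_ /phi_orb[a E]] := h _ (edge_dom_int ht).
have ht1 : (0 < flip o (len e) t%:E < len e1)%E by rewrite lE; exact: flip_int.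
by rewrite (edge_stabE ht) (edge_stabE ht1) -(card_movers_l E) (card_movers_r E).
Qed.

Definition qmult (e' : edge M') : nat := #|edge_stab to (val e')|.

Lemma edge_stab_gt0 (e : edge M) : (0 < #|edge_stab to e|)%N.
Proof.
have [t ht] := int_point e; rewrite (edge_stabE ht); apply/card_gt0P.
by exists 1%g; rewrite inE tact1.
Qed.

(* The elements carrying the base point of [h'] to [x] are sorted by the half-edge
   at [x] to which they carry [h']. *)
Lemma local_degree (x : Gamma) (h' : half_edge M') : half_at h' (to_image phi x) ->
  (\sum_(h : half_edge M |
      `[< half_at h x /\ half_maps (to_image phi) (fun=> 1%N) h h' >])
     (qmult h'.1 %/ 1) * 1)%N = #|movers to x x|.
Proof.
case: h' => e' b' [t' [/= /to_image_eq E ht']].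
have t'_dom : edge_dom (val e') t'.
  by move: ht'; case: b' => /andP[h1 h2]; apply/andP; split=> //; exact: ltW.
pose H (h : half_edge M) := `[< half_at h x /\
  half_maps (M' := M') (to_image phi) (fun=> 1%N) h (e', b') >].
pose y' := emap M (val e') t'.
have [c cE] : exists c, to y' c = x by apply/phi_orb.
rewrite -(card_movers_r cE).
have [u0 u0_int] := int_point (val e').
have u0_dom := edge_dom_int u0_int.
have [ea hea] := choice (fun a => act_edge a (val e')).
have [oa hoa] := choice hea.
(* The half-edge at [x] to which [a] carries [h']; an element reversing the parameter exchanges the
   two sides. *)
pose hedge (a : K) : half_edge M := (ea a, if oa a then b' else ~~ b').
have eqv_a a : edge_eqv phi (val e') (ea a) (oa a).
  have [lE loo h] := hoa a; split=> // t ht; have [h1 h2] := h t ht; split=> //.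
  by apply/phi_orb; exists a.
have hedgeH a : a \in movers to y' x -> H (hedge a).
  rewrite inE => /eqP aE; have [lE loo h] := hoa a; apply/asboolP; split.
    have [h1 h2] := h _ t'_dom; exists (flip (oa a) (len (val e')) t').
    split; first by rewrite -h2.
    rewrite /= lE; case: (oa a) loo => loo //=.
    have [L [r [LE rE]]] := flip_real t'_dom loo erefl.
    have LE' : qlen e' = L%:E by exact: LE.
    move: ht'; rewrite /= rE ?LE' LE /flip -EFinB.
    by case: (b') => /=; rewrite !lee_fin !lte_fin => /andP[h3 h4]; apply/andP; split; lra.
  split=> //; apply/dilates_eqv/edge_eqv_sym => /=.
  rewrite (_ : (_ == b') = oa a); first exact: eqv_a.
  by case: (oa a); case: (b').
rewrite -sum1_card (partition_big hedge H hedgeH) /=.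
apply: eq_bigr => -[e b] /asboolP[[t ht] [_ /dilates_eqv /= eqv_e]].
have t_dom : edge_dom e t by exact: half_pos_dom ht.
have [/= tE _] := ht.
rewrite muln1 divn1 sum1_card.
set o := b == b' in eqv_e.
(* The elements counted by this fibre are those carrying the interior point [u0] to the point [z] of
   [e] above it: an interior point determines the image edge, and the direction onto [e] is forced.
   They form a coset of the stabilizer of that point, which is the stabilizer of the edge. *)
have eqv_e' := edge_eqv_sym eqv_e; have [lE loo h] := eqv_e'.
have [z_dom zE] := h _ u0_dom.
set z := emap M e (flip o (len (val e')) u0%:E) in zE.
have [d dE] : exists d, to (emap M (val e') u0%:E) d = z by apply/phi_orb.
rewrite /qmult /= (edge_stabE u0_int) -(card_movers_l dE).
apply: eq_card => a; rewrite [RHS]inE /= inE.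
apply/eqP/andP => [aE|[aE /eqP[ee be]]]; last first.
  have [_ _ ha] := hoa a; have [_ ->] := ha _ u0_dom.
  rewrite /z -ee; congr (emap M _ (flip _ _ _)).
  by rewrite /o -be; case: (oa a); case: (b').
have [lEa looa ha] := hoa a; have [w_dom wE] := ha _ u0_dom.
have z_int : (0 < flip o (len (val e')) u0%:E < len e)%E by rewrite lE; exact: flip_int.
have [ee _] := emap_int_inj z_int w_dom (etrans (esym aE) wE).
have eqva := eqv_a a; rewrite -ee in eqva.
have oE := edge_eqv_uniq eqva eqv_e'.
have bE : (if oa a then b' else ~~ b') = b by rewrite oE /o; case: (b); case: (b').
split; last by rewrite /hedge bE -ee.
have [h1 h2] := ha _ t'_dom; rewrite inE /y' h2 -ee oE; apply/eqP.
rewrite -tE; congr (emap M e _).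
rewrite -ee oE in h1.
apply: (phi_inj h1 t_dom); rewrite tE -E.
by apply/esym/phi_orb; exists a; rewrite -/y' h2 -ee oE.
Qed.

Lemma singleton_image : is_singleton (image_graph phi) -> is_singleton Gamma.
Proof.
move=> single x y; have [[e [t [ht _]]]|[all_x _]] := point_on_edge M x; last first.
  by rewrite (all_x y).
have E : phi (emap M e 0%E) = phi (emap M e (len e)) by apply/to_image_eq/single.
have := len_gt0 e; rewrite -(phi_inj (edge_dom0 e) (edge_dom_len e) E).
by rewrite ltxx.
Qed.

Lemma quotient_morphism : is_morphism M' (to_image phi) (fun _ : edge M => 1%N).
Proof.
split.
- exact: to_image_continuous.
- move=> v; exists (to_rep (fun v => phi (vmap M v)) v).
  by apply/to_image_eq; rewrite rvE.
- move=> e'; exists [set e | `[< edge_image phi e = edge_image phi (val e') >]]%SET.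
  apply/seteqP; split=> x.
    move=> [t ht /to_image_eq /esym E].
    have [[v xE]|[e [s [hs xE]]]] := model_cover M x.
      rewrite xE in E; have /phi_orb[a] := esym E.
      by move/(act_nv ht).
    rewrite xE in E; have [o ho _] := edge_eqv_meet phi_orb act_edge hs (edge_dom_int ht) E.
    exists e; last by exists s.
    by rewrite /= inE; apply/asboolP/(edge_eqvP phi_orb act_edge); exists o.
  move=> [e /= + [t ht <-]]; rewrite inE => /asboolP /(edge_eqvP phi_orb act_edge)[o [lE loo h]].
  have [h1 h2] := h _ (edge_dom_int ht).
  exists (flip o (len e) t); last by apply/to_image_eq; rewrite h2.
  have -> : @len R M' e' = len e by exact: lE.
  exact: flip_int.
- move=> e /=; have [o ho] := re_eqv phi_orb act_edge e.
  exists (to_rep (@edge_image R Gamma n phi M) e), o; exact/dilates_eqv.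
Qed.

Lemma quotient_galois :
  galois_covering (M' := M') (to_image phi) to (fun _ : edge M => 1%N) qmult.
Proof.
split; first by []; split; first by move=> e'; exact: edge_stab_gt0.
exists (fun=> 1%N); split.
- exact: quotient_morphism.
- by [].
- have [single|nonsingle] := pselect (is_singleton (image_graph phi)).
    by left; split=> //; left; exact: singleton_image.
  (* The local degree is the order of the point stabilizer, so the sum over a fibre is given by
     [orbit_sum]. *)
  right; split=> //; exists (fun x => #|movers to x x|); split.
    move=> x; split=> [e1 _ e' o _ _|h' hx]; first exact: dvd1n.
    exact: local_degree.
  move=> p; have [x ->] := to_image_surj p; rewrite -(orbit_sum to x).
  congr (\sum_(_ \in _) _)%N; apply/funext => y; apply/propext.
  split=> [/to_image_eq /esym /phi_orb//|h]; apply/to_image_eq/esym; exact/phi_orb.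
- move=> x y; rewrite to_image_eq; exact: phi_orb.
- by move=> a e; have [e1 E] := act_edge_set a e; exists e1.
Qed.

Lemma loopless_source : loopless M.
Proof.
move=> e; apply/eqP => E.
have := len_gt0 e; rewrite -(phi_inj (edge_dom0 e) (edge_dom_len e) _) ?ltxx//.
by rewrite emap_src emap_tgt E.
Qed.

Lemma loopless_quotient : loopless M'.
Proof.
move=> e'; apply/eqP => E; set e : edge M := val e'.
have := len_gt0 e; rewrite -(phi_inj (edge_dom0 e) (edge_dom_len e) _) ?ltxx//.
apply/to_image_eq; rewrite -[LHS]/(emap M' e' 0%E) -[RHS]/(emap M' e' (len e')).
by rewrite emap_src emap_tgt E.
Qed.

Lemma qmultE (e : edge M) (e' : edge M') :
  to_image phi @` edge_set e = edge_set e' -> qmult e' = #|edge_stab to e|.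
Proof.
move=> E; have [t ht] := int_point e.
have : edge_set e' (to_image phi (emap M e t%:E)).
  by rewrite -E; exists (emap M e t%:E) => //; exists t%:E => //; exact: edge_dom_int.
move=> [s hs /to_image_eq sE].
have [o ho _] := edge_eqv_meet phi_orb act_edge ht (e1 := val e') hs (esym sE).
by rewrite /qmult -(edge_stab_eqv ho).
Qed.

End GaloisCount.

Lemma galois_covering_of_separation (R : realType) (Gamma : metricGraph R)
    (K : finGroupType) (to : {action K &-> Gamma}) (D : divisor Gamma)
    (n : nat) (f : 'I_n -> Gamma -> \bar R) (phi : Gamma -> TP R n) :
  acts_isometrically to -> effective D -> min_generating f (RDK to D) ->
  induced_map f phi ->
  (forall x y : Gamma, ~ (exists a : K, to x a = y) -> phi x <> phi y) ->
  exists (M : model (@dist R Gamma)) (M' : model (image_dist f phi))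
         (m' : edge M' -> nat),
    [/\ loopless M, loopless M',
        forall (e : edge M) (e' : edge M'),
          to_image phi @` edge_set e = edge_set e' -> m' e' = #|edge_stab to e|
      & galois_covering (to_image phi) to (fun _ : edge M => 1%N) m'].
Proof.
move=> iso D_ge0 f_gen phi_ind sep.
have [M [ref vert edges]] := adapted_exists iso D_ge0 f_gen phi_ind sep.
have [A hA] := choice edges; have [k hk] := choice hA.
have lin e j t : edge_dom e t ->
    f j (emap M e t) = ((A e j)%:E + ((k e j)%:~R : R)%:E * t)%E.
  by have [h _] := hk e; exact: h.
have gap e : exists j1 j2, k e j1 = k e j2 + 1 by have [_] := hk e.
have phi_orb := phi_orbitP iso f_gen phi_ind sep ref.
have phi_inj := phi_inj_edge f_gen phi_ind ref lin gap.
have act_nv := act_not_vertex vert.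
have act_edge := edge_act iso f_gen phi_ind ref vert lin gap.
have phi_inf (e e1 : edge M) (t : R) : len e = +oo%E -> edge_dom e1 t%:E ->
    phi (emap M e1 t%:E) <> phi (emap M e +oo%E).
  move=> le ht E; have inf : at_infinity (emap M e +oo%E).
    by apply/(at_infinityP ref); exists e.
  apply: (phi_infinite f_gen phi_ind ref lin gap inf); rewrite -E.
  by eexists; exact: (phi_real_edge f_gen phi_ind ref lin ht).
have qd := quotient_dist iso D_ge0 f_gen phi_ind sep ref lin gap phi_orb act_edge phi_inf.
have phi_cont := proj2 phi_ind.
exists M, (@qmodel R Gamma n phi K to M phi_cont phi_orb phi_inj act_nv act_edge phi_inf f qd).
exists (qmult (qdist := qd)); split.
- exact: loopless_source phi_inj.
- exact: loopless_quotient.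
- exact: qmultE.
- exact: quotient_galois.
Qed.

End InvariantLinearSystem.

Theorem theorem1p0p5 (R : realType) (Gamma : metricGraph R)
    (K : finGroupType) (to : {action K &-> Gamma}) (D : divisor Gamma)
    (n : nat) (f : 'I_n -> Gamma -> \bar R) (phi : Gamma -> TP R n) :
  acts_isometrically to ->
  effective D ->
  invariant_divisor to D ->
  min_generating f (RDK to D) ->
  induced_map f phi ->
  (exists (M : model (@dist R Gamma)) (M' : model (image_dist f phi))
          (m' : edge M' -> nat),
     [/\ loopless M, loopless M',
         forall (e : edge M) (e' : edge M'),
           (to_image phi @` edge_set e = edge_set e')%classic ->
           m' e' = #|edge_stab to e|
       & galois_covering (to_image phi) to (fun _ : edge M => 1%N) m'])
  <->
  (forall x y : Gamma,
     ~ (exists a : K, to x a = y) -> phi x <> phi y).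
Proof.
move=> iso D_ge0 D_inv f_gen phi_ind; split=> [[M [M' [m' [_ _ _ gal]]]] x y xy E|sep].
  case: gal => _ [_ [deg [_ _ _ fibres _]]]; apply: xy; apply/fibres.
  exact/InvariantLinearSystem.to_image_eq.
exact: InvariantLinearSystem.galois_covering_of_separation iso D_ge0 f_gen phi_ind sep.
Qed.
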